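(* Every $5$-connected claw-free graph $G$ of minimum degree at least $6$ is hamiltonian.
   Context: All graphs are finite and may contain parallel edges but no loops. A graph is claw-free if it does not contain an induced subgraph isomorphic to $K_{1,3}$. A graph is hamiltonian if it contains a Hamilton cycle, that is, a cycle through all its vertices.
   Formalization: Claw-free and minimum degree are read in the underlying simple graph (degree = number of distinct neighbours); with parallel edges read literally the claim fails, e.g. for K_{6,7} with every edge doubled. On simple graphs nothing changes. *)

(* Defs.v *)
From mathcomp Require Import all_boot.

Set Implicit Arguments.
Unset Strict Implicit.
Unset Printing Implicit Defensive.

(* Finite graphs, possibly with parallel edges, without loops. *)
Record mgraph := MGraph {
  vertex : finType;
  edge : finType;
  ends : edge -> {set vertex};
  card_ends : forall e, #|ends e| = 2 }.

Section Notions.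
Variable G : mgraph.

Definition adj : rel (vertex G) :=
  [rel x y | [exists e : edge G, ends e == [set x; y]]].

(* Degree and induced claws are read in the underlying simple graph (parallel
   edges identified); on graphs without parallel edges these are the usual
   notions.  Counting multiplicities in claws would make K_{6,7} with all edges
   doubled claw-free: it has no induced simple K_{1,3}, although it is
   6-connected, of large minimum degree and not hamiltonian.  Counting
   multiplicities in the degree would void any minimum degree condition, since
   all edges can be doubled without affecting the other notions. *)
Definition degree (x : vertex G) : nat := #|[set y | adj x y]|.

Definition min_degree_at_least (d : nat) : Prop :=
  forall x : vertex G, d <= degree x.

Definition adj_avoiding (S : {set vertex G}) : rel (vertex G) :=
  [rel x y | [&& x \notin S, y \notin S & adj x y]].

Definition k_connected (k : nat) : Prop :=
  k < #|vertex G| /\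
  forall S : {set vertex G}, #|S| < k ->
    forall x y, x \notin S -> y \notin S -> connect (adj_avoiding S) x y.

(* K_{1,3} on {0, 1, 2, 3}, with centre 0. *)
Definition claw_adj : rel 'I_4 := [rel i j | (i == ord0) != (j == ord0)].

Definition claw_free : Prop :=
  ~ exists f : 'I_4 -> vertex G,
      injective f /\ forall i j, adj (f i) (f j) = claw_adj i j.

(* The cyclic sequence (v_0, e_0), ..., (v_(n-1), e_(n-1)) encodes the closed
   walk v_0 e_0 v_1 ... v_(n-1) e_(n-1) v_0.  Distinctness of the edges only
   matters for n = 2, where a cycle consists of two parallel edges. *)
Definition is_cycle (c : seq (vertex G * edge G)) : Prop :=
  [/\ 1 < size c,
      cycle [rel p q | ends p.2 == [set p.1; q.1]] c,
      uniq [seq p.1 | p <- c]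
    & uniq [seq p.2 | p <- c]].

Definition hamiltonian : Prop :=
  exists c : seq (vertex G * edge G),
    is_cycle c /\ forall x : vertex G, x \in [seq p.1 | p <- c].

End Notions.

(* Main.v *)
Require Import Defs.
From mathcomp Require Import all_boot.
From mathcomp Require Import boolp zify.

(** Following Kaiser and Vrana, one passes to the closure of Ryjacek, which is
    claw-free with every neighbourhood a disjoint union of at most two cliques.
    Its maximal cliques of size at least 4 are the vertices of a hypergraph
    with hyperedges of size at most 3 (cliques of size 2 and 3 become
    hyperedges), and a Hamilton cycle arises from a closed trail visiting all
    vertices of the hypergraph and using at most two vertices of each hyperedge.

    Such a trail is found from a set [pi] of pairs, at most one inside each
    hyperedge, that forms a spanning tree and has a "tight" complement: an
    unused hyperedge can correct the parities of any two of its vertices, and a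
    used hyperedge [{a, b, c}] with pair [ab] can be switched to [ac] or [bc]
    without disconnecting the tree, which corrects the parity at [c] as soon as
    [a] and [b] are already linked by the complement.

    To find [pi], refine the vertex set alternately into the components of [pi]
    and of its complement, until the classes are stable.  If this sequence of
    partitions is lexicographically as coarse as possible, the complement is
    acyclic over the final partition: a redundant hyperedge of the complement
    could otherwise be exchanged into [pi].  Counting degrees shows that the
    final partition is trivial, since a cut of size 4 contains no hyperedge of
    size 3. *)

Set Implicit Arguments.
Unset Strict Implicit.
Unset Printing Implicit Defensive.

(** * Quasigraphs *)

(** Besides the small cliques, each vertex of the graph gives a hyperedge, the set of the one or two
    large cliques containing it.

    The numbers 5 and 6 enter as follows. A vertex of a clique with at most 6 vertices lies in a
    second maximal clique, and the two sizes sum to at least 6 + 2 = 8; in particular every vertex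
    lies in a large clique. A cut of at most 4 hyperedges gives at most 4 separating vertices, so
    5-connectivity leaves a single clique of 4 vertices on one side. Each of these vertices lies in
    a second large clique, so the cut has 4 hyperedges, all of size 2.

    The obstacle in the search for [pi] is a tame hyperedge with two vertices in one class and the
    third in another: it can be redundant between classes and yet be needed inside its class. Two
    additional kinds of steps, [SD] and [SL], drop such a hyperedge and refine further. *)

Section Relations.
Variable V : Type.
Implicit Types (R S G : V -> V -> Prop).

Definition relsub R S := forall x y, R x y -> S x y.

Definition is_equiv R :=
  [/\ forall x, R x x, forall x y, R x y -> R y x
    & forall x y z, R x y -> R y z -> R x z].

Inductive rtc G (x : V) : V -> Prop :=
| rtc_refl : rtc G x x
| rtc_step y z : rtc G x y -> G y z -> rtc G x z.

Lemma rtc_trans G x y z : rtc G x y -> rtc G y z -> rtc G x z.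
Proof. by move=> xy; elim=> [//|a b _ IH]; apply: rtc_step. Qed.

Lemma rtc1 G x y : G x y -> rtc G x y.
Proof. by move=> g; apply: rtc_step g; apply: rtc_refl. Qed.

Lemma rtc_sym G : (forall x y, G x y -> G y x) ->
  forall x y, rtc G x y -> rtc G y x.
Proof.
move=> sG x y; elim=> [|a b _ IH /sG g]; first exact: rtc_refl.
exact: rtc_trans (rtc1 g) IH.
Qed.

Lemma rtc_sub G S : is_equiv S -> relsub G S -> relsub (rtc G) S.
Proof.
case=> Sr _ St GS x y; elim=> [|a b _ IH /GS g]; [exact: Sr | exact: St g].
Qed.

Lemma rtc_mono G H : (forall x y, G x y -> rtc H x y) -> relsub (rtc G) (rtc H).
Proof.
move=> GH x y; elim=> [|a b _ IH /GH g]; [exact: rtc_refl | exact: rtc_trans g].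
Qed.

Lemma rtc_equiv G : (forall x y, G x y -> G y x) -> is_equiv (rtc G).
Proof.
by move=> sG; split; [apply: rtc_refl | apply: rtc_sym | apply: rtc_trans].
Qed.

Lemma rel_eqP R S : relsub R S -> relsub S R -> R = S.
Proof.
by move=> RS SR; apply/funext => x; apply/funext => y; apply/propext; split; [apply: RS|apply: SR].
Qed.

End Relations.

Section Quasigraph.
Variables (V E : finType) (hy : E -> {set V}).
Hypothesis hy3 : forall e, #|hy e| <= 3.

Notation Rel := (V -> V -> Prop).
Notation quasi := ({ffun E -> {set V}}).
Implicit Types (R S : Rel) (pi : quasi) (A B : {set E}).

Definition full : Rel := fun _ _ => True.

Definition wf pi := forall e, pi e \subset hy e /\
  (pi e = set0 \/ exists a b, a <> b /\ pi e = [set a; b]).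

(* Over the partition [R], the tame hyperedges are those of the complement of
   [pi]: a pair of [pi] inside a class is contracted. *)
Definition tame pi R e := forall a b, a \in pi e -> b \in pi e -> R a b.

Definition Tstep pi A R : Rel := fun x y =>
  R x y /\ exists f, [/\ f \in A, x \in pi f & y \in pi f].
Definition Tconn pi A R : Rel := rtc (Tstep pi A R).

(* An unused hyperedge ([pi e = set0]) links all its vertices; a used one links
   its third vertex as soon as its two chosen vertices are linked.  If [Kconn]
   relates all vertices, [pi] has tight complement in the sense of Kaiser and
   Vrana. *)
Inductive Kconn pi A R : Rel :=
| K_refl x : Kconn pi A R x x
| K_sym x y : Kconn pi A R x y -> Kconn pi A R y x
| K_trans x y z : Kconn pi A R x y -> Kconn pi A R y z -> Kconn pi A R x z
| K_rule e x y : e \in A ->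
    (forall a b, a \in pi e -> b \in pi e -> Kconn pi A R a b) ->
    x \in hy e -> y \in hy e -> R x y -> Kconn pi A R x y.

(** The complement of [pi] without [e], with the classes of [R] contracted. The relation [S] is a
    coarser, earlier partition whose classes must not be left; leaving out [e] makes this a test of
    redundancy of [e]. *)
Definition Lstep pi R S e : Rel := fun x y =>
  R x y \/ exists f, [/\ f <> e, tame pi R f, x \in hy f, y \in hy f & S x y].
Definition Lconn pi R S e : Rel := rtc (Lstep pi R S e).

Definition forest pi := forall f a b,
  a \in pi f -> b \in pi f -> a <> b -> ~ Tconn pi [set~ f] full a b.

Lemma full_equiv : is_equiv full. Proof. by []. Qed.

Lemma T_equiv pi A R : is_equiv R -> is_equiv (Tconn pi A R).
Proof.
case=> _ Rs _; apply: rtc_equiv => x y [/Rs ? [f [? ? ?]]].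
by split=> //; exists f.
Qed.

Lemma K_equiv pi A R : is_equiv (Kconn pi A R).
Proof. by split; [apply: K_refl | apply: K_sym | apply: K_trans]. Qed.

Lemma L_equiv pi R S e : is_equiv R -> is_equiv S ->
  is_equiv (Lconn pi R S e).
Proof.
case=> _ Rs _ [_ Ss _]; apply: rtc_equiv => x y [/Rs ?|[f [? ? ? ? /Ss ?]]].
  by left.
by right; exists f.
Qed.

Lemma T_sub pi A R : is_equiv R -> relsub (Tconn pi A R) R.
Proof. by move=> eR; apply: rtc_sub => // x y []. Qed.

Lemma K_sub pi A R : is_equiv R -> relsub (Kconn pi A R) R.
Proof.
case=> Rr Rs Rt x y; elim=> //; first by move=> a b _; apply: Rs.
by move=> a b c _ ab _; apply: Rt.
Qed.

Lemma T_mono pi A B R S :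
  (forall f x y, f \in A -> x \in pi f -> y \in pi f -> R x y -> x <> y ->
     f \in B /\ S x y) -> relsub (Tconn pi A R) (Tconn pi B S).
Proof.
move=> AB; apply: rtc_mono => x y [Rxy [f [fA xf yf]]].
have [->|/eqP xy] := eqVneq x y; first exact: rtc_refl.
by have [? ?] := AB f x y fA xf yf Rxy xy; apply: rtc1; split=> //; exists f.
Qed.

Lemma T_edge pi A R f x y : f \in A -> x \in pi f -> y \in pi f -> R x y ->
  Tconn pi A R x y.
Proof. by move=> fA xf yf Rxy; apply: rtc1; split=> //; exists f. Qed.

(** Several uses of the pair of [g] collapse to at most one: a further use that ends at [p] makes
    the earlier one a detour, and a use that ends at [q] replaces it. *)
Lemma T_split pi A R g x y : wf pi -> Tconn pi A R x y ->
  Tconn pi (A :\ g) R x y \/ exists p q,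
   [/\ [/\ g \in A, p \in pi g, q \in pi g & p <> q], R p q,
       Tconn pi (A :\ g) R x p & Tconn pi (A :\ g) R q y].
Proof.
move=> wfp; elim=> [|y' z xy IH [Ryz [f [fA yf zf]]]]; first by left; apply: rtc_refl.
have [fg|fg] := eqVneq f g; last first.
  have yz : Tconn pi (A :\ g) R y' z by apply: (@T_edge _ _ _ f); rewrite // !inE fg.
  case: IH => [xy'|[p [q [? ? xp qy]]]]; first by left; apply: rtc_trans yz.
  by right; exists p, q; split=> //; apply: rtc_trans yz.
have [eyz|/eqP nyz] := eqVneq y' z; first by rewrite -eyz.
rewrite {}fg in fA yf zf.
case: IH => [xy'|[p [q [[? pg qg npq] Rpq xp qy]]]].
  by right; exists y', z; split=> //; apply: rtc_refl.
have [_ [gp0|[a [b [nab gab]]]]] := wfp g; first by rewrite gp0 inE in pg.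
have pg1 := pg; have qg1 := qg; move: zf yf pg qg; rewrite !gab !inE.
have [->|zp] := eqVneq z p; first by left.
have [->|zq] := eqVneq z q.
  by right; exists p, q; split=> //; [split; rewrite -?gab | apply: rtc_refl].
move=> /orP[] /eqP ez /orP[] /eqP ey /orP[] /eqP ep /orP[] /eqP eq; subst; try (by rewrite eqxx in zp); try (by rewrite eqxx in zq); by [].
Qed.

Lemma K_mono pi A R S : is_equiv R -> relsub R S -> relsub (Kconn pi A R) (Kconn pi A S).
Proof.
move=> eR RS x y; elim.
- by move=> a; apply: K_refl.
- by move=> a b _; apply: K_sym.
- by move=> a b c _ ab _; apply: K_trans.
- by move=> e a b eA _ IH ae be Rab; apply: (@K_rule _ _ _ e) => //; apply: RS.
Qed.

(** Smaller pairs only weaken the premise of the rule. Since the hypothesis concerns distinct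
    related vertices only, [B] may omit hyperedges that meet every class of [R] at most once. *)
Lemma K_transport pi pi2 A B R S : relsub R S ->
  (forall e x y, e \in A -> x \in hy e -> y \in hy e -> R x y -> x <> y ->
     e \in B /\ pi2 e \subset pi e) ->
  relsub (Kconn pi A R) (Kconn pi2 B S).
Proof.
move=> RS AB x y; elim.
- by move=> a; apply: K_refl.
- by move=> a b _; apply: K_sym.
- by move=> a b c _ ab _; apply: K_trans.
- move=> e a b eA _ IH ae be Rab.
  have [->|/eqP nab] := eqVneq a b; first exact: K_refl.
  have [eB /subsetP sub] := AB e a b eA ae be Rab nab.
  by apply: (@K_rule _ _ _ e) => // [c d /sub ? /sub ?|]; [apply: IH | apply: RS].
Qed.

(** Only [h] may acquire a new pair, and as the new pair is already linked, the rule for [h] remains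
    applicable. *)
Lemma K_change pi pi2 A S h :
  (forall e, e <> h -> pi2 e \subset pi e) ->
  (forall a b, a \in pi2 h -> b \in pi2 h -> Kconn pi2 A S a b) ->
  relsub (Kconn pi A S) (Kconn pi2 A S).
Proof.
move=> sub hh x y; elim.
- by move=> a; apply: K_refl.
- by move=> a b _; apply: K_sym.
- by move=> a b c _ ab _; apply: K_trans.
- move=> e a b eA _ IH ae be Rab.
  have [->|/eqP nab] := eqVneq a b; first exact: K_refl.
  apply: (@K_rule _ _ _ e) => // c d; have [->|/eqP eh] := eqVneq e h; first exact: hh.
  by move=> /(subsetP (sub e eh)) ce /(subsetP (sub e eh)) de; apply: IH.
Qed.

(** The pair of a tame hyperedge lies in a class of [R], so it is linked and the rule of [Kconn]
    applies. *)
Lemma L_sub_K pi R S e : is_equiv R -> is_equiv S -> relsub R S ->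
  relsub R (Kconn pi [set~ e] S) -> relsub (Lconn pi R S e) (Kconn pi [set~ e] S).
Proof.
move=> eR eS RS RK; apply: rtc_sub; first exact: K_equiv.
move=> x y [/RK //|[f [fe tf xf yf Sxy]]].
apply: (@K_rule _ _ _ f) => //; first by rewrite !inE; apply/eqP.
by move=> a b af bf; apply: RK; apply: tf.
Qed.

End Quasigraph.

(** * Refining the partition *)

Section Traces.
Variables (V E : finType) (hy : E -> {set V}).
Hypothesis hy3 : forall e, #|hy e| <= 3.

Notation Rel := (V -> V -> Prop).
Notation quasi := ({ffun E -> {set V}}).
Implicit Types (pi : quasi) (A B : {set E}).
Local Notation Kconn := (Kconn hy).
Local Notation Lconn := (Lconn hy).
Local Notation wf := (wf hy).
Local Notation full := (@full V).

Lemma pair_tame pi S g p q : wf pi -> is_equiv S ->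
  p \in pi g -> q \in pi g -> p <> q -> S p q -> tame pi S g.
Proof.
move=> wfp [Sr Ss _]; rewrite /tame; have [_ [->|[a [b [nab ->]]]]] := wfp g; first by rewrite inE.
rewrite !inE => pg qg npq Spq x y; rewrite !inE.
by move: pg qg => /orP[] /eqP ep /orP[] /eqP eq; subst => // /orP[] /eqP -> /orP[] /eqP ->; auto.
Qed.

(** In a forest the connection between [u] and [v] is unique. If none of the hyperedges that are
    tame over [R] but not over [S] were essential, they could be deleted one after the other, and
    what remains would connect [u] and [v] over [S]. *)
Lemma T_crossing pi R S u v : wf pi -> forest pi ->
  is_equiv R -> is_equiv S ->
  Tconn pi setT R u v -> ~ Tconn pi setT S u v ->
  exists g p q, [/\ [/\ p \in pi g, q \in pi g & p <> q], tame pi R g,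
    ~ tame pi S g, Tconn pi [set~ g] R u p & Tconn pi [set~ g] R q v].
Proof.
move=> wfp fp eR eS Ruv nSuv.
have setTD g : setT :\ g = [set~ g] :> {set E} by apply/setP => x; rewrite !inE andbT.
have [g [[nSg Rg] nuv]] : exists g, (~ tame pi S g /\ tame pi R g) /\ ~ Tconn pi [set~ g] R u v.
  apply: contrapT => no; apply: nSuv.
  have bad g : ~ tame pi S g -> tame pi R g -> Tconn pi [set~ g] R u v.
    by move=> nS tR; apply: contrapT => n; apply: no; exists g.
  suff rem (s : seq E) : (forall g, g \in s -> ~ tame pi S g /\ tame pi R g) ->
      Tconn pi (~: [set x in s]) R u v.
    pose X := [seq g <- enum E | `[< ~ tame pi S g /\ tame pi R g >]].
    have /T_mono : Tconn pi (~: [set x in X]) R u v.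
      by apply: rem => g; rewrite mem_filter => /andP[/asboolP].
    apply=> f x y; rewrite !inE mem_filter mem_enum andbT => /asboolP nf xf yf Rxy nxy.
    split=> //; apply: contrapT => nSxy; apply: nf; split.
      by move=> /(_ x y xf yf).
    exact: (pair_tame wfp eR xf yf nxy).
  elim: s => [_|g s IH bs].
    by rewrite (_ : ~: _ = setT) //; apply/setP => x; rewrite !inE.
  have /IH uv : forall x, x \in s -> ~ tame pi S x /\ tame pi R x.
    by move=> x xs; apply: bs; rewrite inE xs orbT.
  rewrite (_ : ~: _ = ~: [set x in s] :\ g); last first.
    by apply/setP => x; rewrite !inE negb_or.
  (* If this deletion cut the connection, the other connection avoiding [g], given by [bad], would
     join [p] to [q] and close a cycle. *)
  case: (T_split g wfp uv) => // -[p [q [[_ pg qg npq] Rpq up qv]]].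
  have [nSg Rg] : ~ tame pi S g /\ tame pi R g by apply: bs; rewrite mem_head.
  case: (fp g p q pg qg npq).
  have sub : relsub (Tconn pi (~: [set x in s] :\ g) R) (Tconn pi [set~ g] full).
    by apply: T_mono => f x y; rewrite !inE => /andP[].
  have sub' : relsub (Tconn pi [set~ g] R) (Tconn pi [set~ g] full) by apply: T_mono.
  have [_ sy tr] := T_equiv pi [set~ g] (full_equiv V).
  apply: (tr _ u); first by apply: sy; apply: sub.
  by apply: (tr _ v); [apply: sub'; apply: bad | apply: sy; apply: sub].
case: (T_split g wfp Ruv); rewrite setTD // => -[p [q [[_ pg qg npq] Rpq up qv]]].
by exists g, p, q.
Qed.

(** If only the two vertices of its pair share a class, the rule for [f] derives nothing but its own
    premise. *)
Lemma K_drop pi A R f :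
  (forall x y, x \in hy f -> y \in hy f -> R x y -> x = y \/ x \in pi f /\ y \in pi f) ->
  relsub (Kconn pi A R) (Kconn pi (A :\ f) R).
Proof.
move=> ff x y; elim.
- by move=> a; apply: K_refl.
- by move=> a b _; apply: K_sym.
- by move=> a b c _ ab _; apply: K_trans.
- move=> e a b eA _ IH ae be Rab.
  have [ef|ef] := eqVneq e f; last by apply: (K_rule (e := e)); rewrite // !inE ef.
  subst e; case: (ff a b ae be Rab) => [->|[af bf]]; first exact: K_refl.
  exact: IH.
Qed.

Lemma K_drop_related pi A R f :
  (forall x y, x \in hy f -> y \in hy f -> R x y -> Kconn pi (A :\ f) R x y) ->
  relsub (Kconn pi A R) (Kconn pi (A :\ f) R).
Proof.
move=> ff x y; elim.
- by move=> a; apply: K_refl.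
- by move=> a b _; apply: K_sym.
- by move=> a b c _ ab _; apply: K_trans.
- move=> e a b eA _ IH ae be Rab.
  have [ef|ef] := eqVneq e f; last by apply: (K_rule (e := e)); rewrite // !inE ef.
  by subst e; apply: ff.
Qed.

Lemma L_mono pi pi2 R S e : (forall f, tame pi R f -> tame pi2 R f) ->
  relsub (Lconn pi R S e) (Lconn pi2 R S e).
Proof.
move=> tt; apply: rtc_mono => x y [?|[f [? /tt ? ? ? ?]]]; apply: rtc1; first by left.
by right; exists f.
Qed.

(* A partition is refined into the components of [pi] ([ST]), of its complement
   ([SK]), of its complement without a hyperedge [e] ([SD e]) or of [pi] without
   a hyperedge [f] ([SL f]).  The last two steps concern hyperedges which serve
   both inside a class and between classes. *)
Inductive step := ST | SK | SD of E | SL of E.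
Definition TL k := match k with ST | SL _ => true | _ => false end.
Definition rank k := match k with ST => 0 | SK => 1 | _ => 2 end.

Section Steps.
Variables (R : nat -> Rel) (kd : nat -> step).

(* The hyperedge [e] is redundant in the complement at a former stage, where
   [x] and [y] were then separated for lack of pairs of [pi]: once [e] is not
   needed inside its class, it may provide the pair [{x, y}]. *)
Definition release pi i e x y :=
  exists s, [/\ s < i, TL (kd s), R s x y, ~ R s.+1 x y & Lconn pi (R i) (R s) e x y].

Definition valid_step pi i (R1 : Rel) :=
  match kd i with
  | ST => R1 = Tconn pi setT (R i) /\ R1 <> R i
  | SK => [/\ Tconn pi setT (R i) = R i, R1 = Kconn pi setT (R i) & R1 <> R i]
  | SD e => [/\ Tconn pi setT (R i) = R i /\ Kconn pi setT (R i) = R i, pi e = set0,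
      R1 = Kconn pi [set~ e] (R i),
      forall x y, x \in hy e -> y \in hy e -> R1 x y -> x = y
      & exists x y z, [/\ x \in hy e, y \in hy e, z \in hy e,
          R i x z /\ x <> z & release pi i e x y]]
  | SL f => [/\ Tconn pi setT (R i) = R i, Kconn pi setT (R i) = R i,
      R1 = Tconn pi [set~ f] (R i)
      & exists a b c, [/\ pi f = [set a; b], a <> b, R i a b, c \in hy f
          & release pi i f a c]]
  end.

Definition valid pi t := R 0 = full /\ forall i, i < t -> valid_step pi i (R i.+1).

Lemma valid_equiv pi t : valid pi t -> forall i, i <= t -> is_equiv (R i).
Proof.
case=> R0 okp; elim=> [|i IH] it; first by rewrite R0; apply: full_equiv.
have eR := IH (ltnW it); move: (okp i it); rewrite /valid_step.
case: (kd i) => [[-> _]|[_ -> _]|e [_ _ -> _ _]|f [_ _ -> _]];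
  by first [apply: T_equiv | apply: K_equiv].
Qed.

Lemma ok_sub pi i R1 : is_equiv (R i) -> valid_step pi i R1 -> relsub R1 (R i).
Proof.
move=> eR; rewrite /valid_step.
case: (kd i) => [[-> _]|[_ -> _]|e [_ _ -> _ _]|f [_ _ -> _]];
  by first [apply: T_sub | apply: K_sub].
Qed.

Lemma valid_sub pi t : valid pi t -> forall i j, i <= j <= t -> relsub (R j) (R i).
Proof.
move=> va i j /andP[]; elim: j => [|j IH]; first by rewrite leqn0 => /eqP -> _ x y.
rewrite leq_eqVlt => /orP[/eqP -> _ x y //|ij] jt.
have ji := IH ij (ltnW jt); move=> x y /(ok_sub (valid_equiv va (ltnW jt)) (proj2 va j jt)).
exact: ji.
Qed.

(* The least rank of a step that refines [R1]. *)
Definition stage pi (R1 : Rel) : nat :=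
  if `[< Tconn pi setT R1 = R1 >] then
    if `[< Kconn pi setT R1 = R1 >] then 2 else 1
  else 0.

Definition relcard (R1 : Rel) := #|[set p : V * V | `[< R1 p.1 p.2 >]]|.

Lemma relcard_lt R1 R2 : relsub R1 R2 -> R1 <> R2 -> relcard R1 < relcard R2.
Proof.
move=> R12 ne; apply: proper_card; apply/properP; split.
  by apply/subsetP => -[x y]; rewrite !inE => /asboolP /R12 ?; apply/asboolP.
have [x [y [R2xy nR1]]] : exists x y, R2 x y /\ ~ R1 x y.
  apply: contrapT => no; apply: ne; apply: rel_eqP => // x y R2xy.
  by apply: contrapT => n; apply: no; exists x, y.
by exists (x, y); rewrite inE; [apply/asboolP | apply/asboolPn].
Qed.

(** The trace is kept up to stage [i] but supported by another quasigraph. Either it then stops at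
    [i], where only steps of larger rank are left, or it takes a step of the same kind to a coarser
    partition; both increase the lexicographic order. *)
Definition improvable t := exists i pi, [/\ i < t, wf pi /\ forest pi, valid pi i
  & rank (kd i) < stage pi (R i) \/
    exists R1, valid_step pi i R1 /\ relcard (R i.+1) < relcard R1].

End Steps.

Section Swap.
Variables (pi : quasi) (h g : E) (u v : V).
Definition swap : quasi := [ffun e => if e == h then [set u; v]
                            else if e == g then set0 else pi e].

Lemma swap_h : swap h = [set u; v]. Proof. by rewrite ffunE eqxx. Qed.

Lemma swap_g : h <> g -> swap g = set0.
Proof. by move/eqP => hg; rewrite ffunE eq_sym (negbTE hg) eqxx. Qed.

Lemma swap_other e : e <> h -> e <> g -> swap e = pi e.
Proof. by move=> /eqP eh /eqP eg; rewrite ffunE (negbTE eh) (negbTE eg). Qed.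

Lemma swap_sub e : e <> h -> swap e \subset pi e.
Proof.
by move=> /eqP eh; rewrite ffunE (negbTE eh); case: ifP; rewrite ?sub0set.
Qed.

Hypothesis wfp : wf pi.
Hypothesis uh : u \in hy h.
Hypothesis vh : v \in hy h.
Hypothesis nuv : u <> v.
Hypothesis h0 : pi h = set0.

Lemma swap_wf : wf swap.
Proof.
move=> e; rewrite ffunE; have [->|eh] := eqVneq e h.
  split; last by right; exists u, v.
  by apply/subsetP => x; rewrite !inE => /orP[] /eqP ->.
by case: ifP => _; [split; [apply: sub0set | left] | apply: wfp].
Qed.

Lemma swap_tame R f : R u v -> is_equiv R -> tame pi R f -> tame swap R f.
Proof.
move=> Ruv [Rr Rs _] tf; have [->|/eqP fh] := eqVneq f h.
  by move=> a b; rewrite swap_h !inE => /orP[] /eqP -> /orP[] /eqP ->; auto.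
by move=> a b /(subsetP (swap_sub fh)) ? /(subsetP (swap_sub fh)) ?; apply: tf.
Qed.

Variables (p q : V).
Hypothesis pg : p \in pi g.
Hypothesis qg : q \in pi g.
Hypothesis npq : p <> q.

Lemma swap_hg : h <> g. Proof. by move=> hg; move: pg; rewrite -hg h0 inE. Qed.

(** The connections from [u] to [p] and from [q] to [v] survive the exchange, and with them each of
    the pairs [uv] and [pq] can replace the other. *)
Lemma T_swap A S : is_equiv S -> h \in A -> g \in A -> S u v -> S p q ->
  Tconn pi (A :\ g) S u p -> Tconn pi (A :\ g) S q v -> Tconn swap A S = Tconn pi A S.
Proof.
move=> eS hA gA Suv Spq up qv.
have sub : relsub (Tconn pi (A :\ g) S) (Tconn pi A S).
  by apply: T_mono => f x y; rewrite !inE => /andP[].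
have sub2 : relsub (Tconn pi (A :\ g) S) (Tconn swap A S).
  apply: rtc_mono => x y [Sxy [f [fA xf yf]]]; move: fA; rewrite !inE => /andP[/eqP fg fA].
  apply: (@T_edge _ _ _ _ _ f) => //; rewrite swap_other // => fh;
    by move: xf; rewrite fh h0 inE.
have [_ sy tr] := T_equiv pi A eS; have [_ sy2 tr2] := T_equiv swap A eS.
apply: rel_eqP; apply: rtc_mono => x y [Sxy [f [fA xf yf]]].
  have [fh|/eqP fh] := eqVneq f h; last first.
    by apply: (@T_edge _ _ _ _ _ f) => //; apply: (subsetP (swap_sub fh)).
  have Tuv : Tconn pi A S u v.
    by apply: (tr _ p); [apply: sub | apply: (tr _ q); [apply: (@T_edge _ _ _ _ _ g) | apply: sub]].
  move: xf yf; rewrite {}fh swap_h !inE.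
  by move=> /orP[] /eqP -> /orP[] /eqP ->; [apply: rtc_refl | | apply: sy | apply: rtc_refl].
have [fg|/eqP fg] := eqVneq f g; last first.
  apply: (@T_edge _ _ _ _ _ f) => //; rewrite swap_other // => fh;
    by move: xf; rewrite fh h0 inE.
have Tpq : Tconn swap A S p q.
  apply: (tr2 _ u); first by apply: sy2; apply: sub2.
  apply: (tr2 _ v); last by apply: sy2; apply: sub2.
  by apply: (@T_edge _ _ _ _ _ h) => //; rewrite swap_h !inE eqxx ?orbT.
by subst f; apply: (pair_tame wfp (T_equiv swap A eS) pg qg).
Qed.

(** Deleting [g] separates [p] from [q], hence [u] from [v]. A cycle after the exchange would have
    to use the new pair, and the rest of it would connect [u] and [v] without [g]. *)
Lemma swap_forest : forest pi ->
  Tconn pi [set~ g] full u p -> Tconn pi [set~ g] full q v -> forest swap.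
Proof.
move=> fp up qv f a b af bf nab Tab; have hg := swap_hg.
have [_ sy tr] := T_equiv pi [set~ g] (full_equiv V).
have [fh|/eqP fh] := eqVneq f h.
  have uv : Tconn pi [set~ g] full u v.
    subst f; have sub : relsub (Tconn swap [set~ h] full) (Tconn pi [set~ g] full).
      apply: rtc_mono => x y [_ [f [fA xf yf]]].
      have [fg|/eqP fg] := eqVneq f g; first by move: xf; rewrite fg swap_g // inE.
      move: fA; rewrite !inE => /eqP fh; rewrite swap_other // in xf yf.
      by apply: (@T_edge _ _ _ _ _ f) => //; rewrite !inE; apply/eqP.
    suff : Tconn swap [set~ h] full u v by apply: sub.
    have [_ sy2 _] := T_equiv swap [set~ h] (full_equiv V).
    move: af bf nab Tab; rewrite swap_h !inE.
    by move=> /orP[] /eqP -> /orP[] /eqP -> nab Tab //; apply: sy2.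
  by case: (fp g p q pg qg npq); apply: (tr _ u); [apply: sy | apply: (tr _ v) => //; apply: sy].
have [fg|/eqP fg] := eqVneq f g; first by move: af; rewrite fg swap_g // inE.
rewrite swap_other // in af bf.
have sub : relsub (Tconn swap ([set~ f] :\ h) full) (Tconn pi ([set~ f] :\ g) full).
  apply: rtc_mono => x y [_ [e [eA xe ye]]].
  have [eg|/eqP eg] := eqVneq e g; first by move: xe; rewrite eg swap_g // inE.
  move: eA; rewrite !inE => /andP[/eqP eh ef]; rewrite swap_other // in xe ye.
  by apply: (@T_edge _ _ _ _ _ e) => //; rewrite !inE ef andbT; apply/eqP.
have subf : relsub (Tconn pi ([set~ f] :\ g) full) (Tconn pi [set~ f] full).
  by apply: T_mono => e x y; rewrite !inE => /andP[].
have subg : relsub (Tconn pi ([set~ f] :\ g) full) (Tconn pi [set~ g] full).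
  by apply: T_mono => e x y; rewrite !inE => /andP[? ?].
case: (T_split h swap_wf Tab) => [/sub /subf|[c [d [[_ ch dh ncd] _ /sub ac /sub db]]]].
  exact: fp.
have eab : Tconn pi [set~ g] full a b.
  by apply: (@T_edge _ _ _ _ _ f) => //; rewrite !inE; apply/eqP.
have uv : Tconn pi [set~ g] full u v.
  have cd : Tconn pi [set~ g] full c d.
    apply: (tr _ a); first by apply: sy; apply: subg.
    by apply: (tr _ b) => //; apply: sy; apply: subg.
  move: ch dh ncd cd; rewrite swap_h !inE.
  by move=> /orP[] /eqP -> /orP[] /eqP -> ncd cd //; apply: sy.
by case: (fp g p q pg qg npq); apply: (tr _ u); [apply: sy | apply: (tr _ v) => //; apply: sy].
Qed.

End Swap.

End Traces.

Lemma set3_cover (V : finType) (A : {set V}) x y z w : #|A| <= 3 ->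
  x \in A -> y \in A -> z \in A -> x <> y -> x <> z -> y <> z -> w \in A ->
  [\/ w = x, w = y | w = z].
Proof.
move=> A3 xA yA zA /eqP xy /eqP xz /eqP yz wA; apply: contrapT => no.
have u4 : uniq [:: w; x; y; z].
  rewrite /= !inE !negb_or xy xz yz !andbT.
  by apply/and3P; split; apply/eqP => e; apply: no; [constructor 1|constructor 2|constructor 3].
suff : 4 <= #|A| by move/leq_trans/(_ A3).
have <- : #|[:: w; x; y; z]| = 4 by apply/card_uniqP.
apply: subset_leq_card; apply/subsetP => c.
by rewrite !inE => /or4P[] /eqP ->.
Qed.

(** * Inserting a redundant hyperedge into the quasigraph *)

Section Insertion.
Variables (V E : finType) (hy : E -> {set V}).
Hypothesis hy3 : forall e, #|hy e| <= 3.

Notation Rel := (V -> V -> Prop).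
Notation quasi := ({ffun E -> {set V}}).
Implicit Types (pi : quasi) (A B : {set E}).
Local Notation Kconn := (Kconn hy).
Local Notation Lconn := (Lconn hy).
Local Notation wf := (wf hy).
Local Notation full := (@full V).
Local Notation valid := (valid hy).
Local Notation release := (release hy).

Variables (R : nat -> Rel) (kd : nat -> step E) (t : nat).
Local Notation improvable := (improvable hy R kd t).

Lemma release_swap pi h g u v i e x y : (forall j, j <= i -> is_equiv (R j)) ->
  R i u v -> release R kd pi i e x y -> release R kd (swap pi h g u v) i e x y.
Proof.
move=> eR Ruv [s [si TLs Rs nRs Lxy]]; exists s; split=> //.
by apply: L_mono Lxy => f; apply: swap_tame => //; apply: eR.
Qed.

(** If the complement no longer refines [R i] at all, the gain lies in the stage, which becomes 2
    and exceeds the rank of [SK]; otherwise it lies in the coarser classes. *)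
Lemma improve_K pi i : i < t -> wf pi -> forest pi -> valid R kd pi i ->
  kd i = SK E -> Tconn pi setT (R i) = R i -> relsub (R i.+1) (Kconn pi setT (R i)) ->
  R i.+1 <> Kconn pi setT (R i) -> improvable.
Proof.
move=> it wfp fp va kdi Ts sub ne; exists i, pi; split=> //.
have [Ks|Ks] := pselect (Kconn pi setT (R i) = R i).
  by left; rewrite kdi /stage !asboolT.
right; exists (Kconn pi setT (R i)); split; last exact: relcard_lt.
by rewrite /valid_step kdi; split.
Qed.

(* Let [j] be the last stage at which [u] and [v] are connected by [pi], and [g]
   the edge whose pair is separated next on the way from [u] to [v].  Exchange
   [g] for [h] in [pi].  If stage [j] is followed by a step of the complement,
   the latter now has larger classes, unless [e] of a step [SD e] has become
   redundant; if it is followed by [SL g], then [g] is redundant.  A redundant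
   hyperedge is in turn inserted at the former stage given by [release]. *)
Lemma insert s : s < t -> forall pi, wf pi -> forest pi ->
  valid R kd pi s.+1 -> TL (kd s) -> forall h u v, pi h = set0 ->
  u \in hy h -> v \in hy h -> R s u v -> ~ R s.+1 u v ->
  Kconn pi [set~ h] (R s) u v -> improvable.
Proof.
elim/ltn_ind: s => s IHs st pi wfp fp va TLs h u v h0 uh vh Rsuv nRsuv Kuv.
have eR i : i <= s.+1 -> is_equiv (R i) by apply: (valid_equiv va).
have nuv : u <> v by move=> uv; apply: nRsuv; rewrite uv; case: (eR s.+1 (leqnn _)).
have subR i j : i <= j -> j <= s.+1 -> relsub (R j) (R i).
  by move=> ij js; apply: (valid_sub va); rewrite ij.
have R0 : R 0 = full by case: va.
have okp i : i <= s -> valid_step hy R kd pi i (R i.+1) by move=> is_; apply: (proj2 va).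
(* If [pi] does not connect [u] and [v] at all, the first step can only be [ST], which already
   separates them; thus [s = 0], and the pair can be added without removing another one. *)
have [T0uv|nT0uv] := pselect (Tconn pi setT (R 0) u v); last first.
  have kd0 : kd 0 = ST E /\ s = 0.
    have := okp 0 (leq0n s); rewrite /valid_step.
    have notT : Tconn pi setT (R 0) = R 0 -> False by move=> e; apply: nT0uv; rewrite e R0.
    case e0: (kd 0) => [|||] => [[R1 _]|[/notT //]|[[/notT //]]|[/notT //]].
    split=> //; apply/eqP; rewrite -leqn0 leqNgt; apply/negP => s0.
    by apply: nT0uv; rewrite -R1; apply: (subR 1 s).
  case: kd0 => kd0 s0; subst s.
  (* With [g = h] the exchange is a pure addition, as [swap] tests for [h] first. *)
  pose pi1 : quasi := swap pi h h u v.
  have pi1h : pi1 h = [set u; v] by rewrite swap_h.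
  have pi1o e : e <> h -> pi1 e = pi e by move=> eh; rewrite swap_other.
  have wf1 : wf pi1 by apply: swap_wf.
  have sub1 A : relsub (Tconn pi A full) (Tconn pi1 A full).
    apply: rtc_mono => x y [_ [f [fA xf yf]]].
    apply: (@T_edge _ _ _ _ _ f) => //; rewrite pi1o // => fh;
      by move: xf; rewrite fh h0 inE.
  have subh : relsub (Tconn pi1 [set~ h] full) (Tconn pi [set~ h] full).
    apply: rtc_mono => x y [_ [f [fA xf yf]]]; move: (fA); rewrite !inE => /eqP fh.
    by apply: (@T_edge _ _ _ _ _ f) => //; rewrite -pi1o.
  have setTf A : relsub (Tconn pi A full) (Tconn pi setT full) by apply: T_mono.
  have nT : ~ Tconn pi setT full u v by rewrite -R0.
  have [_ syT trT] := T_equiv pi setT (full_equiv V).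
  have f1 : forest pi1.
    move=> f a b af bf nab Tab.
    have [fh|/eqP fh] := eqVneq f h.
      have : Tconn pi setT full a b by subst f; apply: setTf (subh _ _ Tab).
      move: af bf nab; rewrite {}fh pi1h !inE.
      by move=> /orP[] /eqP -> /orP[] /eqP -> // _ /syT /nT.
    rewrite pi1o // in af bf.
    have subfh : relsub (Tconn pi1 ([set~ f] :\ h) full) (Tconn pi [set~ f] full).
      apply: rtc_mono => x y [_ [e [eA xe ye]]]; move: eA; rewrite !inE => /andP[/eqP eh /eqP ef].
      by apply: (@T_edge _ _ _ _ _ e); rewrite ?inE -?pi1o //; apply/eqP.
    case: (T_split h wf1 Tab) => [/subfh|[c [d [[_ ch dh ncd] _ /subfh/setTf ac /subfh/setTf db]]]].
      exact: fp.
    have cd : Tconn pi setT full c d.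
      apply: (trT _ a); first exact: syT.
      by apply: (trT _ b); [apply: (@T_edge _ _ _ _ _ f); rewrite ?inE | apply: syT].
    move: ch dh ncd cd; rewrite pi1h !inE.
    by move=> /orP[] /eqP -> /orP[] /eqP -> // _ /syT /nT.
  have v1 : valid R kd pi1 0 by [].
  exists 0, pi1; split=> //.
  have Tuv1 : Tconn pi1 setT (R 0) u v.
    by rewrite R0; apply: (@T_edge _ _ _ _ _ h); rewrite ?pi1h // !inE eqxx ?orbT.
  (* If [pi1] connects all vertices, [ST] is no longer possible at stage 0, and the stage exceeds
     its rank 0. *)
  have [Ts|Ts] := pselect (Tconn pi1 setT (R 0) = R 0).
    by left; rewrite kd0 /stage asboolT //; case: ifP.
  right; exists (Tconn pi1 setT (R 0)); split; first by rewrite /valid_step kd0.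
  have R1 : R 1 = Tconn pi setT (R 0) by have := okp 0 (leq0n _); rewrite /valid_step kd0 => -[].
  rewrite R1; apply: relcard_lt; first by rewrite R0; apply: sub1.
  by move=> e; apply: nT0uv; rewrite e.
have [j [js Tj nTj]] : exists j, [/\ j <= s, Tconn pi setT (R j) u v & ~ Tconn pi setT (R j.+1) u v].
  apply: contrapT => no; suff all i : i <= s.+1 -> Tconn pi setT (R i) u v.
    by apply: nRsuv; apply: (T_sub (eR _ (leqnn _)) (all _ (leqnn _))).
  elim: i => [//|i IH] is_; apply: contrapT => nT; apply: no; exists i.
  by split=> //; apply: IH; apply: ltnW.
have [g [p [q [[pg qg npq] Rg nRg up qv]]]] :=
  T_crossing wfp fp (eR j (leqW js)) (eR j.+1 js) Tj nTj.
have hg : h <> g by apply: (swap_hg h0 pg).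
have Rjpq : R j p q by apply: Rg.
have nRjpq : ~ R j.+1 p q.
  by move=> r; apply: nRg; apply: (pair_tame wfp (eR j.+1 js) pg qg npq r).
have [Rjuv Rsubs] : R j u v /\ forall i, i <= s -> R i u v.
  by split=> [|i is_]; [apply: (subR j s) | apply: (subR i s)].
pose pi2 := swap pi h g u v.
have wf2 : wf pi2 by apply: swap_wf.
have f2 : forest pi2.
  apply: (swap_forest wfp uh vh nuv h0 pg qg npq fp).
    by apply: T_mono up.
  by apply: T_mono qv.
(* The connections to be preserved run inside the classes of [R j], so hyperedges without a pair
   inside such a class may be missing from [A]. *)
have Teq A i : i <= j -> h \in A -> g \in A ->
    (forall f, f \notin A -> tame pi (R j) f -> pi f = set0) ->
    Tconn pi2 A (R i) = Tconn pi A (R i).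
  move=> ij hA gA out; have is_ := leq_trans ij js.
  have sub : relsub (Tconn pi [set~ g] (R j)) (Tconn pi (A :\ g) (R i)).
    apply: T_mono => f x y; rewrite !inE => fg xf yf Rxy nxy; rewrite fg /=; split.
      apply: contrapT => /negP /out fA.
      have tf := pair_tame wfp (eR j (leqW js)) xf yf nxy Rxy.
      by move: xf; rewrite fA // inE.
    by apply: (subR i j) => //; apply: leqW.
  apply: (T_swap wfp h0 pg qg npq (eR i (leqW is_))) => //; [exact: Rsubs| |exact: sub|exact: sub].
  by apply: (subR i j) => //; apply: leqW.
have Tset i : i <= j -> Tconn pi2 setT (R i) = Tconn pi setT (R i).
  by move=> ij; apply: Teq; rewrite ?inE // => f; rewrite inE.
(* The complement loses nothing: [u] and [v] are linked without [h], so [h] still links its third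
   vertex, while [g] becomes entirely free. *)
have Ksub A B i : i <= s -> (forall e x y, e \in A -> x \in hy e -> y \in hy e -> R i x y -> x <> y -> e \in B) ->
    Kconn pi2 B (R i) u v -> relsub (Kconn pi A (R i)) (Kconn pi2 B (R i)).
  move=> is_ AB uv x y Kxy.
  apply: (@K_change _ _ _ pi pi2 B (R i) h).
    by move=> e; apply: swap_sub.
    have [_ sy _] := K_equiv hy pi2 B (R i).
    move=> a b; rewrite swap_h !inE => /orP[] /eqP -> /orP[] /eqP ->; try exact: K_refl; try by []; exact: sy.
  apply: K_transport Kxy => // e a b eA ae be Rab nab; split=> //; exact: AB Rab nab.
have Kuv2 B i : i <= s ->
    (forall e x y, e \in [set~ h] -> x \in hy e -> y \in hy e -> R s x y -> x <> y -> e \in B) ->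
    Kconn pi2 B (R i) u v.
  move=> is_ AB; apply: (K_transport _ _ Kuv); first by apply: subR.
  move=> e x y eh xe ye Rxy nxy; split; first exact: AB eh xe ye Rxy nxy.
  by apply: swap_sub; move: eh; rewrite !inE => /eqP.
have Kst i : i <= j -> Kconn pi setT (R i) = R i -> Kconn pi2 setT (R i) = R i.
  move=> ij Ks; have is_ := leq_trans ij js; apply: rel_eqP; first by apply: K_sub; apply: eR; apply: leqW.
  rewrite -{1}Ks; apply: Ksub => //; exact: Kuv2.
have key i : i <= j -> valid R kd pi2 i ->
    (i < j -> valid_step hy R kd pi2 i (R i.+1) \/ improvable) /\ (i = j -> improvable).
  move=> ij v2; have is_ := leq_trans ij js; have it := leq_ltn_trans is_ st.
  have eRi k : k <= i -> is_equiv (R k).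
    by move=> ki; apply: eR; apply: leqW; apply: leq_trans ki is_.
  have rel e x y : release R kd pi i e x y -> release R kd pi2 i e x y.
    by apply: release_swap => //; apply: Rsubs.
  have Rlt : i < j -> relsub (R j) (R i.+1) by move=> ltij; apply: subR => //; apply: leqW.
  have Rslt : i < s -> relsub (R s) (R i.+1) by move=> ltis; apply: subR.
  have K2pq B : g \in B -> i = j -> Kconn pi2 B (R i) p q.
    move=> gB eij; apply: (K_rule (e := g)) => //; rewrite ?eij //.
    - by move=> a b; rewrite swap_g // inE.
    - by apply: (subsetP (proj1 (wfp g))).
    - by apply: (subsetP (proj1 (wfp g))).
  have := okp i is_; rewrite /valid_step; case kdi: (kd i) => [||e0|f].
  - case=> Ri1 ne; split=> [ltij|eij].
      by left; rewrite Tset.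
    case: nRjpq; rewrite -eij Ri1; apply: (@T_edge _ _ _ _ _ g) => //; by rewrite eij.
  - case=> Ts Ri1 ne.
    have sub : relsub (R i.+1) (Kconn pi2 setT (R i)).
      by rewrite Ri1; apply: Ksub => //; apply: Kuv2.
    have Ts2 : Tconn pi2 setT (R i) = R i by rewrite Tset.
    have [eqK|neK] := pselect (R i.+1 = Kconn pi2 setT (R i)); last first.
      have im : improvable by apply: (@improve_K pi2 i).
      by split=> // _; right.
    split=> [ltij|eij]; first by left; split.
    by case: nRjpq; rewrite -eij eqK; apply: K2pq; rewrite ?inE.
  - case=> -[Ts Ks] e00 Ri1 sing [x [y [z [xe ye ze [Rxz nxz] re]]]].
    have ltis : i < s by rewrite ltn_neqAle is_ andbT; apply/eqP => eis; move: TLs; rewrite -eis kdi.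
    have he0 : h <> e0.
      by move=> he; apply: nuv; subst e0; apply: sing => //; apply: Rslt.
    have ge0 : g <> e0 by move=> ge; move: pg; rewrite ge e00 inE.
    have pi2e0 : pi2 e0 = set0 by rewrite swap_other //; auto.
    have Ts2 : Tconn pi2 setT (R i) = R i by rewrite Tset.
    have Ks2 := Kst i ij Ks.
    have sub : relsub (R i.+1) (Kconn pi2 [set~ e0] (R i)).
      rewrite Ri1; apply: Ksub => //; apply: Kuv2 => // e a b _ ae be Rab nab.
      by rewrite !inE; apply/eqP => ee; subst e; apply: nab; apply: sing => //; apply: Rslt.
    have [sing2|nsing2] := pselect (forall a b, a \in hy e0 -> b \in hy e0 ->
        Kconn pi2 [set~ e0] (R i) a b -> a = b).
      have okK : valid_step hy R kd pi2 i (Kconn pi2 [set~ e0] (R i)).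
        rewrite /valid_step kdi; split=> //; exists x, y, z; split=> //; exact: rel.
      have [eqK|neK] := pselect (R i.+1 = Kconn pi2 [set~ e0] (R i)); last first.
        have im : improvable.
          exists i, pi2; split=> //; right; exists (Kconn pi2 [set~ e0] (R i)); split=> //.
          exact: relcard_lt.
        by split=> // _; right.
      split=> [ltij|eij]; first by left; rewrite eqK; move: okK; rewrite /valid_step kdi.
      by case: nRjpq; rewrite -eij eqK; apply: K2pq => //; rewrite !inE; apply/eqP.
    have [s0 [s0i TLs0 Rs0 nRs0 Lxy]] := rel e0 x y re.
    have Rs0i : relsub (R i) (R s0.+1) by apply: subR => //; apply: leqW.
    have [Rr Rs Rt] := eRi i (leqnn i).
    have nRxy : ~ R i x y by move/Rs0i.
    have nRzy : ~ R i z y by move=> r; apply: nRxy; apply: Rt r.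
    have nxy : x <> y by move=> e; apply: nRxy; rewrite e.
    have nzy : z <> y by move=> e; apply: nRzy; rewrite e.
    have Kxz : Kconn pi2 [set~ e0] (R i) x z.
      apply: contrapT => nKxz; apply: nsing2 => a b ae be Kab.
      have Rab : R i a b by apply: K_sub Kab; apply: eRi.
      have cov := set3_cover (hy3 e0) xe ye ze nxy nxz (fun e => nzy (esym e)).
      case: (cov a ae) Kab Rab => -> ; case: (cov b be) => -> // Kab Rab;
        by [case: nRxy; first [exact: Rab | exact: Rs] | case: nRzy; first [exact: Rab|exact: Rs]
           | case: nKxz; first [exact: Kab | exact: K_sym]].
    have RK : relsub (R i) (Kconn pi2 [set~ e0] (R i)).
      have -> : [set~ e0] = setT :\ e0 by apply/setP => a; rewrite !inE andbT.
      rewrite -{1}Ks2; apply: K_drop_related => a b ae be Rab.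
      have -> : setT :\ e0 = [set~ e0] by apply/setP => c; rewrite !inE andbT.
      have cov := set3_cover (hy3 e0) xe ye ze nxy nxz (fun e => nzy (esym e)).
      case: (cov a ae) Rab => -> ; case: (cov b be) => -> // Rab;
        by [exact: K_refl | exact: K_sym | case: nRxy; first [exact: Rab | exact: Rs]
           | case: nRzy; first [exact: Rab|exact: Rs]].
    have im : improvable.
      have s0s : s0 < s := leq_trans s0i is_.
      have s0R : relsub (R i) (R s0) := subR s0 i (ltnW s0i) (leqW is_).
      (* The earlier stage [s0] from [release] separated [x] from [y] by a step of [pi]; there [e0]
         is now inserted. *)
      apply: (IHs s0 s0s _ pi2 wf2 f2 _ TLs0 e0 x y) => //; first exact: ltn_trans s0s st.
        by split=> // k ks0; apply: (proj2 v2); apply: leq_trans ks0 s0i.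
      apply: (L_sub_K (eRi i (leqnn i)) (eRi s0 (ltnW s0i)) s0R _ Lxy).
      by move=> a b /RK; apply: K_mono => //; apply: eRi.
    by split=> // _; right.
  - case=> Ts Ks Ri1 [a [b [c [pf nab Rab cf [s0 [s0i TLs0 Rs0 nRs0 Lac]]]]]].
    have af : a \in pi f by rewrite pf !inE eqxx.
    have bf : b \in pi f by rewrite pf !inE eqxx orbT.
    have fh : f <> h by move=> fh; move: af; rewrite fh h0 inE.
    have nRi1 : ~ R i.+1 a b.
      by move=> r; apply: (fp f a b af bf nab); move: r; rewrite Ri1; apply: T_mono.
    split=> [ltij|eij].
      left; have fg : f <> g.
        by move=> fg; apply: nRi1; apply: Rlt => //; apply: Rg; rewrite -fg.
      split=> //; first by rewrite Tset.
      - exact: Kst.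
      - rewrite Ri1; symmetry; apply: Teq => //; rewrite ?inE; try by apply/eqP; auto.
        move=> e; rewrite !inE negbK => /eqP -> tf.
        by case: nRi1; apply: Rlt => //; apply: tf.
      - exists a, b, c; split=> //; first by rewrite swap_other.
        by apply: rel; exists s0.
    (* The step omits only the pair of [f], so the pair that it separates is that of [f]. The
       exchange has emptied [f], which can therefore be inserted with the pair [{a, c}] at the
       earlier stage [s1]. *)
    have fg : g = f.
      apply/eqP/negPn/negP => /eqP gf; apply: nRjpq; rewrite -eij Ri1.
      apply: (@T_edge _ _ _ _ _ g); rewrite ?eij // !inE; exact/eqP.
    have rac : release R kd pi2 i f a c by apply: rel; exists s0.
    have [s1 [s1i TLs1 Rs1 nRs1 Lac1]] := rac.
    have [Rr Rs Rt] := eRi i (leqnn i).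
    have nRac : ~ R i a c by move=> r; apply: nRs1; move: r; apply: subR => //; apply: leqW.
    have nac : a <> c by move=> e; apply: nRac; rewrite -e.
    have nRbc : ~ R i b c by move=> r; apply: nRac; apply: Rt r.
    have nbc : b <> c by move=> e; apply: nRbc; rewrite -e.
    have inf x : x \in pi f -> x \in hy f by apply: (subsetP (proj1 (wfp f))).
    (* As [c] lies in a different class than [a] and [b], the hyperedge [f] contributed nothing to
       the complement and may be left out by [K_drop]. *)
    have fdrop S : relsub S (R i) -> forall x y, x \in hy f -> y \in hy f -> S x y -> x = y \/ x \in pi f /\ y \in pi f.
      move=> SR x y xf yf /SR Rxy.
      have cov := set3_cover (hy3 f) (inf _ af) (inf _ bf) cf nab nac nbc.
      case: (cov x xf) Rxy => ->; case: (cov y yf) => -> Rxy; auto;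
        by [case: nRac; first [exact: Rxy | exact: Rs] | case: nRbc; first [exact: Rxy | exact: Rs]].
    have setTf : setT :\ f = [set~ f] by apply/setP => x; rewrite !inE andbT.
    have Kuv3 : Kconn pi2 [set~ f] (R i) u v.
      have Kd : Kconn pi ([set~ h] :\ f) (R s) u v.
        by apply: (K_drop _ Kuv); apply: fdrop; apply: subR.
      apply: (K_transport _ _ Kd); first by apply: subR.
      move=> e x y; rewrite !inE => /andP[ef /eqP eh] _ _ _ _; split=> //; exact: swap_sub.
    have RK : relsub (R i) (Kconn pi2 [set~ f] (R i)).
      rewrite -{1}Ks => x y /(K_drop (fdrop _ (fun _ _ r => r))); rewrite setTf.
      by apply: Ksub.
    have s1s : s1 < s := leq_trans s1i is_.
    have s1R : relsub (R i) (R s1) := subR s1 i (ltnW s1i) (leqW is_).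
    apply: (IHs s1 s1s _ pi2 wf2 f2 _ TLs1 f a c) => //; first exact: ltn_trans s1s st.
    - by split=> // k ks1; apply: (proj2 v2); apply: leq_trans ks1 s1i.
    - by rewrite -fg swap_g.
    - exact: inf.
    - apply: (L_sub_K (eRi i (leqnn i)) (eRi s1 (ltnW s1i)) s1R _ Lac1).
      by move=> x y /RK; apply: K_mono => //; apply: eRi.
have steps i : i <= j -> valid R kd pi2 i \/ improvable.
  elim: i => [|i IH] ij; first by left.
  case: (IH (ltnW ij)) => [v2|]; last by right.
  have [+ _] := key i (ltnW ij) v2; case=> // [okp2|]; last by right.
  left; split=> // k; rewrite ltnS leq_eqVlt => /orP[/eqP -> //|ki]; exact: (proj2 v2).
case: (steps j (leqnn j)) => // v2.
by have [_] := key j (leqnn j) v2; apply.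
Qed.

End Insertion.

(** Comparison of numbers by their digits in base [B]: all digits after position [i] together weigh
    less than one unit at position [i]. *)
Lemma lexi_sum (f g : nat -> nat) B N i : i <= N -> (forall k, f k < B) ->
  (forall k, k < i -> f k = g k) -> f i < g i ->
  \sum_(k < N.+1) f k * B ^ (N - k) < \sum_(k < N.+1) g k * B ^ (N - k).
Proof.
move=> iN fB fg fgi; have B0 : 0 < B by apply: leq_ltn_trans (fB 0).
pose F (h : nat -> nat) k := h k * B ^ (N - k).
suff : \sum_(0 <= k < N.+1) F f k < \sum_(0 <= k < N.+1) F g k by rewrite !big_mkord.
have split h : \sum_(0 <= k < N.+1) F h k =
    \sum_(0 <= k < i) F h k + (F h i + \sum_(i.+1 <= k < N.+1) F h k).
  by rewrite (big_cat_nat (n := i)) ?leqW //= (big_ltn (m := i)).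
have pre : \sum_(0 <= k < i) F f k = \sum_(0 <= k < i) F g k.
  by apply: eq_big_nat => k /andP[_ ki]; rewrite /F fg.
pose S j := \sum_(j <= k < N.+1) F f k.
have tail d : d <= N - i -> S (N.+1 - d) < B ^ d.
  elim: d => [|d IH] dN; first by rewrite subn0 /S big_geq.
  rewrite /S big_ltn; last by lia.
  have -> : (N.+1 - d.+1).+1 = N.+1 - d by lia.
  have := IH (ltnW dN); rewrite -/(S _) expnS /F => lt.
  have -> : N - (N.+1 - d.+1) = d by lia.
  have := fB (N.+1 - d.+1); move: (f _) => c ltB.
  apply: (leq_trans (n := c.+1 * B ^ d)); last by rewrite leq_mul2r ltB orbT.
  by rewrite mulSn addnC -addSn leq_add2r.
have := tail (N - i) (leqnn _); have -> : N.+1 - (N - i) = i.+1 by lia.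
rewrite !split pre ltn_add2l -/(S _) => lt.
apply: leq_trans (leq_addr _ _).
apply: (leq_trans (n := (f i).+1 * B ^ (N - i))); last by rewrite leq_mul2r fgi orbT.
by rewrite mulSn addnC -addSn leq_add2r.
Qed.

(** * A maximal trace ends in a partition with acyclic complement *)

Section Skeletal.
Variables (V E : finType) (hy : E -> {set V}).
Hypothesis hy3 : forall e, #|hy e| <= 3.
Hypothesis V0 : 0 < #|V|.

Notation Rel := (V -> V -> Prop).
Notation quasi := ({ffun E -> {set V}}).
Implicit Types (pi : quasi) (R : nat -> Rel) (kd : nat -> step E).
Local Notation Kconn := (Kconn hy).
Local Notation Lconn := (Lconn hy).
Local Notation wf := (wf hy).
Local Notation full := (@full V).
Local Notation valid := (valid hy).
Local Notation release := (release hy).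

Let M := #|{: V * V}|.

Lemma relcard_le (R1 : Rel) : relcard R1 <= M.
Proof. exact: max_card. Qed.

Lemma relcard_gt0 (R1 : Rel) : is_equiv R1 -> 0 < relcard R1.
Proof.
move: V0; rewrite -cardsT => /card_gt0P[x _] [Rr _ _].
by apply/card_gt0P; exists (x, x); rewrite inE; apply/asboolP; apply: Rr.
Qed.

Lemma stat_le2 pi (R1 : Rel) : stage hy pi R1 <= 2.
Proof. by rewrite /stage; do 2?case: ifP. Qed.

(* Traces are compared lexicographically, [score] encoding the order. *)
Definition weight pi R kd t k :=
  if k < t then rank (kd k) * M.+1 + relcard (R k.+1)
  else if k == t then stage hy pi (R t) * M.+1 else 0.

(** A digit encodes a rank at most 2 together with a count at most [M]. The digit at the end of the
    trace holds the rank of the possible next steps with count 0, so that taking such a step always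
    increases it. *)
Lemma weight_lt pi R kd t k : weight pi R kd t k < 3 * M.+1.
Proof.
rewrite /weight; case: ifP => _.
  have : rank (kd k) <= 2 by case: (kd k).
  have := relcard_le (R k.+1); move: (relcard _) (rank _) M => a b c; nia.
case: ifP => // _; have := stat_le2 pi (R t); move: (stage _ _ _) M => a b; nia.
Qed.

Definition score pi R kd t :=
  \sum_(k < M.+1) weight pi R kd t k * (3 * M.+1) ^ (M - k).

(** A step [SD] separates the vertices [x] and [z] of the dropped hyperedge, and a step [SL f] the
    pair of [f], by acyclicity of [pi]. *)
Lemma ok_proper pi R kd i (R1 : Rel) : wf pi -> forest pi -> valid_step hy R kd pi i R1 -> R1 <> R i.
Proof.
move=> wfp fp; rewrite /valid_step; case: (kd i) => [[]//|[]//|e|f].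
  case=> _ _ _ sing [x [y [z [xe ye ze [Rxz nxz] _]]]] e1.
  by apply: nxz; apply: sing => //; rewrite e1.
case=> _ _ -> [a [b [c [pf nab Rab _ _]]]] e1.
apply: (fp f a b) => //; rewrite ?pf ?inE ?eqxx ?orbT //.
by move: Rab; rewrite -e1; apply: T_mono.
Qed.

(** The number of related pairs drops with each step and stays positive; hence [M.+1] digits suffice
    for the score. *)
Lemma valid_length pi R kd t : wf pi -> forest pi -> valid R kd pi t -> t < M.
Proof.
move=> wfp fp va; have eR := valid_equiv va.
suff H i : i <= t -> i + relcard (R i) <= M.
  have := H t (leqnn t); have := relcard_gt0 (eR t (leqnn t)); lia.
elim: i => [_|i IH it]; first exact: relcard_le.
have oki := proj2 va i it.
have := relcard_lt (ok_sub (eR i (ltnW it)) oki) (ok_proper wfp fp oki).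
have := IH (ltnW it); lia.
Qed.

Lemma ok_ext pi R kd R' kd' i (R1 : Rel) : (forall k, k <= i -> R k = R' k) ->
  (forall k, k <= i -> kd k = kd' k) -> valid_step hy R kd pi i R1 -> valid_step hy R' kd' pi i R1.
Proof.
move=> eR ek; rewrite /valid_step -ek // -eR //.
have rel e x y : release R kd pi i e x y -> release R' kd' pi i e x y.
  case=> s [si TLs Rs nRs Lxy]; exists s; rewrite -ek -?eR //; lia.
case: (kd i) => [||e|f] //.
  by case=> ? ? ? ? [x [y [z [? ? ? ? /rel ?]]]]; split=> //; exists x, y, z.
by case=> ? ? ? [a [b [c [? ? ? ? /rel ?]]]]; split=> //; exists a, b, c.
Qed.

Definition upd (T : Type) (R : nat -> T) i (R1 : T) k := if k <= i then R k else R1.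

Lemma upd_le T (R : nat -> T) i (R1 : T) k : k <= i -> upd R i R1 k = R k.
Proof. by rewrite /upd => ->. Qed.

Lemma upd_S T (R : nat -> T) i (R1 : T) : upd R i R1 i.+1 = R1.
Proof. by rewrite /upd ltnn. Qed.

Lemma valid_extend pi R kd i k1 (R1 : Rel) : valid R kd pi i ->
  (forall kd', kd' i = k1 -> (forall k, k < i -> kd' k = kd k) -> valid_step hy R kd' pi i R1) ->
  exists kd', [/\ valid (upd R i R1) kd' pi i.+1, kd' i = k1
    & forall k, k < i -> kd' k = kd k].
Proof.
move=> [R0 okp] ok1; pose kd' k := if k < i then kd k else k1.
have kdlt k : k < i -> kd' k = kd k by rewrite /kd' => ->.
have kdi : kd' i = k1 by rewrite /kd' ltnn.
exists kd'; split=> //; split=> [|k]; first by rewrite upd_le.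
rewrite ltnS leq_eqVlt => /orP[/eqP ->|ki].
  by rewrite upd_S; apply: ok_ext (ok1 kd' kdi kdlt) => // l li; rewrite upd_le.
rewrite upd_le //; apply: ok_ext (okp k ki) => l lk; last by rewrite kdlt //; lia.
by rewrite upd_le //; lia.
Qed.

Lemma max_trace : exists pi R kd t, [/\ wf pi, forest pi, valid R kd pi t
  & forall pi' R' kd' t', wf pi' -> forest pi' -> valid R' kd' pi' t' ->
    score pi' R' kd' t' <= score pi R kd t].
Proof.
pose P m := `[< exists pi R kd t, [/\ wf pi, forest pi, valid R kd pi t & m = score pi R kd t] >].
have P0 : exists m, P m.
  pose pi0 : quasi := [ffun=> set0].
  exists (score pi0 (fun=> full) (fun=> ST E) 0); apply/asboolP.
  exists pi0, (fun=> full), (fun=> ST E), 0; split=> //.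
    by move=> e; rewrite ffunE; split; [apply: sub0set | left].
  by move=> f a b; rewrite ffunE inE.
have Pb m : P m -> m <= \sum_(k < M.+1) (3 * M.+1) * (3 * M.+1) ^ (M - k).
  move=> /asboolP[pi [R [kd [t [_ _ _ ->]]]]]; apply: leq_sum => k _.
  by rewrite leq_mul2r ltnW ?orbT // weight_lt.
case: (ex_maxnP P0 Pb) => m /asboolP[pi [R [kd [t [wfp fp va ->]]]]] mx.
exists pi, R, kd, t; split=> // pi' R' kd' t' wf' f' va'.
by apply: mx; apply/asboolP; exists pi', R', kd', t'.
Qed.

Lemma score_lt pi R kd t pi' R' kd' t' i : i <= M ->
  (forall k, k < i -> [/\ k < t, k < t', kd k = kd' k & R k.+1 = R' k.+1]) ->
  weight pi R kd t i < weight pi' R' kd' t' i ->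
  score pi R kd t < score pi' R' kd' t'.
Proof.
move=> iM eq lt; apply: (@lexi_sum _ _ _ _ i) => // k; first exact: weight_lt.
by move=> ki; rewrite /weight; have [-> -> -> ->] := eq k ki.
Qed.

Section Chains.
Variables (pi : quasi) (R1 : Rel).
Hypothesis eR1 : is_equiv R1.

(** An entry [(u, f, v)] crosses [f] from [u] to [v]; the gaps lie inside classes. The explicit list
    makes it possible to remove any single hyperedge of a cycle and to run along the others. *)
Fixpoint chain x (l : seq (V * E * V)) y : Prop :=
  if l is (u, f, v) :: l' then
    [/\ R1 x u, tame pi R1 f, u \in hy f, v \in hy f & chain v l' y]
  else R1 x y.

Definition edges (l : seq (V * E * V)) := [seq i.1.2 | i <- l].

Lemma chain_left x y z l : R1 x y -> chain y l z -> chain x l z.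
Proof.
case: eR1 => Rr Rs Rt Rxy; case: l => [|[[u f] v] l] /=; first exact: Rt.
by case=> Ryu ? ? ? ?; split=> //; apply: Rt Ryu.
Qed.

Lemma chain_cat x y z l1 l2 : chain x l1 y -> chain y l2 z -> chain x (l1 ++ l2) z.
Proof.
elim: l1 x => [|[[u f] v] l1 IH] x /=; first exact: chain_left.
by case=> ? ? ? ? /IH c /c ?.
Qed.

Lemma chain_split x z l1 l2 u f v : chain x (l1 ++ (u, f, v) :: l2) z ->
  [/\ chain x l1 u, tame pi R1 f, u \in hy f, v \in hy f & chain v l2 z].
Proof.
elim: l1 x => [|[[u' f'] v'] l1 IH] x /=; first by [].
by case=> ? ? ? ? /IH[? ? ? ? ?]; split=> //; split.
Qed.

(** When a hyperedge comes up again, the chain is cut at its first occurrence, where it is crossed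
    directly to the new end. *)
Lemma L_chain e x y : Lconn pi R1 full e x y ->
  exists l, [/\ chain x l y, e \notin edges l & uniq (edges l)].
Proof.
case: (eR1) => Rr Rs Rt; elim=> [|y' z _ [l [cl el ul]] st].
  by exists [::]; split=> //=; apply: Rr.
case: st => [Ryz|[f [fe tf yf zf _]]].
  by exists l; split=> //; rewrite -(cats0 l); apply: chain_cat cl _.
have [/mapP[[[u f'] v] /= uv fE]|fl] := boolP (f \in edges l); last first.
  exists (l ++ [:: (y', f, z)]); rewrite /edges map_cat /=; split.
  - by apply: chain_cat cl _; split=> //; apply: Rr.
  - by rewrite mem_cat negb_or el inE eq_sym; apply/eqP.
  - by rewrite cat_uniq ul /= orbF fl.
rewrite -{}fE in uv; have [l1 [l2 el12]] : exists l1 l2, l = l1 ++ (u, f, v) :: l2.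
  by case/splitPr: uv => l1 l2; exists l1, l2.
rewrite {}el12 /edges map_cat /= in cl el ul.
have [c1 _ uf _ _] := chain_split cl.
exists (l1 ++ [:: (u, f, z)]); rewrite /edges map_cat /=; split.
- by apply: chain_cat c1 _; split=> //; apply: Rr.
- by move: el; rewrite !mem_cat !inE !negb_or => /and3P[-> ->].
- by move: ul; rewrite !cat_uniq /= orbF negb_or => /and3P[-> /andP[-> _]].
Qed.

Lemma chain_L (S : Rel) e x l y : is_equiv S -> relsub R1 S -> e \notin edges l ->
  (forall i, i \in l -> S i.1.1 i.2) -> chain x l y -> Lconn pi R1 S e x y.
Proof.
move=> eS RS; have [Lr Ls Lt] := L_equiv hy pi e eR1 eS.
elim: l x => [|[[u f] v] l IH] x /=.
  by move=> _ _ Rxy; apply: rtc1; left.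
rewrite inE negb_or => /andP[/eqP ef el] all [Rxu tf uf vf c].
apply: (Lt _ u); first by apply: rtc1; left.
apply: (Lt _ v); last by apply: IH c => // i il; apply: all; rewrite inE il orbT.
apply: rtc1; right; exists f; split=> //; first by move=> fe; apply: ef.
by apply: (all (u, f, v)); rewrite mem_head.
Qed.

End Chains.

(** The final partition of a trace of maximal score works. A tame hyperedge bypassed by the others
    would be separated at some stage and would then allow either an exchange or a further step. *)
Lemma skeletal : exists pi (R : Rel), [/\ wf pi, forest pi, is_equiv R,
   Tconn pi setT R = R /\ Kconn pi setT R = R
 & forall e x y, tame pi R e -> x \in hy e -> y \in hy e ->
     Lconn pi R full e x y -> R x y].
Proof.
have [pi [R [kd [t [wfp fp va mx]]]]] := max_trace.
have tM := valid_length wfp fp va.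
have R0 : R 0 = full by case: va.
have notimp : ~ improvable hy R kd t.
  case=> i [pi' [it [wf' f'] va' imp]]; have iM : i <= M by lia.
  have wi : weight pi R kd t i = rank (kd i) * M.+1 + relcard (R i.+1) by rewrite /weight it.
  have rM := relcard_le (R i.+1).
  case: imp => [st|[R1 [okR1 lt]]].
    have : score pi R kd t < score pi' R kd i.
      apply: (score_lt iM) => [k ki|]; first by split=> //; lia.
      rewrite wi /weight ltnn eqxx; move: st rM; move: (rank _) (stage _ _ _) (relcard _) M => a b c d; nia.
    by rewrite ltnNge mx.
  have [|kd' [va2 kdi kdlt]] := @valid_extend pi' R kd i (kd i) R1 va'.
    move=> kd' kdi kdlt; apply: ok_ext okR1 => // k; rewrite leq_eqVlt => /orP[/eqP -> //|ki].
    by rewrite kdlt.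
  have : score pi R kd t < score pi' (upd R i R1) kd' i.+1.
    apply: (score_lt iM) => [k ki|].
      by split=> //; [lia|lia|rewrite kdlt|rewrite upd_le].
    by rewrite wi /weight ltnSn upd_S kdi ltn_add2l.
  by rewrite ltnNge mx.
have eRi := valid_equiv va; have eR := eRi t (leqnn t).
have noext k1 (R1 : Rel) : rank k1 = stage hy pi (R t) -> is_equiv R1 ->
    (forall kd', kd' t = k1 -> (forall k, k < t -> kd' k = kd k) -> valid_step hy R kd' pi t R1) -> False.
  move=> rk eR1 okR1; have [kd' [va2 kdi kdlt]] := valid_extend va okR1.
  have : score pi R kd t < score pi (upd R t R1) kd' t.+1.
    apply: (score_lt (ltnW tM)) => [k ki|].
      by split=> //; [lia|rewrite kdlt|rewrite upd_le].
    rewrite /weight ltnn eqxx ltnSn upd_S kdi rk.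
    by rewrite -[X in X < _]addn0 ltn_add2l relcard_gt0.
  by rewrite ltnNge mx.
have Ts : Tconn pi setT (R t) = R t.
  apply: contrapT => nT; apply: (@noext (ST E) (Tconn pi setT (R t))).
  - by rewrite /stage asboolF.
  - exact: T_equiv.
  - by move=> kd' kdt _; rewrite /valid_step kdt.
have Ks : Kconn pi setT (R t) = R t.
  apply: contrapT => nK; apply: (@noext (SK E) (Kconn pi setT (R t))).
  - by rewrite /stage asboolT // asboolF.
  - exact: K_equiv.
  - by move=> kd' kdt _; rewrite /valid_step kdt.
have st2 : stage hy pi (R t) = 2 by rewrite /stage !asboolT.
have subR i j : i <= j -> j <= t -> relsub (R j) (R i).
  by move=> ij jt; apply: (valid_sub va); rewrite ij.
have setTD (e : E) : setT :\ e = [set~ e] by apply/setP => x; rewrite !inE andbT.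
(* No stage separates two vertices of a tame hyperedge that is redundant between them at this
   stage. *)
have level s e x y : s < t -> tame pi (R t) e -> x \in hy e -> y \in hy e -> R s x y ->
    Lconn pi (R t) (R s) e x y -> R s.+1 x y.
  move=> st te xe ye Rs Lxy; apply: contrapT => nRs.
  have subs : relsub (R t) (R s) by apply: subR => //; apply: ltnW.
  have subs1 : relsub (R t) (R s.+1) by apply: subR.
  have eRs := eRi s (ltnW st).
  (* A step of the complement would have kept [x] and [y] together, through [e] itself or, if [e]
     was dropped, through the bypass. *)
  have TLs : TL (kd s).
    have := proj2 va s st; rewrite /valid_step; case kds: (kd s) => [||e0|f] //.
      case=> _ Rs1 _; case: nRs; rewrite Rs1; apply: (K_rule (e := e)) => // a b ae be.
      by rewrite -Rs1; apply: subs1; apply: te.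
    case=> _ e00 Rs1 _ _; case: nRs; rewrite Rs1.
    have [ee0|ee0] := eqVneq e e0.
      subst e0; apply: L_sub_K Lxy => //.
      by rewrite -Rs1.
    apply: (K_rule (e := e)) => //; first by rewrite !inE.
    by move=> a b ae be; rewrite -Rs1; apply: subs1; apply: te.
  have [Lr Ls Lt] := L_equiv hy pi e eR eRs.
  have [Rr Rsy Rt] := eR.
  have RL : relsub (R t) (Lconn pi (R t) (R s) e) by move=> a b ?; apply: rtc1; left.
  have nRt : ~ R t x y by move/subs1.
  have nxy : x <> y by move=> exy; apply: nRt; rewrite exy.
  have [_ Rssy Rstr] := eRs; have [_ Rs1sy Rs1tr] := eRi s.+1 st.
  (* [a] and [b] are the two vertices of [e] in one class, [y] the third *)
  have rel a b x' y' : a \in hy e -> b \in hy e -> a <> b -> R t a b ->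
      x' \in hy e -> y' \in hy e -> R s x' y' -> ~ R s.+1 x' y' -> ~ R t x' y' -> x' <> y' ->
      Lconn pi (R t) (R s) e x' y' -> a <> y' -> b <> y' ->
      [/\ R s a y', ~ R s.+1 a y', ~ R t a y' & Lconn pi (R t) (R s) e a y'].
    move=> ae be nab Rab xe' ye' Rs' nRs' nRt' nxy' L' nay nby.
    have Rax : R t a x'.
      by case: (set3_cover (hy3 e) ae be ye' nab nay nby xe') => [->|->|/nxy'] //; apply: Rr.
    split.
    - by apply: Rstr Rs'; apply: subs.
    - by move=> r; apply: nRs'; apply: Rs1tr r; apply: Rs1sy; apply: subs1.
    - by move=> r; apply: nRt'; apply: Rt r; apply: Rsy.
    - by apply: Lt L'; apply: RL.
  have third a b : a \in hy e -> b \in hy e -> a <> b -> R t a b ->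
      exists y', [/\ y' \in hy e, a <> y', b <> y' &
      [/\ R s a y', ~ R s.+1 a y', ~ R t a y' & Lconn pi (R t) (R s) e a y']].
    move=> ae be nab Rab.
    have [/orP[] /eqP ey|] := boolP ((y == a) || (y == b)); last first.
      rewrite negb_or => /andP[/eqP nya /eqP nyb]; have nay := nesym nya; have nby := nesym nyb.
      by exists y; split=> //; apply: (rel a b x y).
    - subst y; have nbx : b <> x := nesym nxy.
      have nax : a <> x by move=> ax; apply: nRt; rewrite -ax.
      exists x; split=> //; apply: (rel a b b x) => //.
      + exact: Rssy.
      + by move=> r; apply: nRs; apply: Rs1sy.
      + by move=> r; apply: nRt; apply: Rsy.
      + exact: Ls.
    - subst y; have nax : a <> x := nesym nxy.
      have nbx : b <> x by move=> bx; apply: nRt; rewrite -bx; apply: Rsy.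
      exists x; split=> //; apply: (rel a b a x) => //.
      + exact: Rssy.
      + by move=> r; apply: nRs; apply: Rs1sy.
      + by move=> r; apply: nRt; apply: Rsy.
      + exact: Ls.
  have [sube [e0|[a [b [nab eab]]]]] := wfp e; last first.
    have ae : a \in pi e by rewrite eab !inE eqxx.
    have be : b \in pi e by rewrite eab !inE eqxx orbT.
    have Rab := te a b ae be.
    have [c [ce nac nbc [Rsac nRsac _ Lac]]] :=
      third a b (subsetP sube _ ae) (subsetP sube _ be) nab Rab.
    (* A hyperedge that carries a pair of [pi] would extend the trace by a step [SL]. *)
    apply: (@noext (SL e) (Tconn pi [set~ e] (R t))); first by rewrite st2.
      exact: T_equiv.
    move=> kd' kdt kdlt; rewrite /valid_step kdt; split=> //.
    exists a, b, c; split=> //; exists s; split=> //; by rewrite kdlt.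
  have [Kxy|nKxy] := pselect (Kconn pi [set~ e] (R s) x y).
    apply: notimp; apply: (@insert _ _ hy hy3 R kd t s st pi wfp fp _ TLs e x y) => //.
    by split=> // k ks; apply: (proj2 va); lia.
  have [a [b [ae be Rab nKab]]] : exists a b, [/\ a \in hy e, b \in hy e, R t a b
      & ~ Kconn pi [set~ e] (R t) a b].
    apply: contrapT => no; apply: nKxy; apply: L_sub_K Lxy => //.
    suff RK : relsub (R t) (Kconn pi [set~ e] (R t)).
      by move=> a b /RK; apply: K_mono.
    rewrite -{1}Ks -setTD; apply: K_drop_related => a b ae be Rab.
    by apply: contrapT => n; apply: no; exists a, b; rewrite -setTD.
  have nab : a <> b by move=> eab; apply: nKab; rewrite eab; apply: K_refl.
  have [c [ce nac nbc [Rsac nRsac nRtac Lac]]] := third a b ae be nab Rab.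
  have nRtbc : ~ R t b c by move=> r; apply: nRtac; apply: Rt r.
  apply: (@noext (SD e) (Kconn pi [set~ e] (R t))); first by rewrite st2.
    exact: K_equiv.
  move=> kd' kdt kdlt; rewrite /valid_step kdt; split=> //.
    move=> p q pe qe Kpq; have Rpq : R t p q by apply: K_sub Kpq.
    have cov := set3_cover (hy3 e) ae be ce nab nac nbc.
    case: (cov p pe) Kpq Rpq => ->; case: (cov q qe) => -> // Kpq Rpq;
      by [case: nKab; first [exact: Kpq|exact: K_sym] | case: nRtac; first [exact: Rpq|exact: Rsy]
         | case: nRtbc; first [exact: Rpq|exact: Rsy]].
  exists a, c, b; split=> //; exists s; split=> //; by rewrite kdlt.
exists pi, (R t); split=> //.
move=> e x y te xe ye /(L_chain eR)[l [cl el ul]].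
(* The hyperedge [e] and the chain form a cycle in which each hyperedge is bypassed by all others.
   Hence every stage keeps all crossings of the cycle together, and this must be proved for all of
   them simultaneously. *)
suff all s : s <= t -> R s x y /\ forall i, i \in l -> R s i.1.1 i.2 by have [] := all t (leqnn t).
elim: s => [_|s IH st]; first by rewrite R0.
have [Rxy all] := IH (ltnW st); have eRs := eRi s (ltnW st).
have subs : relsub (R t) (R s) by apply: subR => //; apply: ltnW.
have [Lr Ls Lt] := L_equiv hy pi e eR eRs.
split; first by apply: (level s e) => //; apply: chain_L cl.
move=> [[u f] v] uv /=; have [l1 [l2 el12]] : exists l1 l2, l = l1 ++ (u, f, v) :: l2.
  by case/splitPr: uv => l1 l2; exists l1, l2.
move: (cl) (el) (ul); rewrite {1 2 3}el12 => /chain_split[c1 tf uf vf c2].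
rewrite /edges !map_cat /= mem_cat inE !negb_or => /and3P[_ ef _].
rewrite cat_uniq /= negb_or => /and3P[_ /andP[f1 _] /andP[f2 _]].
have [_ Lfs Lft] := L_equiv hy pi f eR eRs.
apply: (level s f) => //; first by apply: (all (u, f, v)).
apply: (Lfs _ _); apply: (Lft _ y).
  by apply: chain_L c2 => // i il; apply: all; rewrite el12 mem_cat inE il !orbT.
apply: (Lft _ x).
  apply: (Lfs _ _); apply: rtc1; right; exists e; split=> //.
  by move=> e1; move: ef; rewrite e1 eqxx.
by apply: chain_L c1 => // i il; apply: all; rewrite el12 mem_cat il.
Qed.

End Skeletal.

(** * Counting *)

Lemma leq_card_imset (T T1 T2 : finType) (f : T -> T1) (g : T -> T2) (A : {set T}) :
  {in A &, forall x y, g x = g y -> f x = f y} -> #|f @: A| <= #|g @: A|.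
Proof.
move=> fg; have [->|[x0 x0A]] := set_0Vmem A; first by rewrite !imset0 cards0.
pose h z := if [pick x in A | g x == z] is Some x then f x else f x0.
suff -> : f @: A = h @: (g @: A) by apply: leq_imset_card.
rewrite -imset_comp; apply: eq_in_imset => x xA /=; rewrite /h.
case: pickP => [y /andP[yA /eqP gy]|/(_ x)]; first by rewrite (fg y x yA xA gy).
by rewrite xA eqxx.
Qed.

Section Classes.
Variable V : finType.
Notation Rel := (V -> V -> Prop).

Definition cls (R : Rel) x := [set y | `[< R x y >]].

Lemma in_cls (R : Rel) x y : (y \in cls R x) = `[< R x y >].
Proof. by rewrite inE. Qed.

Lemma eq_cls (R : Rel) x y : is_equiv R -> cls R x = cls R y <-> R x y.
Proof.
case=> Rr Rs Rt; split=> [/setP/(_ y)|Rxy].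
  by rewrite !inE [in RHS]asboolT // => /asboolP.
apply/setP => z; rewrite !inE; apply/asboolP/asboolP => r; last exact: Rt r.
by apply: Rt r; apply: Rs.
Qed.

Definition merge (R : Rel) (B : {set V}) : Rel := fun x y =>
  R x y \/ (exists2 z, z \in B & R x z) /\ (exists2 z, z \in B & R y z).

Lemma merge_equiv R B : is_equiv R -> is_equiv (merge R B).
Proof.
case=> Rr Rs Rt; split=> [x|x y|x y z].
- by left.
- by case=> [/Rs|[? ?]]; [left|right].
- case=> [xy|[[p pB xp] [q qB yq]]] [yz|[[r rB yr] [w wB zw]]].
  + by left; apply: Rt yz.
  + by right; split; [exists r => //; apply: Rt yr|exists w].
  + by right; split; [exists p|exists q => //; apply: Rt yq; apply: Rs].
  + by right; split; [exists p|exists w].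
Qed.

Variables (I : eqType) (B : I -> {set V}).

Definition links (R : Rel) (s : seq I) i : Rel :=
  rtc (fun x y => R x y \/ exists j, [/\ j \in s, j <> i, x \in B j & y \in B j]).

(** Contracting a block loses one class less than it meets. Acyclicity passes to the contracted
    partition, over which the other blocks still meet as many classes as before. *)
Lemma acyclic_count (W : {set V}) (s : seq I) (R : Rel) :
  is_equiv R -> W != set0 -> uniq s ->
  (forall i, i \in s -> B i \subset W /\ B i != set0) ->
  (forall i x y, i \in s -> x \in B i -> y \in B i -> links R s i x y -> R x y) ->
  \sum_(i <- s) (#|cls R @: B i| - 1) + 1 <= #|cls R @: W|.
Proof.
elim: s R => [|i s IH] R eR W0 us BW ac.
  by rewrite big_nil card_gt0 imset_eq0.
have [BiW /set0Pn[b0 b0B]] := BW i (mem_head _ _).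
case/andP: us => nis us; pose R' := merge R (B i).
have [Rr Rs Rt] := eR; have eR' : is_equiv R' by apply: merge_equiv.
have sub : relsub R R' by left.
have lk j x y : j \in s -> links R' s j x y -> links R (i :: s) j x y.
  move=> js; have ij : i <> j by move=> ij; move: nis; rewrite ij js.
  apply: rtc_mono => {}x {}y.
  have RL a b : R a b -> links R (i :: s) j a b by move=> ?; apply: rtc1; left.
  case=> [[/RL //|[[z zB xz] [w wB yw]]]|[k [ks kj xk yk]]]; last first.
    by apply: rtc1; right; exists k; rewrite inE ks orbT.
  apply: rtc_trans (RL _ _ xz) _; apply: rtc_trans (RL _ _ (Rs _ _ yw)).
  by apply: rtc1; right; exists i; rewrite mem_head.
have hit j : j \in s -> #|cls R @: B j| <= #|cls R' @: B j|.
  move=> js; apply: leq_card_imset => x y xj yj; rewrite !eq_cls // => R'xy.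
  apply: (ac j) => //; first by rewrite inE js orbT.
  by apply: lk => //; apply: rtc1; left.
have IHR : \sum_(j <- s) (#|cls R' @: B j| - 1) + 1 <= #|cls R' @: W|.
  apply: IH => // [j js|j x y js xj yj /(lk j x y js) l]; first by apply: BW; rewrite inE js orbT.
  by apply: sub; apply: (ac j) => //; rewrite inE js orbT.
have lt : #|cls R' @: W| <= 1 + #|(cls R @: W) :\: (cls R @: B i)|.
  apply: (leq_trans (n := #|cls R' b0 |: ((cls R @: W) :\: (cls R @: B i))|)); last first.
    by rewrite cardsU1 leq_add2r leq_b1.
  apply: subset_leq_card; apply/subsetP => _ /imsetP[x xW ->]; rewrite !inE.
  have [[z zB xz]|nz] := pselect (exists2 z, z \in B i & R x z).
    apply/orP; left; apply/eqP; apply/(eq_cls _ _ eR'); right.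
    by split; [exists z|exists b0].
  have -> : cls R' x = cls R x.
    apply/setP => y; rewrite !inE; apply/asboolP/asboolP => [[]//|]; last exact: sub.
    by case=> /nz.
  rewrite [X in _ && X]imset_f // andbT; apply/orP; right; apply/negP => /imsetP[z zB] /(eq_cls _ _ eR) xz.
  by apply: nz; exists z.
have subh : cls R @: B i \subset cls R @: W by apply: imsetS.
rewrite cardsD (setIidPr subh) in lt; have := subset_leq_card subh.
have h0 : 0 < #|cls R @: B i| by apply/card_gt0P; exists (cls R b0); apply: imset_f.
have : \sum_(j <- s) (#|cls R @: B j| - 1) <= \sum_(j <- s) (#|cls R' @: B j| - 1).
  rewrite !big_seq; apply: leq_sum => j /hit; apply: leq_sub2r.
rewrite big_cons; move: IHR lt h0; move: (\sum_(j <- s) _) (\sum_(j <- s) _) => a b; lia.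
Qed.

End Classes.

Section Count.
Variables (V E : finType) (hy : E -> {set V}).
Hypothesis hy3 : forall e, #|hy e| <= 3.
Hypothesis V0 : 0 < #|V|.
Notation Rel := (V -> V -> Prop).

Definition crossing (X : {set V}) e := (hy e :&: X != set0) && ~~ (hy e \subset X).

Hypothesis deg4 : forall X : {set V}, X != set0 -> X != setT -> 4 <= #|[set e | crossing X e]|.
Hypothesis deg5 : forall (X : {set V}) e, X != set0 -> X != setT ->
  crossing X e -> #|hy e| = 3 -> 5 <= #|[set e | crossing X e]|.

(** Suppose that there are n > 1 classes. Between them, the used hyperedges form a forest and the
    tame ones are acyclic, so all [hits] sum to at most 2(n - 1) + 2(n - 1) plus the number of used
    hyperedges with three hits. The latter form a forest on the classes meeting [W], so there are no
    more of them than such classes. But the degrees sum to at least 4n plus the number of these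
    classes, each of which has degree at least 5. *)
Lemma skeletal_full : exists pi, [/\ wf hy pi, forest pi,
  Tconn pi setT (@full V) = @full V & Kconn hy pi setT (@full V) = @full V].
Proof.
have [pi [R [wfp fp eR [Ts Ks] ac]]] := skeletal hy3 V0.
suff Rf : R = @full V by exists pi; rewrite -Rf.
apply: contrapT => nf; have [Rr Rs Rt] := eR.
pose hits e := #|cls R @: hy e|; pose C := cls R @: setT.
have hits3 e : hits e <= 3 by apply: leq_trans (leq_imset_card _ _) (hy3 e).
have Cprop X : X \in C -> X != set0 /\ X != setT.
  case/imsetP => x _ ->; split.
    by apply/set0Pn; exists x; rewrite in_cls; apply/asboolP.
  apply/eqP => /setP all; apply: nf; apply: rel_eqP => // y z _.
  have r w : R x w by have := all w; rewrite in_cls inE => /asboolP.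
  by apply: Rt (r z); apply: Rs.
pose Cr := [set e | 1 < hits e].
pose Tm := [set e in Cr | `[< tame pi R e >]]; pose Us := [set e in Cr | ~~ `[< tame pi R e >]].
pose Us3 := [set e in Us | hits e == 3].
pose W := [set x | [exists e, (hits e == 3) && (cls R x \in cls R @: hy e)]].
have setT0 : [set: V] != set0 by rewrite -card_gt0 cardsT.
have crossP X e : X \in C -> crossing X e = (e \in Cr) && (X \in cls R @: hy e).
  case/imsetP => x _ ->; rewrite /crossing !inE; apply/andP/andP.
    case=> /set0Pn[y]; rewrite inE in_cls => /andP[ye /asboolP Rxy].
    have Xe : cls R x \in cls R @: hy e by apply/imsetP; exists y => //; apply/eq_cls.
    case/subsetPn => z ze; rewrite in_cls => /asboolP nRxz; split=> //.
    suff : [set cls R x; cls R z] \subset cls R @: hy e.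
      move/subset_leq_card; rewrite cards2; case: eqP => // /(eq_cls _ _ eR) //.
    by apply/subsetP => Y; rewrite !inE => /orP[] /eqP -> //; apply: imset_f.
  case=> h /imsetP[y ye /(eq_cls _ _ eR) Rxy]; split.
    by apply/set0Pn; exists y; rewrite inE in_cls ye; apply/asboolP.
  apply/negP => /subsetP sub; move: h; rewrite /hits.
  suff -> : cls R @: hy e = [set cls R x] by rewrite cards1.
  apply/setP => Y; rewrite inE; apply/imsetP/eqP => [[z ze ->]|->]; last first.
    by exists y => //; apply/eq_cls.
  by have := sub z ze; rewrite in_cls => /asboolP r; apply/eq_cls => //; apply: Rs.
have pi2 e : e \in Us -> exists a b, [/\ a <> b, pi e = [set a; b] & ~ R a b].
  rewrite !inE => /andP[_ /asboolPn nt].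
  have [_ [e0|[a [b [nab eab]]]]] := wfp e; first by case: nt => a b; rewrite e0 inE.
  exists a, b; split=> // Rab; apply: nt; move=> x y; rewrite eab !inE.
  by move=> /orP[] /eqP -> /orP[] /eqP ->; auto.
(* By stability ([Ts]) the classes are connected by pairs of [pi] inside them. These do not belong
   to [Us], so a cycle over the classes would give a cycle of [pi]. *)
have forest_card (D : {set E}) (Z : {set V}) : Z != set0 -> D \subset Us ->
    (forall e, e \in D -> hy e \subset Z) -> #|D| + 1 <= #|cls R @: Z|.
  move=> Z0 /subsetP DU DZ; have piZ e : e \in D -> pi e \subset Z.
    by move=> eD; apply: subset_trans (DZ e eD); case: (wfp e).
  have := @acyclic_count V E (fun e => pi e) Z (enum D) R eR Z0 (enum_uniq _).
  have -> : \sum_(i <- enum D) (#|cls R @: pi i| - 1) = #|D|.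
    rewrite big_enum_cond /= -sum1_card; apply: eq_big => e; first by rewrite andbT.
    rewrite andbT => /DU/pi2[a [b [nab -> nR]]]; rewrite imsetU !imset_set1 cards2.
    by case: eqP => // /(eq_cls _ _ eR).
  apply=> [e|e x y]; rewrite mem_enum => eD.
    have [a [b [_ E2 _]]] := pi2 e (DU e eD); split; first exact: piZ.
    by apply/set0Pn; exists a; rewrite E2 !inE eqxx.
  move=> xe ye lk; have [->|/eqP nxy] := eqVneq x y; first exact: Rr.
  case: (fp e x y xe ye nxy).
  have nte : ~ tame pi R e by move: (DU e eD); rewrite !inE => /andP[_ /asboolPn].
  apply: rtc_sub lk; first exact: T_equiv (full_equiv V).
  move=> a b [|[f [_ fe af bf]]]; last first.
    by apply: (@T_edge _ _ _ _ _ f) => //; rewrite !inE; apply/eqP.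
  rewrite -{1}Ts; apply: T_mono => f c d _ cf df Rcd ncd; rewrite !inE; split=> //; apply/eqP => fe.
  by apply: nte; rewrite -fe; apply: (pair_tame wfp eR cf df ncd).
have A1 : #|Us| + 1 <= #|C| by apply: forest_card.
have A3 : #|Us3| <= #|cls R @: W|.
  have [->|[e0 e0U]] := set_0Vmem Us3; first by rewrite cards0.
  have inW e : e \in Us3 -> hy e \subset W.
    rewrite !inE => /andP[_ h3]; apply/subsetP => x xe; rewrite inE.
    by apply/existsP; exists e; rewrite h3; apply: imset_f.
  have UsU : Us3 \subset Us by apply/subsetP => e; rewrite inE => /andP[].
  apply: leq_trans (leq_addr 1 _) (forest_card _ _ _ UsU inW).
  have [a [b [_ eab _]]] := pi2 e0 (subsetP UsU _ e0U).
  apply/set0Pn; exists a; apply: (subsetP (inW _ e0U)).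
  by apply: (subsetP (proj1 (wfp e0))); rewrite eab !inE eqxx.
have A2 : \sum_(e in Tm) (hits e - 1) + 1 <= #|C|.
  have := @acyclic_count V E hy setT (enum Tm) R eR setT0 (enum_uniq _).
  rewrite big_enum_cond /= (eq_bigl (mem Tm)); last by move=> e; rewrite andbT.
  apply=> [e|e x y]; rewrite mem_enum => eT.
    split; first exact: subsetT.
    apply: contraTneq eT => e0; rewrite !inE /hits e0 imset0 cards0 //.
  move=> xe ye lk; apply: (ac e x y) => //; first by move: eT; rewrite !inE => /andP[_ /asboolP].
  apply: rtc_mono lk => a b [?|[f [fT fe af bf]]]; apply: rtc1; first by left.
  right; exists f; split=> //.
  by move: fT; rewrite mem_enum !inE => /andP[_ /asboolP].
have deg : 4 * #|C| + #|cls R @: W| <= \sum_(X in C) #|[set e | crossing X e]|.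
  have WC : cls R @: W \subset C by apply: imsetS; apply: subsetT.
  rewrite mulnC -sum_nat_const -[X in _ + X]sum1_card -(setIidPr WC).
  rewrite [X in _ + X](eq_bigl (fun X => (X \in C) && (X \in cls R @: W))); last by move=> X; rewrite inE.
  rewrite big_mkcondr -big_split /=; apply: leq_sum => X XC.
  have [X0 XT] := Cprop X XC.
  case: ifP => [/imsetP[x]|_]; last by rewrite addn0; apply: deg4.
  rewrite inE => /existsP[e /andP[/eqP h3 xe] eX].
  apply: (deg5 (e := e)) => //.
    by rewrite crossP // eX xe andbT inE h3.
  by apply/eqP; rewrite eqn_leq hy3 -h3 leq_imset_card.
have tot : \sum_(X in C) #|[set e | crossing X e]| = \sum_(e in Cr) hits e.
  under eq_bigr => X XC do rewrite -sum1_card.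
  under eq_bigr => X XC do under eq_bigl => e do rewrite inE crossP //.
  rewrite (exchange_big_dep (mem Cr)) /=; last by move=> X e _ /andP[].
  apply: eq_bigr => e eCr; rewrite /hits -sum1_card; apply: eq_bigl => X.
  rewrite eCr /=; apply/andP/idP => [[]//|Xe]; split=> //.
  by apply: (subsetP (imsetS _ (subsetT _))) Xe.
have spl : \sum_(e in Cr) hits e = \sum_(e in Us) hits e + \sum_(e in Tm) hits e.
  rewrite (bigID (mem Us)) /=; congr (_ + _); apply: eq_bigl => e; rewrite !inE.
    by case: (1 < hits e).
  by case: (1 < hits e); rewrite //= negbK.
have usb : \sum_(e in Us) hits e <= 2 * #|Us| + #|Us3|.
  rewrite mulnC -sum_nat_const -[X in _ + X]sum1_card.
  rewrite [X in _ + X](eq_bigl (fun e => (e \in Us) && (hits e == 3))); last by move=> e; rewrite inE.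
  rewrite big_mkcondr -big_split /=; apply: leq_sum => e _.
  by have := hits3 e; case: eqP => [-> //|]; lia.
(* A crossing hyperedge has at least two hits. *)
have tmb : \sum_(e in Tm) hits e <= 2 * \sum_(e in Tm) (hits e - 1).
  by rewrite big_distrr /=; apply: leq_sum => e; rewrite !inE => /andP[h _]; lia.
move: A1 A2 A3 deg usb tmb; rewrite tot spl; lia.
Qed.

End Count.

(** * Correcting parities *)

Lemma odd_sum (I : finType) (f : I -> nat) :
  odd (\sum_i f i) = odd #|[set i | odd (f i)]|.
Proof.
rewrite -sum1_card [in RHS](eq_bigl (fun i => odd (f i))); last by move=> i; rewrite inE.
rewrite (bigID (fun i => odd (f i))) /= oddD.
have -> : odd (\sum_(i | ~~ odd (f i)) f i) = false.
  elim/big_rec: _ => // i n nf on; by rewrite oddD on (negbTE nf).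
rewrite addbF; elim/big_rec2: _ => // i m n oi e; by rewrite oddD oi e.
Qed.

Section Symdiff.
Variable T : finType.
Implicit Types A B X : {set T}.

Definition symdiff A B := [set x | (x \in A) (+) (x \in B)].

Lemma card_symdiff_odd A B : odd #|symdiff A B| = odd #|A| (+) odd #|B|.
Proof.
rewrite -(cardsID B A) -(cardsID A B) !oddD (setIC B A).
have -> : symdiff A B = (A :\: B) :|: (B :\: A).
  by apply/setP => x; rewrite !inE; case: (x \in A); case: (x \in B).
rewrite cardsU (_ : (A :\: B) :&: (B :\: A) = set0) ?cards0 ?subn0 ?oddD; last first.
  by apply/setP => x; rewrite !inE; case: (x \in A); case: (x \in B).
by move: (odd _) (odd _) (odd _) => [] [] [].
Qed.

Lemma symdiffI A B X : symdiff A B :&: X = symdiff (A :&: X) (B :&: X).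
Proof. by apply/setP => x; rewrite !inE; case: (x \in X); rewrite ?andbT ?andbF. Qed.

Lemma odd_pairI u v X : u <> v -> odd #|[set u; v] :&: X| = (u \in X) (+) (v \in X).
Proof.
move=> /eqP uv; case uX: (u \in X); case vX: (v \in X).
- by rewrite (setIidPl _) ?cards2 ?uv //; apply/subsetP => x; rewrite !inE => /orP[] /eqP ->.
- rewrite (_ : _ :&: _ = [set u]) ?cards1 //; apply/setP => x; rewrite !inE.
  have [->|] := eqVneq x u; first by rewrite uX.
  by have [->|] //= := eqVneq x v; rewrite vX.
- rewrite (_ : _ :&: _ = [set v]) ?cards1 //; apply/setP => x; rewrite !inE.
  have [->|] := eqVneq x v; first by rewrite vX orbT.
  by rewrite orbF; have [->|] //= := eqVneq x u; rewrite uX.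
- rewrite (_ : _ :&: _ = set0) ?cards0 //; apply/setP => x; rewrite !inE.
  have [->|] := eqVneq x v; first by rewrite vX orbT.
  by rewrite orbF; have [->|] //= := eqVneq x u; rewrite uX.
Qed.

End Symdiff.

Section Parity.
Variables (V E : finType) (hy : E -> {set V}).
Hypothesis hy3 : forall e, #|hy e| <= 3.
Notation Rel := (V -> V -> Prop).
Notation quasi := ({ffun E -> {set V}}).
Implicit Types (S : {set V}).
Local Notation wf := (wf hy).

Variable pi : quasi.
Hypothesis wfp : wf pi.

Definition degree_in (s : quasi) v := #|[set e | v \in s e]|.

Let F : {set E} := [set e | pi e != set0].

(** Connectivity must come from the hyperedges used by [pi], so that all others can be toggled
    freely. *)
Definition spanning (s : quasi) := wf s /\ forall x y, Tconn s F (@full V) x y.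

Lemma even_pair (e : E) (S : {set V}) : S \subset hy e -> ~~ odd #|S| ->
  S = set0 \/ exists a b, a <> b /\ S = [set a; b].
Proof.
move=> /subset_leq_card /leq_trans /(_ (hy3 e)).
case c: #|S| => [|[|[|[|n]]]] // _ _; first by left; apply/eqP; rewrite -cards_eq0 c.
right; have /cards2P[a [b [ab ->]]] : #|S| == 2 by rewrite c.
by exists a, b; split=> //; apply/eqP.
Qed.

Definition set_edge (s : quasi) e (S : {set V}) : quasi :=
  [ffun f => if f == e then S else s f].

Lemma set_edge_same s e S : set_edge s e S e = S.
Proof. by rewrite ffunE eqxx. Qed.

Lemma set_edge_other s e S f : f <> e -> set_edge s e S f = s f.
Proof. by move=> /eqP fe; rewrite ffunE (negbTE fe). Qed.

Lemma degree_set_edge s e S v : odd (degree_in (set_edge s e S) v) =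
  odd (degree_in s v) (+) (v \in symdiff (s e) S).
Proof.
rewrite /degree_in (cardsD1 e) [in RHS](cardsD1 e) !inE set_edge_same.
have -> : [set f | v \in set_edge s e S f] :\ e = [set f | v \in s f] :\ e.
  by apply/setP => f; rewrite !inE ffunE; case: eqP.
by rewrite !oddD !oddb; case: (v \in S); case: (v \in s e); case: (odd _).
Qed.

Lemma set_edge_wf s e S : wf s -> S \subset hy e -> ~~ odd #|S| -> wf (set_edge s e S).
Proof.
move=> ws Se oS f; rewrite ffunE; have [->|_] := eqVneq f e; last exact: ws.
by split=> //; apply: (even_pair Se).
Qed.

(** Parities can be corrected on any set that is even in each class of [Q]. The hyperedges of [A]
    may be switched on the way and must still carry their original pairs; the other hyperedges of
    [F] stay fixed, so that corrections can be nested. *)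
Definition flips (Q : Rel) (A : {set E}) := forall s (D : {set V}), spanning s ->
  (forall e, e \in A -> s e = pi e) ->
  (forall x, ~~ odd #|D :&: cls Q x|) ->
  exists s', [/\ spanning s', forall e, e \in F -> e \notin A -> s' e = s e
    & forall v, odd (degree_in s' v) = odd (degree_in s v) (+) (v \in D)].

(* [u] and [v] may be flipped by the edge [e] before the edges of [A] are
   touched. *)
Lemma flips_merge (Q : Rel) (A A' : {set E}) u v : is_equiv Q -> ~ Q u v ->
  A \subset A' -> A \subset F -> flips Q A ->
  (forall s, spanning s -> (forall e, e \in A' -> s e = pi e) ->
    exists s' u' , [/\ spanning s', Q u u' ,
      forall e, e \in F -> e \in A \/ e \notin A' -> s' e = s e
      & forall x, odd (degree_in s' x) = odd (degree_in s x) (+) (x \in [set u'; v])]) ->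
  flips (merge Q [set u; v]) A'.
Proof.
move=> eQ nQ AA' AF flQ mv s D sp sA Dev; have [Qr Qs Qt] := eQ.
pose Q' := merge Q [set u; v].
have [s1 [D1 [sp1 s1A D1ev par]]] : exists s1 D1, [/\ spanning s1,
    forall e, e \in F -> e \in A \/ e \notin A' -> s1 e = s e,
    forall x, ~~ odd #|D1 :&: cls Q x|
    & forall x, odd (degree_in s1 x) (+) (x \in D1) = odd (degree_in s x) (+) (x \in D)].
  have cuv : cls Q' u = cls Q u :|: cls Q v.
    apply/setP => x; rewrite !inE; apply/asboolP/orP.
      case=> [ux|[_ [z]]]; first by left; apply/asboolP.
      by rewrite !inE => /orP[] /eqP -> xz; [left|right]; apply/asboolP; apply: Qs.
    case=> /asboolP h; first by left.
    by right; split; [exists u; rewrite ?inE ?eqxx | exists v; rewrite ?inE ?eqxx ?orbT //; apply: Qs].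
  have dis : [disjoint D :&: cls Q u & D :&: cls Q v].
    rewrite disjoints_subset; apply/subsetP => x; rewrite !inE => /andP[_ /asboolP ux].
    by rewrite negb_and; apply/orP; right; apply/asboolP => vx; apply: nQ; apply: Qt ux _; apply: Qs.
  have := Dev u; rewrite -/Q' cuv setIUr cardsU (disjoint_setI0 dis) cards0 subn0 oddD => Duv.
  have other x : ~ Q u x -> ~ Q v x -> cls Q' x = cls Q x.
    move=> nux nvx; apply/setP => y; rewrite !inE; apply/asboolP/asboolP; last by left.
    case=> [//|[[z + xz] _]]; rewrite !inE => /orP[] /eqP ez; subst z.
      by case: nux; apply: Qs.
    by case: nvx; apply: Qs.
  (* The two merged classes contain numbers of vertices of [D] of the same parity. If it is even,
     nothing has to be moved; if it is odd, one move changes both. *)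
  have [ou|ou] := boolP (odd #|D :&: cls Q u|); last first.
    exists s, D; split=> // x.
    have [ux|nux] := pselect (Q u x); first by rewrite -(proj2 (eq_cls _ _ eQ) ux).
    have [vx|nvx] := pselect (Q v x).
      by rewrite -(proj2 (eq_cls _ _ eQ) vx); move: Duv; rewrite (negbTE ou).
    by rewrite -other.
  have [s1 [u' [sp1 uu' s1A par]]] := mv s sp sA.
  have nu'v : u' <> v by move=> e; apply: nQ; rewrite -e.
  exists s1, (symdiff D [set u'; v]); split=> // x; last first.
    by rewrite par [x \in symdiff _ _]inE; case: (odd _); case: (_ \in _); case: (_ \in _).
  rewrite symdiffI card_symdiff_odd odd_pairI // !in_cls.
  have [ux|nux] := pselect (Q u x).
    have xu' : Q x u' by apply: Qt uu'; apply: Qs.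
    have nxv : ~ Q x v by move=> xv; apply: nQ; apply: Qt xv.
    by rewrite -(proj2 (eq_cls _ _ eQ) ux) ou (asboolT xu') (asboolF nxv).
  have [vx|nvx] := pselect (Q v x).
    have nxu' : ~ Q x u' by move=> xu'; apply: nux; apply: Qt uu' _; apply: Qs.
    rewrite -(proj2 (eq_cls _ _ eQ) vx) (asboolT (Qs _ _ vx)) (asboolF nxu').
    by move: Duv; rewrite ou /=; case: (odd _).
  rewrite asboolF; last by move=> xu'; apply: nux; apply: Qt uu' _; apply: Qs.
  by rewrite asboolF /= ?addbF -?other // => xv; apply: nvx; apply: Qs.
have [|s2 [sp2 s2A par2]] := flQ s1 D1 sp1 _ D1ev.
  move=> e eA; have eA' := subsetP AA' e eA.
  by rewrite s1A //; [apply: sA | apply: (subsetP AF) | left].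
exists s2; split=> // [e eF eA'|x]; last by rewrite par2.
rewrite s2A //; first by apply: s1A => //; right.
by apply: contra eA'; apply: (subsetP AA').
Qed.

Lemma wf_even s e : wf s -> s e \subset hy e /\ ~~ odd #|s e|.
Proof.
move=> ws; have [se [->|[a [b [/eqP nab eab]]]]] := ws e; first by rewrite cards0 sub0set.
by split=> //; rewrite eab cards2 nab.
Qed.

Lemma symdiffK S S' : symdiff S (symdiff S S') = S'.
Proof. by apply/setP => x; rewrite !inE; case: (x \in S); case: (x \in S'). Qed.

Lemma spanning_flip s e u v : spanning s -> e \notin F -> u \in hy e -> v \in hy e ->
  u <> v -> exists s', [/\ spanning s', forall f, f \in F -> s' f = s f
   & forall x, odd (degree_in s' x) = odd (degree_in s x) (+) (x \in [set u; v])].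
Proof.
move=> [ws Ts] eF ue ve nuv; have [se evens] := wf_even e ws.
have sF f : f \in F -> f <> e by move=> fF fe; move: eF; rewrite -fe fF.
exists (set_edge s e (symdiff (s e) [set u; v])); split.
- split.
    apply: set_edge_wf => //.
      apply/subsetP => x; rewrite !inE; case: (boolP (x \in s e)) => [/(subsetP se) //|_ /=].
      by move=> /orP[] /eqP ->.
    by rewrite card_symdiff_odd (negbTE evens) cards2 (introF eqP nuv).
  move=> x y; have := Ts x y; apply: rtc_mono => a b [_ [f [fF af bf]]].
  by apply: (@T_edge _ _ _ _ _ f) => //; rewrite set_edge_other //; apply: sF.
- by move=> f /sF fe; rewrite set_edge_other.
- by move=> x; rewrite degree_set_edge symdiffK.
Qed.

(** Some vertex [p] of the pair is reached from [c] without [e]; replacing [p] by [c] in the pair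
    keeps all connected. Which of [a] and [b] this is cannot be chosen, whence the need for a
    previous link between them. *)
Lemma spanning_switch s e a b c : spanning s -> e \in F -> s e = [set a; b] -> a <> b ->
  c \in hy e -> c <> a -> c <> b ->
  exists s' p, [/\ spanning s', p \in [set a; b], forall f, f <> e -> s' f = s f
   & forall x, odd (degree_in s' x) = odd (degree_in s x) (+) (x \in [set p; c])].
Proof.
move=> [ws Ts] eF seab nab ce nca ncb.
have [p [q [ep epq npq nqc cp]]] : exists p q, [/\ p \in [set a; b], [set a; b] = [set p; q], p <> q,
    q <> c & Tconn s (F :\ e) (@full V) c p].
  have key p : p \in [set a; b] -> Tconn s (F :\ e) (@full V) c p -> exists p q,
    [/\ p \in [set a; b], [set a; b] = [set p; q], p <> q, q <> c & Tconn s (F :\ e) (@full V) c p].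
    move=> pab cp; move: (pab); rewrite !inE => /orP[] /eqP ep.
      exists p, b; split=> //; subst p => //; exact: nesym.
    by exists p, a; split=> //; [rewrite ep setUC | subst p; apply: nesym | apply: nesym].
  case: (T_split e ws (Ts c a)) => [ca|[p [q [[_ pe _ _] _ cp _]]]].
    by apply: (key a) => //; rewrite !inE eqxx.
  by apply: (key p) => //; rewrite -seab.
have [se evens] := wf_even e ws.
have pe : p \in s e by rewrite seab.
have qe : q \in s e by rewrite seab epq !inE eqxx orbT.
exists (set_edge s e [set q; c]), p; split=> //.
- split.
    apply: set_edge_wf => //; last by rewrite cards2 (introF eqP nqc).
    by apply/subsetP => x; rewrite !inE => /orP[] /eqP -> //; apply: (subsetP se).
  set s' := set_edge s e _.
  have sub : relsub (Tconn s (F :\ e) (@full V)) (Tconn s' F (@full V)).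
    apply: rtc_mono => x y [_ [f [fF xf yf]]]; move: fF; rewrite !inE => /andP[/eqP fe fF].
    by apply: (@T_edge _ _ _ _ _ f); rewrite ?set_edge_other // inE.
  have [_ sy tr] := T_equiv s' F (full_equiv V).
  have pq : Tconn s' F (@full V) p q.
    apply: (tr _ c); first by apply: sy; apply: sub.
    by apply: (@T_edge _ _ _ _ _ e) => //; rewrite set_edge_same !inE eqxx ?orbT.
  move=> x y; have := Ts x y; apply: rtc_mono => a' b' [_ [f [fF af bf]]].
  have [fe|/eqP fe] := eqVneq f e; last first.
    by apply: (@T_edge _ _ _ _ _ f) => //; rewrite set_edge_other.
  move: af bf; rewrite fe seab epq !inE => /orP[] /eqP -> /orP[] /eqP -> //;
    by [apply: rtc_refl | apply: sy].
- by move=> f fe; rewrite set_edge_other.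
- move=> x; rewrite degree_set_edge seab epq; congr (_ (+) _).
  rewrite !inE; have [->|/eqP xp] := eqVneq x p.
    by rewrite (introF eqP npq) /= (introF eqP) // => pc; move: cp nca ncb ep;
      rewrite -pc !inE => _ /eqP/negbTE-> /eqP/negbTE->.
  by have [->|_] := eqVneq x q; rewrite //= (introF eqP nqc).
Qed.

(** The links of the tight complement are replayed as parity corrections, merging two classes of [Q]
    at a time. *)
Lemma flips_full (Q : Rel) (A : {set E}) : is_equiv Q -> flips Q A -> A \subset F ->
  (forall e x y, e \in A -> x \in hy e -> y \in hy e -> Q x y) ->
  Kconn hy pi setT (@full V) = @full V -> exists A', flips (@full V) A'.
Proof.
move=> eQ flQ AF AQ Kf; have [n] := ubnP (#|{: V * V}| - relcard Q).
elim: n Q A eQ flQ AF AQ => // n IH Q A eQ flQ AF AQ Qn.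
have [Qf|nQf] := pselect (Q = @full V); first by exists A; rewrite -Qf.
have [Qr Qs Qt] := eQ.
(* Otherwise [Q] would satisfy the rule that generates [Kconn], and would relate all vertices. *)
have [e [u [v [te ue ve nQ]]]] : exists e u v, [/\ tame pi Q e, u \in hy e, v \in hy e & ~ Q u v].
  apply: contrapT => no; apply: nQf; apply: rel_eqP => // x y _.
  have : Kconn hy pi setT (@full V) x y by rewrite Kf.
  elim=> [z|a b _ //|a b c _ ab _ bc|e a b _ _ IHe ae be _].
  - exact: Qr.
  - exact: Qs.
  - exact: Qt ab bc.
  - by apply: contrapT => nab; apply: no; exists e, a, b.
have step A' u' v' : ~ Q u' v' -> flips (merge Q [set u'; v']) A' -> A' \subset F ->
    (forall f x y, f \in A' -> x \in hy f -> y \in hy f -> merge Q [set u'; v'] x y) ->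
    exists A', flips (@full V) A'.
  move=> nQ' fl' A'F A'Q; have eQ' := merge_equiv [set u'; v'] eQ.
  apply: (IH _ A' eQ' fl' A'F A'Q).
  have lt : relcard Q < relcard (merge Q [set u'; v']).
    apply: relcard_lt; first by move=> x y; left.
    move=> eqQ; apply: nQ'; rewrite eqQ; right.
    by split; [exists u' | exists v']; rewrite ?inE ?eqxx ?orbT.
  have : relcard (merge Q [set u'; v']) <= #|{: V * V}| by apply: max_card.
  by move: Qn lt; lia.
have nuv : u <> v by move=> uv; apply: nQ; rewrite uv.
have [eF|eF] := boolP (e \in F); last first.
  apply: (step A u v) => //; last by move=> f x y fA xf yf; left; apply: AQ xf yf.
  apply: (flips_merge eQ nQ (subxx A) AF flQ) => s sp _.
  have [s' [sp' sF par]] := spanning_flip sp eF ue ve nuv.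
  by exists s', u; split=> // f /sF.
have [sube [e0|[a [b [nab eab]]]]] := wfp e; first by move: eF; rewrite inE e0 eqxx.
have ae : a \in pi e by rewrite eab !inE eqxx.
have be : b \in pi e by rewrite eab !inE eqxx orbT.
have Qab := te a b ae be.
have [c [ce nQac]] : exists c, c \in hy e /\ ~ Q a c.
  have [au|] := pselect (Q a u); last by exists u.
  by exists v; split=> // av; apply: nQ; apply: Qt av; apply: Qs.
have nQbc : ~ Q b c by move=> bc; apply: nQac; apply: Qt bc.
have nca : c <> a by move=> ca; apply: nQac; rewrite ca.
have ncb : c <> b by move=> cb; apply: nQbc; rewrite cb.
have nac : a <> c by apply: nesym.
have nbc : b <> c by apply: nesym.
(* The hyperedges switched so far lie inside classes of [Q], so [e] has not been spent. *)
have eA : e \notin A by apply/negP => eA; apply: nQac; apply: (AQ e) => //; apply: (subsetP sube).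
apply: (step (e |: A) a c) => //; last 1 first.
- move=> f x y; rewrite in_setU1 => /orP[/eqP ->|fA] xf yf; last by left; apply: AQ xf yf.
  have hit z : z \in hy e -> exists2 w, w \in [set a; c] & Q z w.
    case/(set3_cover (hy3 e) (subsetP sube _ ae) (subsetP sube _ be) ce nab nac nbc) => ->.
    + by exists a; rewrite ?inE ?eqxx.
    + by exists a; rewrite ?inE ?eqxx //; apply: Qs.
    + by exists c; rewrite ?inE ?eqxx ?orbT.
  by right; split; apply: hit.
- apply: (flips_merge eQ nQac (subsetUr _ _) AF flQ) => s sp sA.
  have se : s e = [set a; b] by rewrite sA // setU11.
  have [s' [p [sp' pab so par]]] := spanning_switch sp eF se nab ce nca ncb.
  exists s', p; split=> //; first by move: pab; rewrite !inE => /orP[] /eqP ->.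
  move=> f _ fA; apply: so => fe; move: fA; rewrite fe setU11 (negbTE eA).
  by case.
- by rewrite subUset AF andbT sub1set.
Qed.

Lemma even_spanning : forest pi -> Tconn pi setT (@full V) = @full V ->
  Kconn hy pi setT (@full V) = @full V ->
  exists s, [/\ wf s, forall x y, Tconn s setT (@full V) x y & forall v, ~~ odd (degree_in s v)].
Proof.
move=> fp Tf Kf; pose Id : Rel := fun x y => x = y.
have eId : is_equiv Id by split=> // x y z; rewrite /Id => -> ->.
have flId : flips Id set0.
  move=> s D sp _ Dev; exists s; split=> // v.
  have -> : v \in D = false; last by rewrite addbF.
  apply/negP => vD; have := Dev v.
  have -> : D :&: cls Id v = [set v]; last by rewrite cards1.
  apply/setP => x; rewrite !inE; apply/andP/eqP => [[_ /asboolP]|->] //.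
  by split=> //; apply/asboolP.
have [|A flA] := flips_full eId flId (sub0set _) _ Kf; first by move=> e x y; rewrite inE.
have sp : spanning pi.
  split=> // x y; have : Tconn pi setT (@full V) x y by rewrite Tf.
  apply: T_mono => f a b _ af _ _ _; split=> //.
  by rewrite inE; apply/set0Pn; exists a.
pose D := [set v | odd (degree_in pi v)].
have [//||s [[ws Ts] _ par]] := flA pi D sp.
  move=> x; have -> : cls (@full V) x = setT by apply/setP => y; rewrite !inE; apply/asboolP.
  (* The sum of the degrees is even because each hyperedge contributes 0 or 2. *)
  rewrite setIT -odd_sum /degree_in.
  have -> : \sum_i #|[set e | i \in pi e]| = \sum_e #|pi e|.
    under eq_bigr => i _ do rewrite -sum1_card.
    rewrite (exchange_big_dep xpredT) //=; apply: eq_bigr => e _.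
    by rewrite -sum1_card; apply: eq_bigl => x'; rewrite inE.
  elim/big_rec: _ => // e n _ nn; rewrite oddD (negbTE nn) addbF.
  by have [] := wf_even e wfp.
exists s; split=> // [x y|v]; last by rewrite par inE addbb.
by have := Ts x y; apply: T_mono.
Qed.

End Parity.

(** * Euler trails *)

Section Euler.
Variables (V E : finType) (s : {ffun E -> {set V}}).
Hypothesis s2 : forall e, s e = set0 \/ exists a b, a <> b /\ s e = [set a; b].

Fixpoint trail x (l : seq (E * V)) : bool :=
  if l is (e, y) :: l' then (s e == [set x; y]) && trail y l' else true.

Local Notation target x l := (last x [seq p.2 | p <- l]).

Lemma trail_cat x l1 l2 : trail x (l1 ++ l2) = trail x l1 && trail (target x l1) l2.
Proof. by elim: l1 x => //= -[e y] l1 IH x; rewrite IH andbA. Qed.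

Lemma edge_ends e x y v : s e = [set x; y] -> (v \in s e) = (v == x) (+) (v == y).
Proof.
move=> se; case: (s2 e) => [e0|[a [b [/eqP ab eab]]]].
  by have := set21 x y; rewrite -se e0 inE.
have /eqP xy : x <> y.
  by move=> exy; have := cards2 a b; rewrite -eab se exy setUid cards1 ab.
by rewrite se !inE; have [->|_] := eqVneq v x; rewrite ?(negbTE xy).
Qed.

Lemma trail_parity x l v : trail x l ->
  odd (count (fun p => v \in s p.1) l) = (v == x) (+) (v == target x l).
Proof.
elim: l x => [|[e y] l IH] x /=; first by rewrite addbb.
case/andP=> /eqP se /IH lv; rewrite oddD lv oddb (edge_ends v se).
by case: (v == x); case: (v == y); case: (v == last _ _).
Qed.

Lemma trail_visited x l e v : trail x l -> e \in [seq p.1 | p <- l] -> v \in s e ->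
  v \in x :: [seq p.2 | p <- l].
Proof.
elim: l x => //= -[e' y] l IH x /andP[/eqP se tl]; rewrite !inE /= => /orP[/eqP ->|el] vs.
  by move: vs; rewrite se !inE => /orP[->|->]; rewrite ?orbT.
by have := IH y tl el vs; rewrite inE => ->; rewrite orbT.
Qed.

Fixpoint steps x (l : seq (E * V)) : seq (V * E) :=
  if l is (e, y) :: l' then (x, e) :: steps y l' else [::].

Lemma steps_fst x l : rcons [seq p.1 | p <- steps x l] (target x l) = x :: [seq p.2 | p <- l].
Proof. by elim: l x => //= -[e y] l IH x /=; rewrite IH. Qed.

Lemma steps_snd x l : [seq p.2 | p <- steps x l] = [seq p.1 | p <- l].
Proof. by elim: l x => //= -[e y] l IH x /=; rewrite IH. Qed.

Local Notation follows := [rel p q : V * E | s p.2 == [set p.1; q.1]].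

Lemma steps_path x e y l z : trail x ((e, y) :: l) -> target y l = z.1 ->
  path follows (x, e) (rcons (steps y l) z).
Proof.
elim: l x e y => [|[e' y'] l IH] x e y /= /andP[se]; first by move=> _ <-; rewrite se.
by rewrite se; apply: IH.
Qed.

Hypothesis conn : forall x y, Tconn s setT (@full V) x y.
Hypothesis even_deg : forall v, ~~ odd (degree_in s v).
Hypothesis V1 : 1 < #|V|.

(** A longest trail is closed by parity. If it missed a vertex, some pair would lead out of it, and
    the closed trail, started at the vertex concerned, could be prolonged. Pairs left over do no
    harm, since only the vertices need be visited. *)
Lemma euler_trail : exists c : seq (V * E),
  [/\ 1 < size c, cycle follows c, uniq [seq p.2 | p <- c]
    & forall v, v \in [seq p.1 | p <- c]].
Proof.
pose P m := `[< exists x l, [/\ trail x l, uniq [seq p.1 | p <- l] & size l = m] >].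
have [x0 _] : exists x0 : V, x0 \in V by apply/card_gt0P; apply: ltnW V1.
have P0 : exists m, P m by exists 0; apply/asboolP; exists x0, [::].
have Pb m : P m -> m <= #|E|.
  case/asboolP=> x [l [_ ul <-]]; rewrite -(size_map fst) -(card_uniqP ul); exact: max_card.
case: (ex_maxnP P0 Pb) => m /asboolP[x [l [tl ul sl]]] mx.
have nolonger x' l' : trail x' l' -> uniq [seq p.1 | p <- l'] -> size l < size l' -> False.
  move=> t' u' lt; have : P (size l') by apply/asboolP; exists x', l'.
  by move/mx; rewrite -sl leqNgt lt.
have closed : target x l = x.
  apply/eqP; apply/negPn/negP => nx; set y := target x l in nx *.
  have [e ye el] : exists2 e, y \in s e & e \notin [seq p.1 | p <- l].
    apply: contrapT => no; have := trail_parity y tl; rewrite -/y eqxx (negbTE nx) /=.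
    have -> : count (fun p => y \in s p.1) l = degree_in s y.
      rewrite -(count_map fst (fun e => y \in s e)) -size_filter /degree_in.
      rewrite -(card_uniqP (filter_uniq _ ul)); apply: eq_card => e.
      rewrite mem_filter inE; case ye: (y \in s e) => //=.
      by apply: contrapT => /negP el; apply: no; exists e.
    by apply/negP.
  have [se|[a [b [nab se]]]] := s2 e; first by rewrite se inE in ye.
  have [z sez] : exists z, s e = [set y; z].
    move: ye; rewrite se !inE => /orP[] /eqP ->; first by exists b.
    by exists a; rewrite setUC.
  apply: (nolonger x (rcons l (e, z))); last by rewrite size_rcons.
    by rewrite -cats1 trail_cat tl /= sez eqxx.
  by rewrite map_rcons rcons_uniq el.
have visited v : v \in x :: [seq p.2 | p <- l].
  apply: contrapT => /negP nv.
  suff : v \in x :: [seq p.2 | p <- l] by rewrite (negbTE nv).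
  have := conn x v; elim=> [|a b _ va [_ [e [_ ae be]]]]; first by rewrite mem_head.
  apply: contrapT => /negP nb; have el : e \notin [seq p.1 | p <- l].
    by apply: contra nb => el; apply: trail_visited el be.
  have seab : s e = [set a; b].
    have nab : a <> b by move=> ab; move: nb; rewrite -ab va.
    have [se|[c [d [ncd se]]]] := s2 e; first by rewrite se inE in ae.
    move: ae be; rewrite se !inE.
    by move=> /orP[] /eqP ea /orP[] /eqP eb; subst => //; rewrite setUC.
  (* The closed trail is rotated to start and end at [a], after which [e] is appended. *)
  have [l1 [l2 [el12 ta]]] : exists l1 l2, l = l1 ++ l2 /\ target x l1 = a.
    move: va; rewrite inE => /orP[/eqP ->|]; first by exists [::], l.
    case/mapP=> -[f c] fl /= ->; case/splitPr: fl => l1 l2.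
    by exists (rcons l1 (f, c)), l2; rewrite cat_rcons map_rcons last_rcons.
  subst l; move: tl closed; rewrite trail_cat ta map_cat last_cat ta => /andP[t1 t2] cl.
  apply: (nolonger a (l2 ++ rcons l1 (e, b))).
  - by rewrite trail_cat t2 cl -cats1 trail_cat t1 ta /= seab eqxx.
  - move: ul el; rewrite !map_cat map_rcons !cat_uniq rcons_uniq mem_cat negb_or.
    case/and3P=> u1 h u2 /andP[e1 e2]; rewrite u1 u2 e1 !andbT /=.
    apply: contra h => /hasP[f]; rewrite mem_rcons inE => /orP[/eqP -> /= f2|f1 f2].
      by rewrite f2 in e2.
    by apply/hasP; exists f.
  - by rewrite !size_cat size_rcons addnS ltnS addnC.
have fst_steps v : v \in [seq p.1 | p <- steps x l].
  have := visited v; rewrite -steps_fst mem_rcons inE closed => /orP[/eqP ->|->] //.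
  case el: l => [|[e y] l'] /=; last by rewrite mem_head.
  have [a [b [_ _ /eqP ab]]] := card_gt1P V1; case: ab.
  by have := visited a; have := visited b; rewrite el !inE => /eqP -> /eqP ->.
exists (steps x l); rewrite steps_snd; split=> //; last first.
  case el: l tl closed => [|[e y] l'] //= tl closed.
  by apply: (@steps_path x e y l' (x, e)) => //=.
have : size [seq p.1 | p <- steps x l] < 2 -> False; last first.
  by rewrite size_map ltnNge => h; apply: contrapT => /negP; rewrite -leqNgt => h'; apply: h; rewrite -ltnNge ltnS.
move=> lt; have : #|V| <= size [seq p.1 | p <- steps x l].
  by rewrite -cardsT; apply: leq_trans (card_size _); apply: subset_leq_card; apply/subsetP => v _.
by move=> /leq_ltn_trans /(_ lt); rewrite ltnNge V1.
Qed.

End Euler.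

(** * The closure of a claw-free graph *)

Section Segments.
Variables (T : finType) (e : rel T).

Definition hamiltonian_rel := exists c, [/\ uniq c, cycle e c & forall x, x \in c].

Definition seg a l b := exists q, [/\ l = a :: q, path e a q & last a q = b].

Lemma seg_cat a b c d l l' : seg a l b -> e b c -> seg c l' d -> seg a (l ++ l') d.
Proof.
case=> q [-> pq <-] bc [r [-> pr <-]]; exists (q ++ c :: r).
by rewrite cat_path last_cat /= pq bc pr.
Qed.

Lemma seg1 a : seg a [:: a] a. Proof. by exists [::]. Qed.

Lemma seg_cycle a b l : seg a l b -> e b a -> cycle e l.
Proof. by case=> q [-> pq qb] ba; rewrite /= rcons_path pq qb. Qed.

Lemma seg_head a b l : seg a l b -> a \in l.
Proof. by case=> q [-> _ _]; rewrite mem_head. Qed.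

Lemma seg_last a b l : seg a l b -> b \in l.
Proof. by case=> q [-> _ <-]; rewrite mem_last. Qed.

Hypothesis sym : symmetric e.

Lemma seg_rev a b l : seg a l b -> seg b (rev l) a.
Proof.
case=> q [-> pq <-]; exists (rev (belast a q)); split.
- by rewrite -rev_rcons -lastI.
- by rewrite rev_path; apply: sub_path pq => x y /=; rewrite sym.
- by case: q {pq} => //= b' q; rewrite rev_cons last_rcons.
Qed.

Lemma seg_split a b l1 l2 : l1 != [::] -> l2 != [::] -> seg a (l1 ++ l2) b ->
  exists c d, [/\ seg a l1 c, seg d l2 b & e c d].
Proof.
case: l1 => [//|a' q] _; case: l2 => [//|d r] _ [q' [[<- <-]]].
rewrite cat_path last_cat /= => /and3P[pq cd pr] <-.
by exists (last a' q), d; split=> //; [exists q|exists r].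
Qed.

Lemma seg_ham a b l s : seg a l b -> e b a -> perm_eq l s -> uniq s ->
  (forall x, x \in s) -> hamiltonian_rel.
Proof.
move=> sl ba ls us cs; exists l; split; first by rewrite (perm_uniq ls).
  exact: seg_cycle ba.
by move=> x; rewrite (perm_mem ls).
Qed.

End Segments.

Ltac count_perm :=
  let f := fresh "f" in
  apply/permP => f;
  do 3 rewrite ?count_cat ?count_rev /=;
  repeat match goal with |- context [nat_of_bool ?b] => move: (nat_of_bool b) => ? end;
  repeat match goal with |- context [count f ?l] => move: (count f l) => ? end;
  clear; lia.

Lemma uniq_cat_neq (T : eqType) (l1 l2 : seq T) a b : uniq (l1 ++ l2) ->
  a \in l1 -> b \in l2 -> a <> b.
Proof.
rewrite cat_uniq => /and3P[_ /hasPn h _] al bl ab.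
by have := h b bl; rewrite /= -ab al.
Qed.

Section RemoveEdge.
Variables (T : finType) (e : rel T).
Hypothesis sym : symmetric e.

Definition remove_edge u v : rel T := fun a b =>
  e a b && ~~ (((a == u) && (b == v)) || ((a == v) && (b == u))).

Lemma remove_edge_sym u v : symmetric (remove_edge u v).
Proof.
move=> a b; rewrite /remove_edge sym.
by case: (a == u); case: (a == v); case: (b == u); case: (b == v).
Qed.

Lemma hamilton_path u v : 2 < #|T| -> hamiltonian_rel e -> hamiltonian_rel (remove_edge u v) \/
  exists p, [/\ path (remove_edge u v) u p, uniq (u :: p), last u p = v
    & forall x, x \in u :: p].
Proof.
set e0 := remove_edge u v => T3 [c [uc cc ca]].
have [cc0|ncc0] := boolP (cycle e0 c); first by left; exists c.
right; have [x nx] : exists x, ~~ e0 x (next c x).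
  apply: contrapT => no; move/negP: ncc0; apply; apply: cycle_from_next => // x _.
  by apply: contrapT => /negP n; apply: no; exists x.
set y := next c x in nx; have [i q rc] := rot_to (ca y).
have ur : uniq (y :: q) by rewrite -rc rot_uniq.
have cr : cycle e (y :: q) by rewrite -rc rot_cycle.
have car z : z \in y :: q by rewrite -rc mem_rot.
have lastq : last y q = x.
  have <- : prev c y = x by rewrite /y prev_next.
  have gen z r : y \notin r -> prev_at y y z r = last z r.
    elim: r z => [|b r IH] z /=; first by rewrite eqxx.
    by rewrite inE negb_or => /andP[/negbTE -> /IH].
  by rewrite -(prev_rot i uc) rc /= gen //; case/andP: ur.
have exy : e x y by move: cr; rewrite /= rcons_path lastq => /andP[].
have uvxy : (x == u) && (y == v) || (x == v) && (y == u).
  by apply: contrapT => /negP n; move: nx; rewrite /e0 /remove_edge exy n.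
(* With at least three vertices, the cycle traverses the deleted edge only once. *)
have pq : path e0 y q.
  case: q => [|b [|b' q]] in rc ur cr car lastq *; first by [].
    have : #|T| <= size [:: y; b].
      by rewrite -cardsT; apply: leq_trans (card_size _); apply: subset_leq_card; apply/subsetP => z _.
    by rewrite leqNgt T3.
  move: cr; rewrite /= rcons_path => /and3P[eyb eb' /andP[pq _]].
  move: (ur); rewrite /= !inE !negb_or => /and3P[/and3P[yb yb' yq] /andP[bb' bq] _].
  have bx : b != x.
    by apply/eqP => bx; have := mem_last b' q; rewrite /= in lastq; rewrite lastq -bx inE (negbTE bb') (negbTE bq).
  have xy : x != y by apply/eqP => xy; have := mem_last b' q; rewrite /= in lastq; rewrite lastq xy inE (negbTE yb') (negbTE yq).
  apply/andP; split.
    rewrite /e0 /remove_edge eyb /=; move: uvxy bx; case/orP=> /andP[/eqP <- /eqP <-] /negbTE ->;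
      by rewrite ?andbF ?orbF //= eq_sym (negbTE xy).
  have : path e b (b' :: q) by rewrite /= eb'.
  apply: (@sub_in_path _ (predC1 y)).
    move=> z z' zy zy' ezz'; rewrite /e0 /remove_edge ezz' /=.
    move: zy zy'; rewrite !inE; case/orP: uvxy => /andP[_ /eqP <-] /negbTE -> /negbTE ->;
      by rewrite ?andbF.
  apply/allP => z zb; rewrite !inE; apply/eqP => zy; move: zb.
  by rewrite zy !inE (negbTE yb) (negbTE yb') (negbTE yq).
have s0 : symmetric e0 by apply: remove_edge_sym.
case/orP: uvxy => /andP[/eqP xu /eqP yv].
  have : seg e0 y (y :: q) x by exists q.
  case/(seg_rev s0) => r [rr pr lr]; exists r; rewrite -xu -yv; split=> //.
    by rewrite -rr rev_uniq.
  by move=> z; rewrite -rr mem_rev.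
by exists q; rewrite -yv; split=> //; rewrite lastq.
Qed.

End RemoveEdge.

Lemma seg_headE (T : finType) (e : rel T) a x l b : seg e a (x :: l) b -> a = x.
Proof. by case=> q [[]]. Qed.

(* Suppose that [e] has a Hamilton path from [u] to [v].  If it does not close
   up by one exchange at [x] or [w], the neighbours of [x] and [w] inside the
   subpath between them are joined to [v] and [u], and two exchanges close it. *)
Lemma ham_of_path (T : finType) (e : rel T) u v x w p : symmetric e -> irreflexive e ->
  path e u p -> uniq (u :: p) -> last u p = v -> (forall z, z \in u :: p) ->
  e x w -> e x u -> e x v -> e w u -> e w v ->
  (forall t, e x t -> t <> u -> t <> v -> e t u || e t v) ->
  (forall t, e w t -> t <> u -> t <> v -> e t u || e t v) -> hamiltonian_rel e.
Proof.
move=> sym irr pp up pv pa xw xu xv wu wv Nx Nw.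
wlog : x w xw xu xv wu wv Nx Nw / exists s1 s2 s3, u :: p = s1 ++ x :: s2 ++ w :: s3.
  move=> H; have nxw : x <> w by move=> xw'; move: xw; rewrite xw' irr.
  have [s1 [s2 E]] : exists s1 s2, u :: p = s1 ++ x :: s2.
    by case/splitPr: (pa x) => s1 s2; exists s1, s2.
  have := pa w; rewrite E mem_cat inE => /or3P[ws1|/eqP ewx|ws2].
  - apply: (H w x) => //; first by rewrite sym.
    by case/splitPr: ws1 E => r1 r2 E; exists r1, r2, s2; rewrite E -catA.
  - by case: nxw.
  - by apply: (H x w) => //; case/splitPr: ws2 E => r1 r2 E; exists s1, r1, r2.
case=> s1 [s2 [s3 E]].
have sg : seg e u (u :: p) v by exists p.
rewrite E in sg up pa.
have s1n : s1 != [::].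
  by apply/eqP => s10; move: sg; rewrite s10 => /seg_headE ux; move: xu; rewrite ux irr.
have [x' [x0 [S1 S23 x'x]]] := seg_split s1n (isT : x :: s2 ++ w :: s3 != [::]) sg.
have ? := seg_headE S23; subst x0.
have [w' [w0 [S2 S3 w'w]]] := @seg_split _ _ _ _ (x :: s2) (w :: s3) isT isT S23.
have ? := seg_headE S3; subst w0.
have s3n : s3 != [::].
  apply/eqP => s30; move: S3; rewrite s30 => -[q [[<-] _ /= vw]].
  by move: wv; rewrite -vw irr.
have [w0 [w1 [W S4 ww1]]] := @seg_split _ _ _ _ [:: w] s3 isT s3n S3.
have [w'v|nw'v] := boolP (e w' v).
  have S12 := seg_cat S1 x'x S2.
  apply: (seg_ham (seg_cat S3 _ (seg_rev sym S12)) _ _ up pa); rewrite 1?sym //.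
  by count_perm.
have s2n : s2 != [::].
  by apply/eqP => s20; move: S2 nw'v; rewrite s20 => -[q [[<-] _ /= <-]]; rewrite xv.
have [x0 [x1 [X S2' xx1]]] := @seg_split _ _ _ _ [:: x] s2 isT s2n S2.
have ? : x = x0.
  by case: X => q [[<-] _].
subst x0.
have x1s2 := seg_head S2'; have w's2 := seg_last S2'; have us1 := seg_head S1; have vs3 := seg_last S4.
have nu z : z \in s2 -> z <> u.
  move=> zs; apply: nesym; apply: (uniq_cat_neq up) => //.
  by rewrite inE mem_cat zs orbT.
have nv z : z \in s2 -> z <> v.
  move=> zs; have up' : uniq ((s1 ++ x :: s2) ++ w :: s3) by rewrite -catA.
  by apply: (uniq_cat_neq up'); rewrite ?mem_cat ?inE ?zs ?vs3 ?orbT.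
have [x1u|nx1u] := boolP (e x1 u).
  have S12 := seg_cat S1 x'x (seg1 e x).
  have S34 := seg_cat S2' w'w S3.
  apply: (seg_ham (seg_cat S12 xv (seg_rev sym S34)) x1u _ up pa).
  by count_perm.
have vx1 : e v x1.
  by have := Nx x1 xx1 (nu _ x1s2) (nv _ x1s2); rewrite (negbTE nx1u) sym.
have w'u : e w' u.
  have := Nw w' _ (nu _ w's2) (nv _ w's2); rewrite (negbTE nw'v) orbF; apply.
  by rewrite sym.
(* The cycle runs from [u] to [x], over [xw] on to [v], back to [x1], along the middle part to [w']
   and back to [u]. *)
apply: (seg_ham (seg_cat (seg_cat (seg_cat S1 x'x (seg1 e x)) xw S3) vx1 S2') w'u _ up pa).
by count_perm.
Qed.

(** * Closing a Hamilton path when the neighbourhood of [x] consists of two cliques *)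

Section TwoCliques.
Variables (T : finType) (e : rel T) (x : T) (s0 : seq T).
Hypothesis sym : symmetric e.
Hypothesis us0 : uniq s0.
Hypothesis cs0 : forall z, z \in s0.

Definition two_cliques (A B : {set T}) :=
  [/\ forall t, e x t = (t \in A) || (t \in B),
      {in A &, forall s t, s <> t -> e s t} & {in B &, forall s t, s <> t -> e s t}].

(** This is what claw-freeness at a neighbour [c] of [x] provides, [x] being the third leaf. It is a
    separate notion because it is applied to intermediate graphs, which need not be claw-free. *)
Definition outer_clique c := forall s t, e c s -> e c t -> ~~ e x s -> ~~ e x t ->
  s <> x -> t <> x -> s <> t -> e s t.

(** A spanning figure eight: [x] is adjacent to the ends of both parts, one with ends in [A], the
    other with ends in [B]. *)
Definition split_path (A B : {set T}) s1 s2 := perm_eq (s1 ++ x :: s2) s0 /\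
  exists u p q v, [/\ seg e u s1 p, seg e q s2 v, u \in A /\ p \in A & q \in B /\ v \in B].

Lemma two_cliquesC A B : two_cliques A B -> two_cliques B A.
Proof. by case=> Nx cA cB; split=> // t; rewrite Nx orbC. Qed.

Lemma split_pathC A B s1 s2 : split_path A B s1 s2 -> split_path B A (rev s2) (rev s1).
Proof.
case=> ps [u [p [q [v [S1 S2 [uA pA] [qB vB]]]]]]; split.
  by apply: perm_trans ps; count_perm.
by exists v, q, p, u; split=> //; apply: seg_rev.
Qed.

Lemma split_path_uniq A B s1 s2 : split_path A B s1 s2 -> uniq (s1 ++ x :: s2).
Proof. by case=> ps _; rewrite (perm_uniq ps). Qed.

Section Oriented.
Variables (A B : {set T}).
Hypothesis AB : two_cliques A B.

Lemma crossing_ham s1 s2 c d l1 l2 u p : split_path A B s1 s2 -> s1 = l1 ++ l2 ->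
  seg e u l1 c -> seg e d l2 p -> e c d ->
  (c \in B /\ e x d) \/ (c \in A /\ d \in B) -> hamiltonian_rel e.
Proof.
case: AB => Nx cA cB sp E S1 S2 cd; have := split_path_uniq sp.
case: sp => ps [u' [p' [q [v [S S3 [uA pA] [qB vB]]]]]].
have ? : u' = u by case: S S1 => r [er _ _] [r1 [er1 _ _]]; move: er; rewrite E er1 => -[].
have ? : p' = p.
  case: S S2 => r [er _ <-] [r2 [er2 _ <-]]; rewrite -(last_cons u') -er E er2 last_cat //.
subst u' p' s1 => up.
have xA a : a \in A -> e x a by rewrite Nx => ->.
have xB a : a \in B -> e x a by rewrite Nx orbC => ->.
have qs2 := seg_head S3; have vs2 := seg_last S3.
have ul1 := seg_head S1; have cl1 := seg_last S1; have dl2 := seg_head S2; have pl2 := seg_last S2.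
have n12 a b : a \in l1 -> b \in l2 -> a <> b.
  by move=> al bl; move: up; rewrite cat_uniq => /and3P[u12 _ _]; apply: (uniq_cat_neq u12).
have n13 a b : a \in l1 ++ l2 -> b \in s2 -> a <> b.
  by move=> al bl; apply: (uniq_cat_neq up) => //; rewrite inE bl orbT.
have ps' : perm_eq (x :: l1 ++ l2 ++ s2) s0 by apply: perm_trans ps; count_perm.
have fin a b l : seg e a l b -> e b a -> perm_eq l (x :: l1 ++ l2 ++ s2) -> hamiltonian_rel e.
  by move=> sl ba pl; apply: (seg_ham sl ba (perm_trans pl ps')).
have cq : c \in B -> e c q.
  by move=> cB'; apply: cB => //; apply: n13; rewrite // mem_cat cl1.
case=> [[cB' +]|[cA' dB']].
  rewrite Nx => /orP[dA|dB].
  - have pu : e p u by apply: cA => //; apply: nesym; apply: n12.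
    have xd : e x d by apply: xA.
    apply: (fin _ _ _ (seg_cat (seg_cat (seg_cat S1 (cq cB') S3) _ (seg1 e x)) xd S2) pu).
      by rewrite sym xB.
    by count_perm.
  - have vd : e v d by apply: cB => //; apply: nesym; apply: n13; rewrite // mem_cat dl2 orbT.
    apply: (fin _ _ _ (seg_cat (seg_cat (seg_cat S1 (cq cB') S3) vd S2) _ (seg1 e x))).
    + by rewrite sym xA.
    + by rewrite xA.
    + by count_perm.
have cp : e c p by apply: cA => //; apply: n12.
have dq : e d q by apply: cB => //; apply: n13; rewrite // mem_cat dl2 orbT.
apply: (fin _ _ _ (seg_cat (seg_cat (seg_cat S1 cp (seg_rev sym S2)) dq S3) _ (seg1 e x))).
+ by rewrite sym xB.
+ by rewrite xA.
+ by count_perm.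
Qed.

Lemma interior s1 s2 b : split_path A B s1 s2 -> b \in s1 ->
  (exists l, s1 = b :: l) \/ (exists l, s1 = rcons l b) \/
  exists l1 l2 u c d p, [/\ s1 = l1 ++ b :: l2,
   seg e u l1 c /\ seg e d l2 p, [/\ e c b, e b d & c <> d], [/\ c <> x, d <> x, c <> b & d <> b] & u \in A /\ p \in A].
Proof.
move=> sp bs1; have := split_path_uniq sp.
case: sp => ps [u [p [q [v [S S3 [uA pA] [qB vB]]]]]].
case/splitPr: bs1 S {ps} => l1 l2 S up.
have [l10|l1n] := eqVneq l1 [::]; first by left; exists l2; rewrite l10.
have [l20|l2n] := eqVneq l2 [::].
  by right; left; exists l1; rewrite l20 cats1.
right; right; have [c [b' [S1 S2 cb]]] := seg_split l1n (isT : b :: l2 != [::]) S.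
have ? := seg_headE S2; subst b'.
have [b' [d [Sb Sd bd]]] := @seg_split _ _ _ _ [:: b] l2 isT l2n S2.
have ? : b = b' by case: Sb => r [[<-] _].
subst b'; exists l1, l2, u, c, d, p; have cl1 := seg_last S1; have dl2 := seg_head Sd.
move: up; rewrite -!catA /= => up.
have up2 : uniq ((l1 ++ [:: b]) ++ l2 ++ x :: s2) by rewrite -catA.
have up3 : uniq ((l1 ++ b :: l2) ++ x :: s2) by rewrite -catA.
split=> //.
- split=> //; apply: (uniq_cat_neq up) => //; by rewrite inE mem_cat dl2 orbT.
- split.
  + by apply: (uniq_cat_neq up3); rewrite ?mem_cat ?cl1 ?mem_head.
  + by apply: (uniq_cat_neq up3); rewrite ?mem_cat ?inE ?dl2 ?eqxx ?orbT.
  + by apply: (uniq_cat_neq up) => //; rewrite mem_head.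
  + by apply: nesym; apply: (uniq_cat_neq up2); rewrite ?mem_cat ?inE ?dl2 ?eqxx ?orbT.
Qed.

(** The aim is to have [a] at an end, where the edge [ab] can join the two parts. A path neighbour
    of [a] in [B] merges the parts, one in [A] allows a rotation; if both lie outside, they are
    adjacent by [outer_clique], and [a] can be bypassed and attached to an end. *)
Lemma end_at s1 s2 a : split_path A B s1 s2 -> a \in s1 -> a \in A -> outer_clique a ->
  hamiltonian_rel e \/ exists s p, [/\ perm_eq s s1, p \in A & seg e p s a].
Proof.
move=> sp as1 aA oa; have [Nx cA cB] := AB.
have := interior sp as1; case=> [[l E]|[[l E]|]].
- right; case: sp => _ [u [p [q [v [S _ [uA pA] _]]]]].
  exists (rev s1), p; split=> //; first by count_perm.
  by move: (S); rewrite {1}E => /seg_headE ua; rewrite -ua; apply: seg_rev.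
- right; case: sp => _ [u [p [q [v [S _ [uA pA] _]]]]].
  exists s1, u; split=> //.
  suff -> : a = p by [].
  case: (S) => r [er _ rp]; have := erefl (last u s1).
  by rewrite {1}E er last_rcons /= rp.
case=> l1 [l2 [u [c [d [p [E [S1 S2] [ca ad ncd] [ncx ndx nca nda] [uA pA]]]]]]].
have xa : e x a by rewrite Nx aA.
have up := split_path_uniq sp.
have S1a := seg_cat S1 ca (seg1 e a).
have S2a := seg_cat (seg1 e a) ad S2.
have E' : s1 = (l1 ++ [:: a]) ++ l2 by rewrite -catA.
have [cB'|ncB] := boolP (c \in B).
  by left; apply: (crossing_ham sp E S1 S2a ca); left.
have [dB'|ndB] := boolP (d \in B).
  by left; apply: (crossing_ham sp E' S1a S2 ad); right.
have ul1 := seg_head S1; have cl1 := seg_last S1; have dl2 := seg_head S2; have pl2 := seg_last S2.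
have n12 y z : y \in l1 ++ [:: a] -> z \in l2 -> y <> z.
  by move=> yl zl; move: up; rewrite E' cat_uniq => /and3P[u12 _ _]; apply: (uniq_cat_neq u12).
right.
have [cA'|ncA] := boolP (c \in A).
  have cp : e c p by apply: cA => //; apply: n12; rewrite // mem_cat cl1.
  exists (l1 ++ rev (a :: l2)), u; split=> //; first by rewrite E; count_perm.
  exact: seg_cat S1 cp (seg_rev sym S2a).
have [dA'|ndA] := boolP (d \in A).
  have ud : e u d by apply: cA => //; apply: n12; rewrite // mem_cat ul1.
  exists (rev (rev (l1 ++ [:: a]) ++ l2)), p; split=> //; first by rewrite E; count_perm.
  exact: (seg_rev sym (seg_cat (seg_rev sym S1a) ud S2)).
have cd : e c d.
  by apply: oa; rewrite ?Nx ?negb_or ?ncA ?ndA //; rewrite sym.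
have ua : e u a.
  apply: cA => // ua; move: up; rewrite E -ua.
  by case: S1 => r [-> _ _]; rewrite /= !mem_cat inE eqxx !orbT.
exists (rev (l1 ++ l2) ++ [:: a]), p; split=> //; first by rewrite E; count_perm.
exact: seg_cat (seg_rev sym (seg_cat S1 cd S2)) ua (seg1 e a).
Qed.

(** A path neighbour of [b] adjacent to [x] merges the parts. Otherwise both are outside, hence
    adjacent, so [b] can be taken out and put before the other part, whose ends are in its
    clique. *)
Lemma move_to s1 s2 b : split_path A B s1 s2 -> b \in s1 -> b \in B -> b \notin A ->
  outer_clique b ->
  hamiltonian_rel e \/ exists s1', split_path A B s1' (b :: s2) /\ perm_eq s1 (b :: s1').
Proof.
move=> sp bs1 bB nbA ob; have [Nx cA cB] := AB.
have := interior sp bs1; case=> [[l E]|[[l E]|]].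
- case: sp => _ [u [p [q [v [S _ [uA pA] _]]]]].
  by move: (S); rewrite E => /seg_headE ub; move: uA; rewrite ub (negbTE nbA).
- case: sp => _ [u [p [q [v [S _ [uA pA] _]]]]].
  suff bp : b = p by case/negP: nbA; rewrite bp.
  case: (S) => r [er _ rp]; have := erefl (last u s1).
  by rewrite {1}E er last_rcons /= rp.
case=> l1 [l2 [u [c [d [p [E [S1 S2] [cb bd ncd] [ncx ndx ncb ndb] [uA pA]]]]]]].
have xb : e x b by rewrite Nx bB orbT.
have S1b := seg_cat S1 cb (seg1 e b).
have S2b := seg_cat (seg1 e b) bd S2.
have E' : s1 = (l1 ++ [:: b]) ++ l2 by rewrite -catA.
have [xd|nxd] := boolP (e x d).
  by left; apply: (crossing_ham sp E' S1b S2 bd); left.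
have [xc|nxc] := boolP (e x c).
  left; apply: (crossing_ham sp E S1 S2b cb).
  by move: xc; rewrite Nx => /orP[]; [right|left].
right; exists (l1 ++ l2); split; last by rewrite E; count_perm.
have up := split_path_uniq sp.
case: sp => ps [u' [p' [q [v [S S3 _ [qB vB]]]]]]; split.
  by apply: perm_trans ps; rewrite E; count_perm.
exists u, p, b, v; split=> //.
  by apply: (seg_cat S1 _ S2); apply: ob => //; rewrite sym.
apply: (@seg_cat _ _ b b q v [:: b] s2 (seg1 e b) _ S3); apply: cB => //.
by apply: (uniq_cat_neq up) => //; rewrite inE (seg_head S3) orbT.
Qed.

End Oriented.

Variables (A B : {set T}) (a b : T).
Hypothesis AB : two_cliques A B.
Hypothesis disAB : forall z, z \in A -> z \notin B.
Hypothesis aA : a \in A.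
Hypothesis bB : b \in B.
Hypothesis ab : e a b.
Hypothesis oa : outer_clique a.
Hypothesis ob : outer_clique b.

Lemma close_up s1 s2 p q : seg e p s1 a -> seg e q s2 b -> perm_eq (s1 ++ x :: s2) s0 ->
  p \in A -> q \in B -> hamiltonian_rel e.
Proof.
move=> S1 S2 ps pA qB; have [Nx _ _] := AB.
have qx : e q x by rewrite sym Nx qB orbT.
have xp : e x p by rewrite Nx pA.
apply: (seg_ham (seg_cat (seg_cat S1 ab (seg_rev sym S2)) qx (seg1 e x)) xp _ us0 cs0).
by apply: perm_trans ps; count_perm.
Qed.

End TwoCliques.

Section Exchange.
Variables (T : finType) (e : rel T) (x : T) (s0 : seq T).
Hypothesis sym : symmetric e.
Hypothesis us0 : uniq s0.
Hypothesis cs0 : forall z, z \in s0.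

Lemma both_left (A B : {set T}) a b s1 s2 : two_cliques e x A B ->
  (forall z, z \in A -> z \notin B) -> a \in A -> b \in B -> e a b ->
  outer_clique e x a -> outer_clique e x b -> split_path e x s0 A B s1 s2 ->
  a \in s1 -> b \in s1 -> hamiltonian_rel e.
Proof.
move=> AB dis aA bB ab oa ob sp as1 bs1.
have nbA : b \notin A by apply/negP => /dis; rewrite bB.
have nab : a <> b by move=> e1; move: (dis a aA); rewrite e1 bB.
case: (move_to sym us0 cs0 AB sp bs1 bB nbA ob) => // -[s1' [sp' ps]].
have as1' : a \in s1'.
  by have := perm_mem ps a; rewrite as1 inE (introF eqP nab).
case: (end_at sym us0 cs0 AB sp' as1' aA oa) => // -[s [p [pss pA S]]].
case: sp' => ps0 [u' [p' [q [v [_ S3 _ [_ vB]]]]]].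
have ? := seg_headE S3; subst q.
apply: (close_up sym us0 cs0 AB ab S (seg_rev sym S3) _ pA vB).
apply: perm_trans ps0; apply: perm_cat => //.
by rewrite perm_cons perm_rev.
Qed.

Lemma split_path_ham (A B : {set T}) a b s1 s2 : two_cliques e x A B ->
  (forall z, z \in A -> z \notin B) -> a \in A -> b \in B -> e a b -> a <> x -> b <> x ->
  outer_clique e x a -> outer_clique e x b -> split_path e x s0 A B s1 s2 -> hamiltonian_rel e.
Proof.
move=> AB dis aA bB ab nax nbx oa ob sp.
have dis' z : z \in B -> z \notin A by move=> zB; apply/negP => /dis; rewrite zB.
have ba : e b a by rewrite sym.
have inl z r1 r2 : split_path e x s0 A B r1 r2 -> z <> x -> z \in r1 \/ z \in r2.
  case=> ps _ /eqP zx; have := perm_mem ps z; rewrite cs0 mem_cat inE (negbTE zx).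
  by case/orP; auto.
have right r1 r2 : split_path e x s0 A B r1 r2 -> a \in r2 -> b \in r2 -> hamiltonian_rel e.
  move=> sp' ar br.
  apply: (both_left (two_cliquesC AB) dis' bB aA ba ob oa (split_pathC sym sp'));
  by rewrite mem_rev.
case: (inl a s1 s2 sp nax) => as_; case: (inl b s1 s2 sp nbx) => bs.
- exact: (both_left AB dis aA bB ab oa ob sp).
- case: (end_at sym us0 cs0 AB sp as_ aA oa) => // -[r1 [p [p1 pA S1]]].
  have bs' : b \in rev s2 by rewrite mem_rev.
  case: (end_at sym us0 cs0 (two_cliquesC AB) (split_pathC sym sp) bs' bB ob) => // -[r2 [q [p2 qB S2]]].
  apply: (close_up sym us0 cs0 AB ab S1 S2 _ pA qB).
  case: sp => ps _; apply: perm_trans ps; apply: perm_cat => //.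
  by rewrite perm_cons; apply: perm_trans p2 _; rewrite perm_rev.
- case: (move_to sym us0 cs0 AB sp bs bB (dis' b bB) ob) => // -[s1' [sp' ps]].
  by apply: (right _ _ sp'); rewrite inE ?as_ ?eqxx ?orbT.
- exact: right sp as_ bs.
Qed.

End Exchange.

(** If the predecessor of [x] lies in [B] or its successor in [A], the path closes up with an edge
    inside that clique. Otherwise [x] divides it into a [split_path], whose parts are joined with
    the help of the edge [ab]. *)
Lemma ham_of_path2 (T : finType) (e : rel T) (A B : {set T}) u v x a b p :
  symmetric e -> irreflexive e ->
  path e u p -> uniq (u :: p) -> last u p = v -> (forall z, z \in u :: p) ->
  two_cliques e x A B -> (forall z, z \in A -> z \notin B) ->
  u \in A -> v \in B -> a \in A -> b \in B -> e a b ->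
  outer_clique e x a -> outer_clique e x b -> hamiltonian_rel e.
Proof.
move=> sym irr pp up pv pa AB dis uA vB aA bB ab oa ob; have [Nx cA cB] := AB.
have xu : e x u by rewrite Nx uA.
have xv : e x v by rewrite Nx vB orbT.
have nx z : e x z -> z <> x by move=> xz zx; move: xz; rewrite zx irr.
have sg : seg e u (u :: p) v by exists p.
have [s1 [s2 E]] : exists s1 s2, u :: p = s1 ++ x :: s2.
  by case/splitPr: (pa x) => s1 s2; exists s1, s2.
rewrite E in sg up pa.
have s1n : s1 != [::].
  by apply/eqP => s10; move: sg; rewrite s10 => /seg_headE ux; case: (nx u xu).
have [x' [x0 [S1 S23 x'x]]] := seg_split s1n (isT : x :: s2 != [::]) sg.
have ? := seg_headE S23; subst x0.
have s2n : s2 != [::].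
  by apply/eqP => s20; move: S23; rewrite s20 => -[q [[<-] _ /= vw]]; case: (nx v xv).
have [x0 [x1 [X S2 xx1]]] := @seg_split _ _ _ _ [:: x] s2 isT s2n S23.
have ? : x = x0 by case: X => q [[<-] _].
subst x0; have us1 := seg_head S1; have x's1 := seg_last S1.
have x1s2 := seg_head S2; have vs2 := seg_last S2.
have [x'B|] := boolP (x' \in B).
  have vx' : e v x'.
    by apply: cB => //; apply: nesym; apply: (uniq_cat_neq up) => //; rewrite inE vs2 orbT.
  apply: (seg_ham (seg_cat S23 vx' (seg_rev sym S1)) _ _ up pa); first by rewrite sym.
  by count_perm.
have [x1A _|] := boolP (x1 \in A).
  have x1u : e x1 u.
    by apply: cA => //; apply: nesym; apply: (uniq_cat_neq up) => //; rewrite inE x1s2 orbT.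
  apply: (seg_ham (seg_cat (seg_cat S1 x'x (seg1 e x)) xv (seg_rev sym S2)) x1u _ up pa).
  by count_perm.
move=> nx1A nx'B; have x'A : x' \in A by move: x'x; rewrite sym Nx (negbTE nx'B) orbF.
have x1B : x1 \in B by move: xx1; rewrite Nx (negbTE nx1A).
have sp : split_path e x (s1 ++ x :: s2) A B s1 s2 by split=> //; exists u, x', x1, v.
by apply: (split_path_ham sym up pa AB dis aA bB ab _ _ oa ob sp); apply: nx; rewrite Nx ?aA ?bB ?orbT.
Qed.

Section Closure.
Variable T : finType.
Implicit Types e f : rel T.

Definition claw_free_rel e := forall c p q r, e c p -> e c q -> e c r ->
  p <> q -> p <> r -> q <> r -> [\/ e p q, e p r | e q r].

Definition closed_rel e := forall x u w v, e x u -> e x w -> e x v ->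
  e u w -> e w v -> u <> v -> e u v.

Definition complete_at e x : rel T := fun a b =>
  e a b || [&& a != b, e x a & e x b].

Lemma remove_edge_keeps e f u v a b : symmetric e -> subrel e f -> ~~ e u v ->
  e a b -> remove_edge f u v a b.
Proof.
move=> sym ef nuv eab; rewrite /remove_edge ef //=; apply/negP.
by case/orP=> /andP[/eqP ea /eqP eb]; move: nuv; rewrite -ea -eb ?[e b a]sym eab.
Qed.

(** Removing the added edges one at a time leaves only Hamilton paths between the ends of one added
    edge to be treated, over any intermediate graph [f]. *)
Lemma peel e e' : symmetric e -> subrel e e' -> symmetric e' ->
  (forall f u v, symmetric f -> subrel e f -> subrel f e' -> f u v -> ~~ e u v ->
     hamiltonian_rel f -> hamiltonian_rel (remove_edge f u v)) -> hamiltonian_rel e' -> hamiltonian_rel e.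
Proof.
move=> sym ee' sym' H; suff gen n f : #|[set p : T * T | f p.1 p.2 && ~~ e p.1 p.2]| < n ->
    symmetric f -> subrel e f -> subrel f e' -> hamiltonian_rel f -> hamiltonian_rel e.
  by apply: (gen _ e' (leqnn _)).
elim: n f => // n IH f; rewrite ltnS => fn symf ef fe' hf.
have [[u [v [fuv neuv]]]|no] := pselect (exists u v, f u v /\ ~~ e u v).
  apply: (IH (remove_edge f u v)).
  - apply: leq_trans fn; apply: proper_card; apply/properP; split.
      by apply/subsetP => -[a b]; rewrite !inE /remove_edge /= => /andP[/andP[-> _] ->].
    by exists (u, v); rewrite !inE /remove_edge /= ?eqxx ?fuv ?neuv ?andbF.
  - exact: remove_edge_sym.
  - by move=> a b; apply: remove_edge_keeps.
  - by move=> a b /andP[/fe'].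
  - exact: H.
have [c [uc cc ca]] := hf; exists c; split=> //.
rewrite (eq_cycle (e' := f)) // => a b; apply/idP/idP; first exact: ef.
by move=> fab; apply: contrapT => /negP neab; apply: no; exists a, b.
Qed.

Lemma complete_at_sym e x : symmetric e -> symmetric (complete_at e x).
Proof. by move=> sym a b; rewrite /complete_at sym eq_sym [e x a && _]andbC. Qed.

Lemma complete_at_irr e x : irreflexive e -> irreflexive (complete_at e x).
Proof. by move=> irr a; rewrite /complete_at irr eqxx. Qed.

(** If a claw at [c] has a leaf [p] with both [c] and [p] adjacent to [x], its other leaves are not
    adjacent to [x], and replacing [p] by [x] gives a claw of the old graph. *)
Lemma complete_at_claw_free e x : symmetric e -> irreflexive e ->
  claw_free_rel e -> claw_free_rel (complete_at e x).
Proof.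
move=> sym irr cf.
have cf' c p q r : e x c -> e x p -> c != p -> complete_at e x c q -> complete_at e x c r ->
    p <> q -> p <> r -> q <> r -> [\/ complete_at e x p q, complete_at e x p r | complete_at e x q r].
  move=> xc xp cp cq cr /eqP pq /eqP pr /eqP qr.
  have [xq|nxq] := boolP (e x q); first by constructor 1; rewrite /complete_at pq xp xq orbT.
  have [xr|nxr] := boolP (e x r); first by constructor 2; rewrite /complete_at pr xp xr orbT.
  move: cq cr; rewrite /complete_at (negbTE nxq) (negbTE nxr) !andbF !orbF => cq cr.
  have cx : e c x by rewrite sym.
  have [xq|/eqP xq] := eqVneq x q.
    by constructor 1; rewrite /complete_at -xq sym xp.
  have [xr|/eqP xr] := eqVneq x r.
    by constructor 2; rewrite /complete_at -xr sym xp.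
  case: (cf c x q r cx cq cr xq xr (elimN eqP qr)) => h.
  - by rewrite h in nxq.
  - by rewrite h in nxr.
  - by constructor 3; rewrite h.
move=> c p q r cp cq cr pq pr qr.
have [[/eqP ncp xc xp]|ncp] := pselect [/\ c <> p, e x c & e x p].
  exact: (cf' c p q r).
have [[/eqP ncq xc xq]|ncq] := pselect [/\ c <> q, e x c & e x q].
  case: (cf' c q p r xc xq ncq cp cr (nesym pq) qr pr) => h.
  - by constructor 1; rewrite complete_at_sym.
  - by constructor 3.
  - by constructor 2.
have [[/eqP ncr xc xr]|ncr] := pselect [/\ c <> r, e x c & e x r].
  case: (cf' c r p q xc xr ncr cp cq (nesym pr) (nesym qr) pq) => h.
  - by constructor 2; rewrite complete_at_sym.
  - by constructor 3; rewrite complete_at_sym.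
  - by constructor 1.
have old z : complete_at e x c z -> ~ [/\ c <> z, e x c & e x z] -> e c z.
  by case/orP=> // /and3P[/eqP ? ? ?] [].
case: (cf c p q r (old p cp ncp) (old q cq ncq) (old r cr ncr) pq pr qr) => h.
- by constructor 1; rewrite /complete_at h.
- by constructor 2; rewrite /complete_at h.
- by constructor 3; rewrite /complete_at h.
Qed.

(** Two cases: either any two nonadjacent neighbours of [x] have a common neighbour among the
    neighbours of [x], which serves as [w] in [ham_of_path]; or one such pair has none, and its two
    sides are disjoint cliques covering the neighbourhood, joined by an edge, as in
    [ham_of_path2]. *)
Lemma complete_at_ham e x u w v : 2 < #|T| -> symmetric e -> irreflexive e -> claw_free_rel e ->
  e x u -> e x w -> e x v -> e u w -> e w v -> u <> v -> ~~ e u v ->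
  hamiltonian_rel (complete_at e x) -> hamiltonian_rel e.
Proof.
move=> T3 sym irr cf xu xw xv uw wv nuv neuv.
have new f a b : subrel f (complete_at e x) -> f a b -> ~~ e a b -> [/\ e x a, e x b & a <> b].
  by move=> fc /fc /orP[->//|/and3P[/eqP ? -> ->]].
have atx f t : subrel e f -> subrel f (complete_at e x) -> f x t = e x t.
  move=> ef fe; apply/idP/idP => [/fe/orP[//|/and3P[_]]|/ef //]; by rewrite irr.
have irrf f : subrel f (complete_at e x) -> irreflexive f.
  by move=> fe a; apply/negP => /fe; rewrite complete_at_irr.
have ec : subrel e (complete_at e x) by move=> a b; rewrite /complete_at => ->.
have rem f a b : subrel f (complete_at e x) -> subrel (remove_edge f a b) (complete_at e x).
  by move=> fc c d /andP[/fc].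
have xclaw a b t : e x a -> e x b -> e x t -> a <> b -> ~~ e a b -> t <> a -> t <> b -> e t a || e t b.
  move=> xa xb xt ab nab ta tb.
  by case: (cf x t a b xt xa xb ta tb ab) => [->|->|h]; rewrite ?orbT //; rewrite h in nab.
have [near|far] := pselect (forall a b, e x a -> e x b -> a <> b -> ~~ e a b ->
    exists c, [/\ e x c, e c a & e c b]).
  apply: peel => // [|f a b symf ef fc fab nab hf]; first exact: complete_at_sym.
  have [xa xb neq] := new f a b fc fab nab.
  have [//|[p [pp up pl pa]]] := hamilton_path symf a b T3 hf.
  have [c [xc ca cb]] := near a b xa xb neq nab.
  set f0 := remove_edge f a b in pp *.
  have ef0 c' d : e c' d -> f0 c' d by apply: remove_edge_keeps.
  have f0c : subrel f0 (complete_at e x) by apply: rem.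
  have xt t : f0 x t -> t <> a -> t <> b -> f0 t a || f0 t b.
    rewrite (atx f0 t ef0 f0c) => xt ta tb.
    by case/orP: (xclaw a b t xa xb xt neq nab ta tb) => /ef0 ->; rewrite ?orbT.
  apply: (@ham_of_path _ f0 a b x c p) => //; try by apply: ef0.
  - exact: remove_edge_sym.
  - exact: irrf.
  move=> t ct ta tb; have [ect|nect] := boolP (e c t); last first.
    by have [_ ? _] := new f0 c t f0c ct nect; apply: xt => //; apply: ef0.
  case: (cf c t a b ect ca cb ta tb neq) => [/ef0 ->|/ef0 ->|h]; rewrite ?orbT //.
  by rewrite h in nab.
have [u0 [v0 [xu0 xv0 nuv0 neuv0 noc]]] : exists u0 v0, [/\ e x u0, e x v0, u0 <> v0, ~~ e u0 v0
    & forall c, e x c -> e c u0 -> ~~ e c v0].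
  apply: contrapT => no; apply: far => a b xa xb ab nab; apply: contrapT => no2.
  apply: no; exists a, b; split=> // c xc ca; apply/negP => cb.
  by apply: no2; exists c.
pose side y := [set t | e x t && ((t == y) || e t y)].
have clique y z : e x y -> e x z -> y <> z -> ~~ e y z -> (forall c, e x c -> e c y -> ~~ e c z) ->
    {in side y &, forall s t, s <> t -> e s t}.
  move=> xy xz nyz neyz nc s t; rewrite !inE => /andP[xs sy] /andP[xt ty] st.
  have off c : e x c -> (c == y) || e c y -> c <> z /\ ~~ e c z.
    move=> xc /orP[/eqP -> //|cy]; split; last exact: nc.
    by move=> cz; move: neyz; rewrite -cz sym cy.
  have [sz nsz] := off s xs sy; have [tz ntz] := off t xt ty.
  case: (cf x s t z xs xt xz st sz tz) => // h; by [rewrite h in nsz|rewrite h in ntz].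
have noc' c : e x c -> e c v0 -> ~~ e c u0.
  by move=> xc cv; apply/negP => cu; move: (noc c xc cu); rewrite cv.
have cA := clique u0 v0 xu0 xv0 nuv0 neuv0 noc.
have cB : {in side v0 &, forall s t, s <> t -> e s t}.
  by apply: (clique v0 u0 xv0 xu0 (nesym nuv0) _ noc'); rewrite sym.
have AorB t : e x t -> (t \in side u0) || (t \in side v0).
  move=> xt; rewrite !inE xt /=.
  have [->|/eqP tu] := eqVneq t u0; first by [].
  have [->|/eqP tv] := eqVneq t v0; first by rewrite orbT.
  by rewrite /=; apply: xclaw.
have dis t : t \in side u0 -> t \notin side v0.
  rewrite !inE => /andP[xt /orP[/eqP ->|tu]].
    by rewrite (introF eqP nuv0) (negbTE neuv0) andbF.
  rewrite negb_and negb_or (negbTE (noc t xt tu)) andbT; apply/orP; right.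
  by apply/eqP => tv; move: neuv0; rewrite -tv sym tu.
have inx t y : t \in side y -> e x t by rewrite inE => /andP[].
(* One of the edges [uw] and [wv] changes sides, since [u] and [v] would be adjacent in a common
   clique. *)
have [a [b [aA bB ab]]] : exists a b, [/\ a \in side u0, b \in side v0 & e a b].
  have cross s t : e s t -> e x s -> e x t -> (s \in side u0) <> (t \in side u0) ->
      exists a b, [/\ a \in side u0, b \in side v0 & e a b].
    move=> st xs xt; have := AorB s xs; have := AorB t xt.
    case sA: (s \in side u0); case tA: (t \in side u0) => //= tB sB _.
      by exists s, t.
    by exists t, s; rewrite sym.
  have [uwA|] := pselect ((u \in side u0) = (w \in side u0)); last exact: cross.
  apply: (cross w v) => // wvA; move/negP: neuv; apply.
  have := AorB u xu; case uA: (u \in side u0) => /= uB.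
    by apply: cA => //; rewrite -wvA -uwA.
  apply: cB => //; have := AorB v xv; by rewrite -wvA -uwA uA.
apply: peel => // [|f c d symf ef fc fcd ncd hf]; first exact: complete_at_sym.
have [xc xd neq] := new f c d fc fcd ncd.
have [//|[p [pp up pl pa]]] := hamilton_path symf c d T3 hf.
set f0 := remove_edge f c d in pp *.
have ef0 s t : e s t -> f0 s t by apply: remove_edge_keeps.
have f0c : subrel f0 (complete_at e x) by apply: rem.
have symf0 : symmetric f0 by apply: remove_edge_sym.
have irr0 := irrf f0 f0c.
have two : two_cliques f0 x (side u0) (side v0).
  split=> [t|s t sA tA st|s t sB tB st].
  - by rewrite (atx f0 t ef0 f0c); apply/idP/orP => [/AorB/orP //|[/inx|/inx]].
  - by apply: ef0; apply: cA.
  - by apply: ef0; apply: cB.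
have out y : e x y -> outer_clique f0 x y.
  move=> xy s t ys yt; rewrite !(atx f0 _ ef0 f0c) => nxs nxt sx tx st.
  have eys z : f0 y z -> ~~ e x z -> e y z.
    by move=> yz nxz; apply: contraNT nxz => nyz; have [] := new f0 y z f0c yz nyz.
  have yx : e y x by rewrite sym.
  case: (cf y x s t yx (eys s ys nxs) (eys t yt nxt) (nesym sx) (nesym tx) st) => h.
  - by rewrite h in nxs.
  - by rewrite h in nxt.
  - exact: ef0.
have dis' t : t \in side v0 -> t \notin side u0 by move=> tB; apply/negP => /dis; rewrite tB.
have oa := out a (inx _ _ aA); have ob := out b (inx _ _ bB).
have eab := ef0 a b ab; have eba : f0 b a by rewrite symf0.
have [cA'|ncA] := boolP (c \in side u0).
  apply: (@ham_of_path2 _ f0 (side u0) (side v0) c d x a b p) => //.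
  have := AorB d xd; have [dA|//] := boolP (d \in side u0).
  by move: ncd; rewrite cA.
have cB' : c \in side v0 by have := AorB c xc; rewrite (negbTE ncA).
apply: (@ham_of_path2 _ f0 (side v0) (side u0) c d x b a p) => //.
  exact: two_cliquesC.
have := AorB d xd; have [//|dA /= dB] := boolP (d \in side u0).
by move: ncd; rewrite cB.
Qed.

Lemma closure e : 2 < #|T| -> symmetric e -> irreflexive e -> claw_free_rel e ->
  exists e', [/\ symmetric e', irreflexive e', claw_free_rel e' /\ closed_rel e',
    subrel e e' & hamiltonian_rel e' -> hamiltonian_rel e].
Proof.
move=> T3; have [n] := ubnP #|[set p : T * T | ~~ e p.1 p.2]|.
elim: n e => // n IH e; rewrite ltnS => en sym irr cf.
have [cl|ncl] := pselect (closed_rel e); first by exists e; split.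
have [x [u [w [v [[xu xw xv] uw wv nuv neuv]]]]] : exists x u w v, [/\ [/\ e x u, e x w & e x v],
    e u w, e w v, u <> v & ~~ e u v].
  apply: contrapT => no; apply: ncl => x u w v xu xw xv uw wv nuv.
  by apply: contrapT => /negP neuv; apply: no; exists x, u, w, v.
have [| | | |e' [sym' irr' cf' sub h]] := IH (complete_at e x).
- apply: leq_trans en; apply: proper_card; apply/properP; split.
    by apply/subsetP => -[a b]; rewrite !inE /complete_at /= negb_or => /andP[].
  by exists (u, v); rewrite !inE /complete_at /= ?neuv // xu xv (introF eqP nuv) orbT.
- exact: complete_at_sym.
- exact: complete_at_irr.
- exact: complete_at_claw_free.
exists e'; split=> // [a b eab|he']; first by apply: sub; rewrite /complete_at eab.
exact: (complete_at_ham T3 sym irr cf xu xw xv uw wv nuv neuv (h he')).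
Qed.

End Closure.

(** * The hypergraph of a closed claw-free graph *)

Lemma uniq_map_inj (A B : eqType) (f : A -> B) c : uniq [seq f p | p <- c] ->
  {in c &, injective f}.
Proof.
elim: c => //= p c IH /andP[fp uc] q r; rewrite !inE => /orP[/eqP ->|qc] /orP[/eqP ->|rc] // E.
- by move: fp; rewrite E map_f.
- by move: fp; rewrite -E map_f.
- exact: IH.
Qed.

Lemma uniq_flatten_map (A B : eqType) (f : A -> seq B) c : uniq c ->
  (forall p, p \in c -> uniq (f p)) ->
  (forall p q b, p \in c -> q \in c -> b \in f p -> b \in f q -> p = q) ->
  uniq (flatten [seq f p | p <- c]).
Proof.
elim: c => //= p c IH /andP[pc uc] uf dis; rewrite cat_uniq uf ?mem_head //= IH //; last first.
- by move=> q r b qc rc; apply: dis; rewrite inE ?qc ?rc orbT.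
- by move=> q qc; apply: uf; rewrite inE qc orbT.
rewrite andbT; apply/hasPn => b /flatten_mapP[q qc bq]; apply/negP => bp.
by move: pc; rewrite (dis p q b) ?mem_head ?qc // inE qc orbT.
Qed.

Lemma seg_flatten (A : eqType) (T : finType) (e : rel T) (fs ls : A -> T) (f : A -> seq T) p c :
  path (fun q r => e (ls q) (fs r)) p c ->
  (forall q, q \in p :: c -> seg e (fs q) (f q) (ls q)) ->
  seg e (fs p) (flatten [seq f q | q <- p :: c]) (ls (last p c)).
Proof.
elim: c p => [|q c IH] p /=; first by move=> _ sf; rewrite cats0; apply: sf; rewrite mem_head.
case/andP=> pq pc sf; apply: seg_cat pq _; first by apply: sf; rewrite mem_head.
by apply: IH => // r rc; apply: sf; rewrite inE rc orbT.
Qed.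

Lemma seg_clique (T : finType) (e : rel T) (P : T -> Prop) a q :
  (forall x y, P x -> P y -> x <> y -> e x y) ->
  (forall x, x \in a :: q -> P x) -> uniq (a :: q) -> seg e a (a :: q) (last a q).
Proof.
move=> cl; elim: q a => [|b q IH] a Pq uq; first exact: seg1.
have /andP[aq ubq] := uq.
apply: (@seg_cat _ _ a a b _ [:: a] (b :: q) (seg1 e a)).
  apply: cl; [apply: Pq|apply: Pq|]; rewrite ?mem_head ?inE ?eqxx ?orbT //.
  by move=> ab; move: aq; rewrite ab mem_head.
by apply: IH => // x xq; apply: Pq; rewrite inE xq orbT.
Qed.

Section ClosedGraph.
Variables (T : finType) (e : rel T).
Hypothesis sym : symmetric e.
Hypothesis irr : irreflexive e.
Hypothesis cf : claw_free_rel e.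
Hypothesis cl : closed_rel e.

(* In a closed graph, the maximal clique containing the edge [x y]. *)
Definition clq x y := [set z | [|| z == x, z == y | e z x && e z y]].

Definition nodes := [set clq p.1 p.2 | p in [set p : T * T | e p.1 p.2]].

Lemma nodesP N : reflect (exists x y, e x y /\ N = clq x y) (N \in nodes).
Proof.
apply: (iffP imsetP) => [[[x y]]|[x [y [exy ->]]]].
  by rewrite inE /= => exy ->; exists x, y.
by exists (x, y); rewrite // inE.
Qed.

Lemma edge_neq x y : e x y -> x <> y.
Proof. by move=> exy xy; move: exy; rewrite xy irr. Qed.

Lemma clq_clique x y a b : e x y -> a \in clq x y -> b \in clq x y -> a <> b -> e a b.
Proof.
move=> exy; rewrite !inE.
case/or3P=> [/eqP ->|/eqP ->|/andP[ax ay]]; case/or3P=> [/eqP ->|/eqP ->|/andP[bx by_]] // ab;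
  try by rewrite // sym.
by apply: (cl (x := x) (w := y)); rewrite // sym.
Qed.

Lemma clq_eq x y u v : e x y -> u \in clq x y -> v \in clq x y -> u <> v -> clq u v = clq x y.
Proof.
move=> exy uN vN uv; have cN := clq_clique exy; have euv := cN u v uN vN uv.
have xN : x \in clq x y by rewrite !inE eqxx.
have yN : y \in clq x y by rewrite !inE eqxx orbT.
have adj w z : z \in clq x y -> e w u -> e w v -> w = z \/ e w z.
  move=> zN wu wv; have [->|/eqP zu] := eqVneq z u; first by right.
  have [->|/eqP zv] := eqVneq z v; first by right.
  have [->|/eqP wz] := eqVneq w z; [by left | right].
  apply: (cl (x := u) (w := v)) => //; try by rewrite sym.
    by apply: cN => //; apply: nesym.
  by apply: cN => //; apply: nesym.
apply/setP => w; apply/idP/idP => [|wN]; last first.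
  rewrite !inE; have [//|/eqP wu] := eqVneq w u; have [//|/eqP wv] := eqVneq w v.
  by rewrite /= !cN.
rewrite inE => /or3P[/eqP -> //|/eqP -> //|/andP[wu wv]].
case: (adj w x xN wu wv) => [->//|wx]; case: (adj w y yN wu wv) => [->//|wy].
by rewrite !inE wx wy !orbT.
Qed.

Lemma node_clique N a b : N \in nodes -> a \in N -> b \in N -> a <> b -> e a b.
Proof. by case/nodesP=> x [y [exy ->]]; apply: clq_clique. Qed.

Lemma node_clq N a b : N \in nodes -> a \in N -> b \in N -> a <> b -> N = clq a b.
Proof. by case/nodesP=> x [y [exy ->]] ? ? ?; rewrite (clq_eq exy). Qed.

Lemma node_uniq N N' a b : N \in nodes -> N' \in nodes -> a \in N -> b \in N ->
  a \in N' -> b \in N' -> a <> b -> N = N'.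
Proof. by move=> nN nN' aN bN aN' bN' ab; rewrite (node_clq nN aN bN ab) (node_clq nN' aN' bN' ab). Qed.

Lemma clq_node x y : e x y -> [/\ clq x y \in nodes, x \in clq x y & y \in clq x y].
Proof. by move=> exy; split; rewrite ?inE ?eqxx ?orbT //; apply/nodesP; exists x, y. Qed.

Lemma node_other_vertex N x : N \in nodes -> x \in N -> exists y, [/\ y \in N, e x y & N = clq x y].
Proof.
move=> nN xN; case/nodesP: (nN) => a [b [eab E]].
have [_ aN bN] := clq_node eab; rewrite -E in aN bN.
have [xa|/eqP xa] := eqVneq x a.
  by exists b; split=> //; rewrite xa.
by exists a; split=> //; [apply: (node_clique nN xN aN xa) | apply: node_clq xa].
Qed.

(** Neighbours of [x] in different nodes are nonadjacent, so three nodes at [x] would give a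
    claw. *)
Lemma two_nodes N1 N2 N3 x : N1 \in nodes -> N2 \in nodes -> N3 \in nodes ->
  x \in N1 -> x \in N2 -> x \in N3 -> [\/ N1 = N2, N1 = N3 | N2 = N3].
Proof.
move=> n1 n2 n3 x1 x2 x3.
have [y1 [y1N xy1 E1]] := node_other_vertex n1 x1.
have [y2 [y2N xy2 E2]] := node_other_vertex n2 x2.
have [y3 [y3N xy3 E3]] := node_other_vertex n3 x3.
have eqN N N' y y' : N \in nodes -> N' \in nodes -> x \in N -> x \in N' -> y \in N -> y' \in N' ->
    e x y -> e x y' -> y = y' \/ e y y' -> N = N'.
  move=> nN nN' xN xN' yN yN' xy xy' h.
  apply: (node_uniq nN nN' xN _ xN' yN' (edge_neq xy')).
  case: h => [<- //|yy']; rewrite (node_clq nN xN yN (edge_neq xy)) !inE.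
  by rewrite [e y' x]sym xy' [e y' y]sym yy' !orbT.
have [y12|/eqP y12] := eqVneq y1 y2; first by constructor 1; apply: (eqN _ _ y1 y2); auto.
have [y13|/eqP y13] := eqVneq y1 y3; first by constructor 2; apply: (eqN _ _ y1 y3); auto.
have [y23|/eqP y23] := eqVneq y2 y3; first by constructor 3; apply: (eqN _ _ y2 y3); auto.
case: (cf xy1 xy2 xy3 y12 y13 y23) => h.
- by constructor 1; apply: (eqN _ _ y1 y2); auto.
- by constructor 2; apply: (eqN _ _ y1 y3); auto.
- by constructor 3; apply: (eqN _ _ y2 y3); auto.
Qed.

Hypothesis mindeg : forall x, 6 <= #|[set y | e x y]|.

(** Inside [N], the vertex [x] has at most 5 neighbours. Two nodes contain all its neighbours, and
    [x] is counted in both: 6 + 2 = 8. *)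
Lemma other_node N x : N \in nodes -> x \in N -> #|N| <= 6 ->
  exists N', [/\ N' \in nodes, N' != N, x \in N' & 8 <= #|N| + #|N'|].
Proof.
move=> nN xN N6; have cD (M : {set T}) : x \in M -> #|M| = #|M :\ x|.+1 by move=> xM; rewrite (cardsD1 x) xM.
have [y xy yN] : exists2 y, e x y & y \notin N.
  apply: contrapT => no; have : [set y | e x y] \subset N :\ x.
    apply/subsetP => y; rewrite !inE => xy; rewrite eq_sym (introF eqP (edge_neq xy)) /=.
    by apply: contrapT => /negP yN; apply: no; exists y.
  by move/subset_leq_card => h; have := mindeg x; rewrite cD // in N6; lia.
have [nN' xN' yN'] := clq_node xy.
exists (clq x y); split=> //; first by apply: contraNneq yN => <-.
have : [set z | e x z] \subset (N :\ x) :|: (clq x y :\ x).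
  apply/subsetP => z; rewrite inE => xz; rewrite in_setU !in_setD1 eq_sym (introF eqP (edge_neq xz)) /=.
  have [nz xNz zNz] := clq_node xz.
  case: (two_nodes nN nN' nz xN xN' xNz) => h.
  - by move: yN; rewrite h yN'.
  - by rewrite h zNz.
  - by rewrite h zNz orbT.
move/subset_leq_card; have := mindeg x; rewrite cardsU (cD N xN) (cD _ xN').
by move: #|N :\ x| #|clq x y :\ x| #|_ :&: _| #|[set y0 | e x y0]| => a b c d; lia.
Qed.

Definition isbig N := (N \in nodes) && (4 <= #|N|).
Definition bigT := {N : {set T} | isbig N}.

Lemma big_node (C : bigT) : val C \in nodes. Proof. by case/andP: (valP C). Qed.
Lemma big_card (C : bigT) : 4 <= #|val C|. Proof. by case/andP: (valP C). Qed.

Lemma in_big x : exists C : bigT, x \in val C.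
Proof.
have /card_gt0P[y] : 0 < #|[set y | e x y]| by apply: leq_trans (mindeg x).
rewrite inE => /clq_node[nN xN _].
have mk N : N \in nodes -> 4 <= #|N| -> x \in N -> exists C : bigT, x \in val C.
  move=> nN' N4 xN'; have bN : isbig N by rewrite /isbig nN' N4.
  by exists (Sub N bN).
have [N4|N4] := leqP 4 #|clq x y|; first exact: mk nN N4 xN.
have [N' [nN' _ xN' N8]] := other_node nN xN (ltnW (ltn_trans N4 (isT : 4 < 6))).
by apply: (mk N') => //; move: N4 N8; lia.
Qed.

Definition small N := (N \in nodes) && (#|N| < 4).

Lemma small_big N (C : bigT) : small N -> N <> val C.
Proof. by case/andP=> _ N4 E; have := big_card C; rewrite -E leqNgt N4. Qed.

(* A small node of size 3 is a degree-3 vertex of the preimage, to be used as a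
   hyperedge; one of size 2 is a suppressed degree-2 vertex. *)
Definition hyperedge (f : T + {set T}) : {set bigT} :=
  match f with
  | inl v => [set C : bigT | v \in val C]
  | inr N => if small N then [set C : bigT | N :&: val C != set0] else set0
  end.

Lemma hyp_l v : #|hyperedge (inl v)| <= 2.
Proof.
rewrite leqNgt; apply/negP => /card_gt2P[C1 [C2 [C3 [[]]]]]; rewrite !inE => v1 v2 v3 [n12 n23 n31].
case: (two_nodes (big_node C1) (big_node C2) (big_node C3) v1 v2 v3) => /val_inj h.
- by rewrite h eqxx in n12.
- by rewrite h eqxx in n31.
- by rewrite h eqxx in n23.
Qed.

Lemma small_one_big N v (C D : bigT) : small N -> v \in N -> v \in val C -> v \in val D -> C = D.
Proof.
move=> sN vN vC vD; have nN : N \in nodes by case/andP: sN.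
case: (two_nodes nN (big_node C) (big_node D) vN vC vD) => [/(small_big sN)|/(small_big sN)|/val_inj] //.
Qed.

(** A vertex of a small node lies in only one big node, so common vertices inject the big nodes
    meeting [N] into [N]. *)
Lemma hyp3 f : #|hyperedge f| <= 3.
Proof.
case: f => [v|N] /=; first exact: leq_trans (hyp_l v) _.
case: ifP => [sN|_]; last by rewrite cards0.
have [/andP[nN N4]] : small N /\ True by [].
have [x [y [_ E]]] := nodesP _ nN => _.
pose f (C : bigT) := odflt x [pick v in N :&: val C].
have fP C : C \in [set C : bigT | N :&: val C != set0] -> f C \in N :&: val C.
  rewrite inE => /set0Pn[v vI]; rewrite /f; case: pickP => [//|/(_ v)].
  by rewrite vI.
rewrite -(card_in_imset (f := f)) => [|C D /fP + /fP + fCD].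
  rewrite -ltnS; apply: leq_trans N4; rewrite ltnS; apply: subset_leq_card.
  by apply/subsetP => _ /imsetP[C /fP + ->]; rewrite inE => /andP[].
rewrite fCD !inE => /andP[vN vC] /andP[_ vD].
exact: small_one_big sN vN vC vD.
Qed.

Hypothesis conn : forall S : {set T}, #|S| < 5 -> forall x y, x \notin S -> y \notin S ->
  connect [rel a b | [&& a \notin S, b \notin S & e a b]] x y.

(** * Small cuts of the hypergraph and vertex cuts of the graph *)

Section Cut.
Variable X : {set bigT}.

Definition side w := [exists C in X, w \in val C].

(* A vertex whose deletion leaves the rest of a crossing hyperedge on one side. *)
Definition cutv (f : T + {set T}) : option T :=
  match f with
  | inl v => Some v
  | inr N => [pick v in N | [forall w in N, forall w' in N,
               (w != v) && (w' != v) ==> (side w == side w')]]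
  end.

(** Of at most three vertices, at most one is on the minority side; if there is none, any vertex
    will do. *)
Lemma cutvP N : small N -> exists2 v, cutv (inr N) = Some v &
  forall w w', w \in N -> w' \in N -> w <> v -> w' <> v -> side w = side w'.
Proof.
move=> sN; rewrite /cutv; case: pickP => [v /andP[vN /forall_inP h]|none].
  exists v => // w w' wN w'N /eqP wv /eqP w'v.
  by have /forall_inP/(_ w' w'N) := h w wN; rewrite wv w'v => /eqP.
have /andP[nN N4] := sN; have [x [y [exy E]]] := nodesP _ nN.
have xN : x \in N by rewrite E !inE eqxx.
pose A := [set w in N | side w]; pose B := [set w in N | ~~ side w].
have AB : #|A| + #|B| = #|N|.
  rewrite -(cardsID A N); congr (_ + _); apply: eq_card => w; rewrite !inE; by case: (w \in N); case: (side w).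
have minority (b : bool) (M : {set T}) : M = [set w in N | side w == b] -> #|M| <= 1 -> False.
  move=> EM M1; have [v vN vM] : exists2 v, v \in N & forall w, w \in N -> w != v -> side w != b.
    have [M0|[v vM]] := set_0Vmem M.
      by exists x => // w wN _; move/setP/(_ w): M0; rewrite EM !inE wN /= => ->.
    have vM2 := vM; rewrite EM inE in vM; case/andP: vM => vN _; exists v => // w wN wv.
    apply: contraNN wv => sw; apply/eqP.
    by move/card_le1_eqP: M1; apply; rewrite // EM inE wN.
  have /negP := none v; apply; rewrite vN /=; apply/forall_inP => w wN; apply/forall_inP => w' w'N.
  apply/implyP => /andP[wv w'v]; have := vM w wN wv; have := vM w' w'N w'v.
  by case: b {EM vM}; case: (side w); case: (side w').
have [A1|A2] := leqP #|A| 1.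
  by case: (minority true A) => //; apply/setP => w; rewrite !inE eqb_id.
case: (minority false B) => //; last by lia.
by apply/setP => w; rewrite !inE eqbF_neg.
Qed.

Definition crossings := [set f | crossing hyperedge X f].

Definition separator := [set v | Some v \in cutv @: crossings].

Lemma card_separator : #|separator| <= #|crossings|.
Proof.
apply: leq_trans (leq_imset_card cutv _).
have si : injective (@Some T) by move=> a b [].
rewrite -(card_imset _ si); apply: subset_leq_card.
by apply/subsetP => _ /imsetP[v + ->]; rewrite inE.
Qed.

Lemma crossing_l v (C D : bigT) : v \in val C -> v \in val D -> C \in X -> D \notin X ->
  v \in separator.
Proof.
move=> vC vD CX DX; rewrite inE; apply/imsetP; exists (inl v) => //.
rewrite inE /crossing; apply/andP; split; first by apply/set0Pn; exists C; rewrite !inE vC.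
by apply/subsetPn; exists D; rewrite // inE.
Qed.

(** Off the separator, the big nodes at a vertex lie on one side. This settles edges in big nodes. A
    small node either crosses, and then its remaining vertices agree, or meets big nodes of one side
    only. *)
Lemma same_side a b : a \notin separator -> b \notin separator -> e a b -> side a = side b.
Proof.
move=> aS bS eab; have [nN aN bN] := clq_node eab.
have bigside v (C : bigT) : v \notin separator -> v \in val C -> side v = (C \in X).
  move=> vS vC; apply/existsP/idP => [[D /andP[DX vD]]|CX]; last by exists C; rewrite CX.
  by apply: contrapT => /negP CX; move: vS; rewrite (crossing_l vD vC DX CX).
have [N4|N4] := leqP 4 #|clq a b|.
  have bN4 : isbig (clq a b) by rewrite /isbig nN N4.
  by rewrite (bigside a (Sub _ bN4)) // (bigside b (Sub _ bN4)).
have sN : small (clq a b) by rewrite /small nN N4.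
have [v cv vP] := cutvP sN.
have [cr|ncr] := boolP (crossing hyperedge X (inr (clq a b))).
  have vS : v \in separator by rewrite inE -cv; apply: imset_f; rewrite inE.
  by apply: vP => // ev; move: vS; rewrite -ev ?(negbTE aS) ?(negbTE bS).
have inh w (C : bigT) : w \in clq a b -> w \in val C -> C \in hyperedge (inr (clq a b)).
  by move=> wN wC; rewrite /= sN inE; apply/set0Pn; exists w; rewrite inE wN.
have [Ca aC] := in_big a; have [Cb bC] := in_big b.
rewrite (bigside a Ca) // (bigside b Cb) //.
have ha := inh a Ca aN aC; have hb := inh b Cb bN bC.
move: ncr; rewrite negb_and !negbK => /orP[/eqP h0|/subsetP hX]; last by rewrite !hX.
have out (C : bigT) : C \in hyperedge (inr (clq a b)) -> C \in X = false.
  by move=> hC; apply/negP => CX; move/setP/(_ C): h0; rewrite in_setI hC CX inE.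
by rewrite !out.
Qed.

Definition span_of (Y : {set bigT}) := [set w | [exists C in Y, w \in val C]].

(** Otherwise each side keeps a vertex off the separator, and by 5-connectivity a path joins the
    two, along which the side never changes. *)
Lemma small_side : #|crossings| <= 4 -> #|span_of X| <= 4 \/ #|span_of (~: X)| <= 4.
Proof.
move=> c4; have S4 : #|separator| < 5 by rewrite ltnS; apply: leq_trans card_separator c4.
have [|X5] := leqP #|span_of X| 4; first by left.
have [|Y5] := leqP #|span_of (~: X)| 4; first by right.
have pick5 (A : {set T}) : 4 < #|A| -> exists2 a, a \in A & a \notin separator.
  move=> A5; have /subsetPn : ~~ (A \subset separator).
    by apply/negP => /subset_leq_card; rewrite leqNgt; apply/negP; rewrite negbK; apply: leq_trans S4 A5.
  by case=> a aA aS; exists a.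
have [a aX aS] := pick5 _ X5; have [b bY bS] := pick5 _ Y5.
have sa : side a by move: aX; rewrite inE.
have sb : ~~ side b.
  move: bY; rewrite inE => /existsP[D /andP[DX bD]]; apply/negP => /existsP[C /andP[CX bC]].
  by rewrite inE in DX; move: bS; rewrite (crossing_l bC bD CX DX).
suff : side a = side b by rewrite sa (negbTE sb).
have /connectP[p pp ->] := conn S4 aS bS; clear - pp cf cl mindeg sym irr.
elim: p a pp => //= c p IH a /andP[/and3P[aS cS ac] /IH <-].
exact: same_side.
Qed.

Lemma single_big (Y : {set bigT}) : Y != set0 -> #|span_of Y| <= 4 ->
  exists C, Y = [set C] /\ #|val C| = 4.
Proof.
case/set0Pn=> C CY Y4.
have sub (D : bigT) : D \in Y -> val D \subset span_of Y.
  by move=> DY; apply/subsetP => w wD; rewrite inE; apply/existsP; exists D; rewrite DY.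
have valE (D : bigT) : D \in Y -> val D = span_of Y.
  by move=> DY; apply/eqP; rewrite eqEcard sub // (leq_trans Y4 (big_card D)).
exists C; split.
  apply/setP => D; rewrite inE; apply/idP/eqP => [DY|->] //.
  by apply: val_inj; rewrite !valE.
by apply/eqP; rewrite eqn_leq big_card andbT valE.
Qed.

End Cut.

Lemma crossingC X f : crossing hyperedge (~: X) f = crossing hyperedge X f.
Proof.
rewrite /crossing; have -> : (hyperedge f :&: ~: X != set0) = ~~ (hyperedge f \subset X).
  by rewrite -setDE setD_eq0.
by rewrite andbC -disjoints_subset -setI_eq0.
Qed.

Lemma other_big (C : bigT) v : #|val C| = 4 -> v \in val C -> exists2 D : bigT, v \in val D & D != C.
Proof.
move=> C4 vC; have [|N' [nN' NC vN' N8]] := other_node (big_node C) vC; first by rewrite C4.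
have bN : isbig N' by rewrite /isbig nN'; move: N8; rewrite C4; lia.
by exists (Sub _ bN) => //; apply: contraNneq NC => <-.
Qed.

(** Each of the 4 vertices lies in a second big node, which makes its own hyperedge cross and leaves
    no room for a small node at it. *)
Lemma single_degree (C : bigT) : #|val C| = 4 -> 4 <= #|crossings [set C]| /\
  forall N, ~~ crossing hyperedge [set C] (inr N).
Proof.
move=> C4; split.
  have il : injective (@inl T {set T}) by move=> a b [].
  rewrite -C4 -(card_imset _ il); apply: subset_leq_card.
  apply/subsetP => _ /imsetP[v vC ->]; have [D vD DC] := other_big C4 vC.
  rewrite inE /crossing; apply/andP; split.
    by apply/set0Pn; exists C; rewrite !inE vC eqxx.
  by apply/subsetPn; exists D; rewrite !inE.
move=> N; apply/negP => /andP[/set0Pn[D]]; rewrite inE in_set1 => /andP[Dh /eqP DC] _.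
move: Dh; rewrite {}DC /=; case: ifP => [sN|_]; last by rewrite inE.
rewrite inE => /set0Pn[v]; rewrite inE => /andP[vN vC].
have [D' vD DC] := other_big C4 vC.
by move: DC; rewrite (small_one_big sN vN vD vC) eqxx.
Qed.

Lemma small_crossings X : X != set0 -> X != setT -> #|crossings X| <= 4 ->
  4 <= #|crossings X| /\ forall N, ~~ crossing hyperedge X (inr N).
Proof.
move=> X0 XT c4; case: (small_side c4) => h.
  by have [C [-> C4]] := single_big X0 h; apply: single_degree.
have cX0 : ~: X != set0 by apply: contra XT => /eqP cX; rewrite -(setCK X) cX setC0.
have [C [E C4]] := single_big cX0 h; have [c1 c2] := single_degree C4.
have -> : crossings X = crossings [set C].
  by rewrite -E; apply/setP => f; rewrite !inE crossingC.
by split=> // N; rewrite -crossingC E.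
Qed.

Lemma hyp_deg4 X : X != set0 -> X != setT -> 4 <= #|[set f | crossing hyperedge X f]|.
Proof.
move=> X0 XT; have [c|c] := leqP #|crossings X| 4; last exact: ltnW.
by have [] := small_crossings X0 XT c.
Qed.

Lemma hyp_deg5 X f : X != set0 -> X != setT -> crossing hyperedge X f -> #|hyperedge f| = 3 ->
  5 <= #|[set f | crossing hyperedge X f]|.
Proof.
move=> X0 XT cr f3; have [c|//] := leqP #|crossings X| 4.
have [_ no] := small_crossings X0 XT c; case: f cr f3 => [v _ f3|N].
  by have := hyp_l v; rewrite f3.
by move=> cr; have := no N; rewrite cr.
Qed.

Lemma clique_ham : 1 < #|T| -> (forall a b : T, a <> b -> e a b) -> hamiltonian_rel e.
Proof.
move=> T1 all; have := mem_enum T; have := enum_uniq T.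
have : size (enum T) = #|T| by rewrite cardE.
case E: (enum T) => [|a q] sz ue me; first by rewrite -sz in T1.
have sg := @seg_clique _ e (fun=> True) a q (fun x y _ _ => all x y) (fun _ _ => I) ue.
exists (a :: q); split=> [//||x]; last by rewrite me.
apply: (seg_cycle sg); apply: all => la; case: q sz ue la {E me sg} => [|b q] sz; first by rewrite -sz in T1.
by move=> /andP[/negP aq _] /= la; apply: aq; have := mem_last b q; rewrite la.
Qed.

(** A closed trail through all big nodes is turned into a Hamilton cycle. A hyperedge [inl v] is
    passed through [v], which lies in both big nodes; a hyperedge [inr N] along an edge of [N].
    Between them the cycle stays inside a big node, where further vertices can be inserted. *)
Lemma closed_ham : 1 < #|T| -> hamiltonian_rel e.
Proof.
move=> T1; have /card_gt0P[x0 _] := ltnW T1.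
have [C0 _] := in_big x0.
have V0 : 0 < #|{: bigT}| by apply/card_gt0P; exists C0.
have [V1|V1] := leqP #|{: bigT}| 1.
  apply: clique_ham => // a b; have [Ca aC] := in_big a; have [Cb bC] := in_big b.
  have CC : Ca = Cb by apply: (card_le1_eqP V1).
  by apply: (node_clique (big_node Ca)) => //; rewrite CC.
have [pi [wfp fp Tf Kf]] := skeletal_full hyp3 V0 hyp_deg4 hyp_deg5.
have [s [ws Ts evs]] := even_spanning hyp3 wfp fp Tf Kf.
have s2 f := proj2 (ws f).
have [c [c1 cc uc2 cv]] := euler_trail s2 Ts evs V1.
have uc : uniq c by apply: map_uniq uc2.
pose nx p := (next c p).1.
have snd_inj p q : p \in c -> q \in c -> p.2 = q.2 -> p = q.
  by move=> pc qc; apply: (uniq_map_inj uc2).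
have ends p : p \in c -> [/\ p.1 \in hyperedge p.2, nx p \in hyperedge p.2 & p.1 <> nx p].
  move=> pc; have /= /eqP sp := next_cycle cc pc.
  have sub := proj1 (ws p.2); rewrite sp in sub.
  split; try by apply: (subsetP sub); rewrite !inE eqxx ?orbT.
  move=> ee; case: (s2 p.2) => [|[a [b [/eqP nab]]]]; rewrite sp.
    by move/setP/(_ p.1); rewrite !inE eqxx.
  by move=> E; have := cards2 a b; rewrite -E -/(nx p) -ee setUid cards1 nab.
pose vt (N : {set T}) (C : bigT) := odflt x0 [pick v in N :&: val C].
have vtP N C : C \in hyperedge (inr N) -> [/\ small N, vt N C \in N & vt N C \in val C].
  rewrite /=; case: ifP => [sN|_]; last by rewrite inE.
  rewrite inE /vt => /set0Pn[v vN]; case: pickP => [w|/(_ v)]; last by rewrite vN.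
  by rewrite inE => /andP[].
pose fs0 (p : bigT * (T + {set T})) := match p.2 with inl v => v | inr N => vt N p.1 end.
pose ls (p : bigT * (T + {set T})) := match p.2 with inl v => v | inr N => vt N (nx p) end.
pose block (p : bigT * (T + {set T})) :=
  match p.2 with inl v => [:: v] | inr N => [:: vt N p.1; vt N (nx p)] end.
have fs0P p : p \in c -> fs0 p \in val p.1.
  move=> pc; have [h1 h2 _] := ends p pc; rewrite /fs0; move: h1; case: p.2 => [v|N].
    by rewrite inE.
  by case/vtP.
have lsP p : p \in c -> ls p \in val (nx p).
  move=> pc; have [h1 h2 _] := ends p pc; rewrite /ls; move: h2; case: p.2 => [v|N].
    by rewrite inE.
  by case/vtP.
have two_in_small p N : p \in c -> p.2 = inr N ->
    [/\ small N, vt N p.1 \in N, vt N (nx p) \in N & vt N p.1 <> vt N (nx p)].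
  move=> pc pN; have [h1 h2 nn] := ends p pc; rewrite pN in h1 h2.
  have [sN i1 j1] := vtP _ _ h1; have [_ i2 j2] := vtP _ _ h2; split=> // ee.
  by apply: nn; apply: (small_one_big sN i1 j1); rewrite ee.
have block_seg p : p \in c -> seg e (fs0 p) (block p) (ls p).
  move=> pc; rewrite /fs0 /block /ls; case E: p.2 => [v|N]; first exact: seg1.
  have [sN i1 i2 ne] := two_in_small p N pc E; have /andP[nN _] := sN.
  by apply: (@seg_cat _ _ _ _ _ _ [:: _] [:: _] (seg1 e _) _ (seg1 e _)); apply: (node_clique nN).
have block_uniq p : p \in c -> uniq (block p).
  move=> pc; rewrite /block; case E: p.2 => [v|N] //=.
  by have [_ _ _ /eqP ne] := two_in_small p N pc E; rewrite inE ne.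
(* A vertex that the trail passes lies in two big nodes, hence in no small one. *)
have mixed p q v N : p \in c -> q \in c -> p.2 = inl v -> q.2 = inr N -> v \notin N.
  move=> pc qc pv qN; have [h1 h2 nn] := ends p pc; have [sN _ _ _] := two_in_small q N qc qN.
  rewrite pv !inE in h1 h2; apply/negP => vN; apply: nn; exact: small_one_big sN vN h1 h2.
have block_in p N w : p \in c -> p.2 = inr N -> w \in block p -> w \in N.
  move=> pc pN; have [_ i1 i2 _] := two_in_small p N pc pN.
  by rewrite /block pN !inE => /orP[] /eqP ->.
have block_dis p q w : p \in c -> q \in c -> w \in block p -> w \in block q -> p = q.
  move=> pc qc wp wq; apply: snd_inj => //.
  case Ep: p.2 => [v|N]; case Eq: q.2 => [v'|N'].
  - by move: wp wq; rewrite /block Ep Eq !inE => /eqP -> /eqP ->.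
  - have := mixed p q v N' pc qc Ep Eq; move: wp; rewrite {1}/block Ep inE => /eqP <-.
    by rewrite (block_in q).
  - have := mixed q p v' N qc pc Eq Ep; move: wq; rewrite {1}/block Eq inE => /eqP <-.
    by rewrite (block_in p).
  - have [sN _ _ _] := two_in_small p N pc Ep; have [sN' _ _ _] := two_in_small q N' qc Eq.
    have [C wC] := in_big w; have /andP[nN _] := sN; have /andP[nN' _] := sN'.
    case: (two_nodes nN nN' (big_node C) (block_in p N w pc Ep wp) (block_in q N' w qc Eq wq) wC).
    + by move=> ->.
    + by move/(small_big sN).
    + by move/(small_big sN').
pose used := flatten [seq block p | p <- c].
have usedP w : reflect (exists2 p, p \in c & w \in block p) (w \in used) by apply: flatten_mapP.
have [p0 p0c] : exists p, p \in c by case: (c) c1 => // p c' _; exists p; rewrite mem_head.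
pose occ C := odflt p0 [pick p | (p \in c) && (p.1 == C)].
have occP C : occ C \in c /\ (occ C).1 = C.
  rewrite /occ; case: pickP => [p /andP[pc /eqP]//|none].
  by have /mapP[p pc E] := cv C; have := none p; rewrite pc -E eqxx.
pose g x := odflt C0 [pick C : bigT | x \in val C].
have gP x : x \in val (g x).
  by rewrite /g; case: pickP => [//|none]; have [C xC] := in_big x; have := none C; rewrite xC.
(* The vertices off the trail, inserted at a visit of a clique containing them. *)
pose extra p := [seq x <- enum T | (x \notin used) && (occ (g x) == p)].
have extraP p x : x \in extra p -> x \notin used /\ x \in val p.1.
  rewrite mem_filter => /andP[/andP[xu /eqP <-] _]; split=> //.
  by have [_ ->] := occP (g x).
have extra_uniq p : uniq (extra p) by rewrite filter_uniq ?enum_uniq.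
pose fs p := head (fs0 p) (extra p).
pose blk p := extra p ++ block p.
have fs0_block p : p \in c -> fs0 p \in block p by move=> /block_seg/seg_head.
have fsP p : p \in c -> fs p \in val p.1.
  move=> pc; rewrite /fs; case E: (extra p) => [|a q] /=; first exact: fs0P.
  by have [] := extraP p a; rewrite ?E ?mem_head.
have blk_seg p : p \in c -> seg e (fs p) (blk p) (ls p).
  move=> pc; rewrite /fs /blk; case E: (extra p) => [|a q] /=; first exact: block_seg.
  have inE' x : x \in a :: q -> x \notin used /\ x \in val p.1 by rewrite -E; apply: extraP.
  have sg : seg e a (a :: q) (last a q).
    apply: (@seg_clique _ e (fun x => x \in val p.1)) => [x y||]; first exact: node_clique (big_node _).
      by move=> x /inE'[].
    by rewrite -E.
  have [lu lp] := inE' _ (mem_last a q).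
  apply: (seg_cat sg _ (block_seg p pc)); apply: (node_clique (big_node p.1)) => //.
    exact: fs0P.
  by move=> le; move: lu; rewrite le; apply/negP; rewrite negbK; apply/usedP; exists p; rewrite ?fs0_block.
have blk_dis p q w : p \in c -> q \in c -> w \in blk p -> w \in blk q -> p = q.
  move=> pc qc; rewrite !mem_cat; case/orP=> wp /orP[] wq.
  - by move: wp wq; rewrite !mem_filter => /andP[/andP[_ /eqP <-] _] /andP[/andP[_ /eqP <-] _].
  - by have [/usedP[]] := extraP _ _ wp; exists q.
  - by have [/usedP[]] := extraP _ _ wq; exists p.
  - exact: block_dis wp wq.
have linked : cycle (fun p q => e (ls p) (fs q)) c.
  apply: cycle_from_next => // p pc; have nc : next c p \in c by rewrite mem_next.
  apply: (node_clique (big_node (nx p))); [exact: lsP|exact: fsP|move=> le].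
  have [_ _ []] := ends p pc.
  have lb := seg_last (blk_seg p pc); have fb := seg_head (blk_seg _ nc).
  by rewrite /nx -(blk_dis p (next c p) (ls p)) // le.
have cover x : x \in flatten [seq blk p | p <- c].
  apply/flatten_mapP; have [/usedP[p pc xp]|xu] := boolP (x \in used).
    by exists p; rewrite // mem_cat xp orbT.
  have [oc _] := occP (g x); exists (occ (g x)); rewrite // mem_cat mem_filter xu eqxx.
  by rewrite mem_enum.
exists (flatten [seq blk p | p <- c]); split=> //.
  apply: uniq_flatten_map => // p pc; rewrite cat_uniq extra_uniq block_uniq //= andbT.
  apply/hasPn => x xb; apply/negP => /extraP[/usedP[]]; by exists p.
case: (c) linked blk_seg => //= p c' linked blk_seg.
have /andP[pl ll] : path (fun p q => e (ls p) (fs q)) p c' && e (ls (last p c')) (fs p).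
  by rewrite -rcons_path.
exact: seg_cycle (seg_flatten pl blk_seg) ll.
Qed.

End ClosedGraph.

(** * From multigraphs to the adjacency relation and back *)

Lemma adj_sym G : symmetric (@adj G).
Proof. by move=> x y; apply: eq_existsb => f; rewrite setUC. Qed.

Lemma adj_irr G : irreflexive (@adj G).
Proof.
move=> x; apply/negbTE; rewrite /= negb_exists; apply/forallP => f; apply/eqP => ef.
by have := card_ends f; rewrite ef setUid cards1.
Qed.

Lemma claw_free_adj G : claw_free G -> claw_free_rel (@adj G).
Proof.
move=> cf c p q r cp cq cr pq pr qr; apply: contrapT => no; apply: cf.
have nadj (x y : vertex G) : (adj x y -> False) -> adj x y = false by move=> h; apply/negbTE/negP/h.
have npq : adj p q = false by apply: nadj => h; apply: no; constructor 1.
have npr : adj p r = false by apply: nadj => h; apply: no; constructor 2.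
have nqr : adj q r = false by apply: nadj => h; apply: no; constructor 3.
have neq (x y : vertex G) : adj x y -> x != y by move=> h; apply/eqP => xy; move: h; rewrite xy adj_irr.
exists (tnth [tuple c; p; q; r]); split.
  apply/tuple_uniqP; rewrite /= !inE !negb_or (neq _ _ cp) (neq _ _ cq) (neq _ _ cr).
  by rewrite (introF eqP pq) (introF eqP pr) (introF eqP qr).
move=> i j; case: i => -[|[|[|[|//]]]] i4; case: j => -[|[|[|[|//]]]] j4;
  by rewrite !(tnth_nth c) /= ?adj_irr ?cp ?cq ?cr ?npq ?npr ?nqr // adj_sym ?cp ?cq ?cr ?npq ?npr ?nqr.
Qed.

Lemma next_next (T : eqType) (c : seq T) v : 2 < size c -> uniq c -> v \in c ->
  next c (next c v) != v.
Proof.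
move=> c3 uc vc; have [i q rc] := rot_to vc.
have : 2 < size (v :: q) by rewrite -rc size_rot.
have : uniq (v :: q) by rewrite -rc rot_uniq.
rewrite -!(next_rot i uc) rc; case: q {rc} => [|b [|d r]] //=.
rewrite !inE !negb_or => /and3P[/and3P[vb vd vr] /andP[bd br] _] _.
by rewrite !eqxx [b == v]eq_sym (negbTE vb) eq_sym.
Qed.

Lemma ham_hamiltonian G : 2 < #|vertex G| -> hamiltonian_rel (@adj G) -> hamiltonian G.
Proof.
move=> G3 [c [uc cc ca]].
have c3 : 2 < size c.
  rewrite -(card_uniqP uc); apply: leq_trans G3 _; apply: subset_leq_card.
  by apply/subsetP => x _; apply: ca.
have [v0 _] : exists v0, v0 \in c by case: (c) c3 => // v0 q _; exists v0; rewrite mem_head.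
have := next_cycle cc (ca v0); rewrite {1}/adj /= => /existsP[f0 _].
pose ed v := odflt f0 [pick f | ends f == [set v; next c v]].
have edP v : ends (ed v) = [set v; next c v].
  rewrite /ed; case: pickP => [f /eqP //|none].
  by have := next_cycle cc (ca v); rewrite {1}/adj /= => /existsP[f ef]; have := none f; rewrite ef.
(* An edge chosen at two distinct vertices would make each the successor of the other, impossible on
   a cycle of length at least 3. *)
have ed_inj : injective ed.
  move=> v w vw; have := edP v; rewrite vw edP => /setP E.
  have := E v; rewrite !inE eqxx /= => /orP[/eqP //|/eqP vE].
  have := E w; rewrite !inE eqxx /= => /esym/orP[/eqP -> //|/eqP wE].
  by have := next_next c3 uc (ca v); rewrite -wE -vE eqxx.
exists [seq (v, ed v) | v <- c]; have fstE : [seq p.1 | p <- [seq (v, ed v) | v <- c]] = c.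
  by rewrite -map_comp map_id_in.
split; last by move=> x; rewrite fstE.
split; rewrite ?fstE ?size_map //; first exact: ltnW.
  have : cycle (fun v w => ends (ed v) == [set v; w]) c.
    by apply: cycle_from_next => // v _; rewrite edP.
  by case: (c) => //= v q; rewrite -map_rcons path_map.
by rewrite -map_comp map_inj_in_uniq // => v w _ _; apply: ed_inj.
Qed.

Theorem corollary25 (G : mgraph) :
  k_connected G 5 -> claw_free G -> min_degree_at_least G 6 -> hamiltonian G.
Proof.
move=> [G5 conn] cf mindeg; have G3 : 2 < #|vertex G| by lia.
apply: ham_hamiltonian => //.
have [e [sym irr [cfe cle] sub he]] := closure G3 (@adj_sym G) (@adj_irr G) (claw_free_adj cf).
(* The closure only adds edges, so degrees and connectivity carry over. *)
apply: he; apply: (closed_ham sym irr cfe cle); last by lia.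
- move=> x; apply: leq_trans (mindeg x) _; apply: subset_leq_card.
  by apply/subsetP => y; rewrite !inE; apply: sub.
- move=> S S5 x y xS yS; have := conn S S5 x y xS yS; apply: connect_sub => a b /and3P[aS bS ab].
  by apply: connect1; rewrite /= aS bS sub.
Qed.
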